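(* Let $n\ge 1$ and let $D_M\ge 1$ be an integer. Let $H\in\mathbb{R}^{n\times n}$ be symmetric with $H_mI\le H\le H_MI$ for known positive scalars $H_m,H_M$. Let $\sigma_0>0$; suppose that $\theta^*\in\mathbb{R}^n$ is uncertain from a known ball with radius $\sigma_0$, its components satisfying $\theta_i^*\in[\underline\theta_i^*,\overline\theta_i^*]$, $i=1,\dots,n$, with $\sum_{i=1}^n(\overline\theta_i^*-\underline\theta_i^* )^2=\sigma_0^2$, that $|\theta(0)-\theta^*|\le\sigma_0$, and that $|Q^*-Q_0|\le\Delta_Q$ with known $Q_0\in\mathbb{R}$ and $\Delta_Q>0$. Let $a_1,\dots,a_n>0$, $\alpha_0>0$ and let $k,\lambda,\omega_h>0$ satisfy $$kH_m>\lambda,\qquad \omega_h>2\lambda .$$ Consider the estimation error system for $(\tilde\theta,\tilde\eta)$ defined in the context, with an unknown time-varying delay $D(j)\in\mathbb{Z}$ satisfying $0\le D(j)\le D_M$ for all $j\ge 0$. Let $\sigma>\sigma_0$. Suppose there exists $\varepsilon^*>0$ such that (a) $nD_M\lfloor \tfrac{1}{\sqrt{\varepsilon^*}}\rfloor\ge 2n+1$; (b) $\varepsilon^*\max\{\lambda+kH_m,\ \omega_h+2\lambda-\varepsilon^*\lambda^2\}<2$; (c) $\displaystyle \big(\sigma_0+\sqrt{\varepsilon^*}\Delta_G|1-\varepsilon^*\lambda|^{D_M}\big)|1-\varepsilon^*kH_m|^{-D_M}+\sqrt{\varepsilon^*}\Delta_G+\frac{(\sqrt{\varepsilon^*})^3\Delta_Y}{|1-\varepsilon^*\lambda|-|1-\varepsilon^*kH_m|}<\sigma,$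 where the constants $\Delta_G,\Delta_Y$ (and $\sigma_\eta$ below) are defined in the context. Then for all $\varepsilon\in(0,\varepsilon^*]$, $$|\tilde\theta(j)|<\sigma|1-\varepsilon\lambda|^j,\qquad |\tilde\eta(j)|<\sigma_\eta|1-\varepsilon\lambda|^{2j},\qquad j\ge D_M,$$ meaning that the estimation error system is exponentially stable with decay rate $|1-\varepsilon\lambda|$. Thus, $\theta(j)$ converges exponentially to $\theta^*$ with decay rate $|1-\varepsilon\lambda|$. Moreover, for any $D_M\geq 1$ and $\sigma_0>0$, inequalities (a), (b), (c) are always feasible for small enough $\varepsilon^*,k,\lambda$ and appropriate $\sigma>\sigma_0$.
   Context: Notation: $|\cdot|$ is the Euclidean norm on $\mathbb{R}^n$; $|x|_P^2=x^TPx$; $\lfloor\cdot\rfloor$ is the floor; time $j$ runs over nonnegative integers. ''Decay rate $r$'' means a bound by a constant times $r^j$. Map and measurements: $Q(\theta)=Q^*+\frac12|\theta-\theta^*|_H^2$ on $\mathbb{R}^n$ ($\theta^*$, $Q^*$ unknown). Delayed measurements: $y(j)=0$ for $0\le j<D_M$ and $y(j)=Q(\theta(j-D(j)))$ for $j\ge D_M$. Dithers: for $\varepsilon>0$, $T=\max\{nD_M\lfloor 1/\sqrt\varepsilon\rfloor,\,2n+1\}$, $\omega_i=2\pi i/T$, $S(j)=[S_1(j),\dots,S_n(j)]^T$ with $S_i(j)=a_i\sin(\omega_ij)$, $M(j)=[M_1(j),\dots,M_n(j)]^T$ with $M_i(j)=\frac{2}{a_i}\sin(\omega_ij)$, $\alpha(j)=\alpha_0(1-\varepsilon\lambda)^j$.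 Algorithm: $\hat\theta(j)=\theta(0)$ for $0\le j\le D_M$ and $\hat\theta(j+1)=\hat\theta(j)-\varepsilon\frac{kM(j)}{\alpha(j)}[y(j)-\eta(j)]$ for $j\ge D_M$; $\eta(D_M)=Q_0$ and $\eta(j+1)=\eta(j)+\varepsilon\omega_h[y(j)-\eta(j)]$ for $j\ge D_M$. The input is $\theta(j)=\theta(0)$ for $0\le j\le D_M$ and $\theta(j)=\hat\theta(j)+\alpha(j)S(j)$ for $j>D_M$. Estimation error system: $\tilde\theta(j)=\hat\theta(j)-\theta^*$ ($j\ge0$), $\tilde\eta(j)=\eta(j)-Q^*$ ($j\ge D_M$). Thus $\tilde\theta(j)=\theta(0)-\theta^*$ for $0\le j\le D_M$, $\tilde\eta(D_M)=Q_0-Q^*$, and for $j\ge D_M$: $\tilde\theta(j+1)=\tilde\theta(j)-\varepsilon\frac{kM(j)}{\alpha(j)}[y(j)-Q^*-\tilde\eta(j)]$, $\ \tilde\eta(j+1)=\tilde\eta(j)-\varepsilon\omega_h[\tilde\eta(j)-y(j)+Q^*]$. Constants $\bar\rho_l$ (with $\varepsilon$ below taken equal to $\varepsilon^*$): $\bar\rho_1=0.19245\,nD_MkH_M\Big[\sum_{i=1}^n\frac1i+\sum_{1\le i\ne l\le n}\frac{a_l}{a_i}\big(\frac{1}{|i-l|}+\frac{1}{i+l}\big)\Big]$, $\bar\rho_2=0.3849\,nD_Mk\sum_{i=1}^n\frac{1}{ia_i}$, $\bar\rho_3=kH_M\big(\sum_{s=1}^na_s^2\big)\sqrt{\sum_{i=1}^n\frac{c_i^2}{a_i^2}}$,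 $\bar\rho_4=0.19245\,nD_Mk\sum_{i=1}^n\frac{1}{ia_i}$, where $$c_i=\frac{(nD_M+\sqrt\varepsilon)(2nD_M+\sqrt\varepsilon)}{12}+\frac{\sqrt\varepsilon(\sqrt\varepsilon+nD_M)+D_M^2n^2\big(1+\frac{1}{3.3072\pi i}\big)}{3.3072\,\pi i}.$$ Let $A=\sqrt{\sum_{i=1}^na_i^2}$ and $B=\sqrt{\sum_{i=1}^n a_i^{-2}}$. Then $$\sigma_y=\tfrac{H_M}{2}|1-\varepsilon^*\lambda|^{-2D_M}(\sigma+\alpha_0A)^2,$$ $$\sigma_\eta=\Delta_Q|1-\varepsilon^*\omega_h|^{-D_M}+\frac{\varepsilon^*\omega_h\sigma_y}{|1-\varepsilon^*\lambda|^2-|1-\varepsilon^*\omega_h|},$$ $$\Delta_G=\bar\rho_1\sigma+\bar\rho_2\frac{\sigma_\eta}{\alpha_0}+\bar\rho_3\alpha_0+\bar\rho_4\frac{\sigma^2H_M}{\alpha_0},$$ $$\Delta=\frac{2k}{\alpha_0}\Big[\frac{H_M}{2}(\sigma+\alpha_0A)^2+\sigma_\eta\Big]B,$$ $$\bar\Delta_{out}=\frac{kD_MH_M}{\alpha_0}B\,[\sigma+\alpha_0A]\,\big[1+|1-\varepsilon^*\lambda|^{-D_M}\big]\Bigg[\frac{2\sqrt{\varepsilon^*}k(\sigma_y+\sigma_\eta)}{\alpha_0}B+\frac{\alpha_0A\Big(\lambda\sqrt{\varepsilon^*}+\frac{2\pi}{(1-\sqrt{\varepsilon^*})D_M}\Big[\frac{\pi\sqrt{\varepsilon^*}}{(1-\sqrt{\varepsilon^*})D_M}+1\Big]\Big)}{|1-\varepsilon^*\lambda|}\Bigg],$$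 $$\begin{aligned}\Delta_Y={}&kH_M\Delta_G+\bar\rho_1(\Delta+\sqrt{\varepsilon^*}\bar\Delta_{out})+\frac{\omega_h\bar\rho_2}{\alpha_0}[\sigma_y+\sigma_\eta]+\frac{\bar\rho_2\lambda(\sigma_\eta|1-\varepsilon^*\omega_h|+\varepsilon^*\omega_h\sigma_y)}{\alpha_0|1-\varepsilon^*\lambda|}\\&+\bar\rho_3\alpha_0\lambda+2\bar\rho_4\sigma\alpha_0^{-1}H_M(\Delta+\sqrt{\varepsilon^*}\bar\Delta_{out})+\bar\Delta_{out}+\varepsilon^*\bar\rho_4\alpha_0^{-1}H_M(\Delta+\sqrt{\varepsilon^*}\bar\Delta_{out})^2\\&+\frac{\bar\rho_4\alpha_0^{-1}\lambda}{|1-\varepsilon^*\lambda|}H_M\big[\sigma+\varepsilon^*(\Delta+\sqrt{\varepsilon^*}\bar\Delta_{out})\big]^2.\end{aligned}$$ *)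

(* Defs.v *)
From HB Require Import structures.
From mathcomp Require Import all_boot all_order all_algebra.
From mathcomp Require Import reals trigo.

Set Implicit Arguments.
Unset Strict Implicit.
Unset Printing Implicit Defensive.

Import Order.TTheory GRing.Theory Num.Theory.
Local Open Scope ring_scope.

Section Vectors.
Context {R : realType} {n : nat}.
Implicit Types (x : 'cV[R]_n) (P : 'M[R]_n).

(* The library norm `|x| on matrices is the sup norm, hence this definition. *)
Definition enorm x : R := Num.sqrt (\sum_i x i 0 ^+ 2).

Definition wnorm2 P x : R := (x^T *m P *m x) 0 0.

End Vectors.

(* The known data and the parameters that stay fixed while the gains k, lambda
   and the bounds eps_star, sigma are chosen. Positivity is assumed where the
   data are used. *)
Record design (R : realType) (n : nat) := Design {
  D_M : nat;
  H_m : R;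
  H_M : R;
  sigma0 : R;
  Delta_Q : R;
  a : 'I_n -> R;
  alpha0 : R;
  omega_h : R }.

Section Algorithm.
Context {R : realType} {n : nat}.
Variables (p : design R n) (k lambda eps : R).

Definition period : nat :=
  maxn (n * D_M p * Num.truncn (1 / Num.sqrt eps)) (2 * n + 1).

(* omega_i = 2 pi i / T for i = 1, ..., n; ordinals start at 0. *)
Definition omega (i : 'I_n) : R := 2 * pi * i.+1%:R / period%:R.

Definition dither (j : nat) : 'cV[R]_n := \col_i (a p i * sin (omega i * j%:R)).

Definition demod (j : nat) : 'cV[R]_n := \col_i (2 / a p i * sin (omega i * j%:R)).

Definition alpha (j : nat) : R := alpha0 p * (1 - eps * lambda) ^+ j.

Definition quad_map (H : 'M[R]_n) (theta_star : 'cV[R]_n) (Q_star : R)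
    (theta : 'cV[R]_n) : R :=
  Q_star + 1 / 2 * wnorm2 H (theta - theta_star).

Definition input (theta_init : 'cV[R]_n) (theta_hat : nat -> 'cV[R]_n)
    (j : nat) : 'cV[R]_n :=
  if (j <= D_M p)%N then theta_init else theta_hat j + alpha j *: dither j.

(* The subtraction j - D j is on nat; it is exact since D j <= D_M p. *)
Definition measurement (Q : 'cV[R]_n -> R) (D : nat -> nat)
    (theta : nat -> 'cV[R]_n) (j : nat) : R :=
  if (j < D_M p)%N then 0 else Q (theta (j - D j)%N).

(* eta is unconstrained, and never read, before time D_M p. *)
Record algorithm (Q : 'cV[R]_n -> R) (D : nat -> nat)
    (theta_init : 'cV[R]_n) (Q_0 : R)
    (theta_hat : nat -> 'cV[R]_n) (eta : nat -> R) : Prop := Algorithm {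
  theta_hat_init : forall j, (j <= D_M p)%N -> theta_hat j = theta_init;
  theta_hat_step : forall j, (D_M p <= j)%N ->
    let y := measurement Q D (input theta_init theta_hat) in
    theta_hat j.+1
      = theta_hat j - (eps * k / alpha j * (y j - eta j)) *: demod j;
  eta_init : eta (D_M p) = Q_0;
  eta_step : forall j, (D_M p <= j)%N ->
    let y := measurement Q D (input theta_init theta_hat) in
    eta j.+1 = eta j + eps * omega_h p * (y j - eta j) }.

End Algorithm.

Section Constants.
Context {R : realType} {n : nat}.
Variables (p : design R n) (k lambda sigma eps : R).

Local Notation D := (D_M p).
Local Notation nD := (n%:R * (D_M p)%:R : R).
Local Notation a := (a p).
Local Notation alpha0 := (alpha0 p).
Local Notation omega_h := (omega_h p).
Local Notation H_m := (H_m p).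
Local Notation H_M := (H_M p).
Local Notation se := (Num.sqrt eps).
Local Notation r := `|1 - eps * lambda|.
Local Notation q := `|1 - eps * omega_h|.
Local Notation idx i := ((i : 'I_n).+1%:R : R).

(* The decimals 3.3072, 0.3849 and 0.19245; numerals here are unary, so large
   ones are avoided. *)
Definition d33072 : R := 2067 / 625.
Definition d03849 : R := 3849 / 10 ^+ 4.
Definition d019245 : R := d03849 / 2.

Definition norm_a : R := Num.sqrt (\sum_i a i ^+ 2).
Definition norm_ainv : R := Num.sqrt (\sum_i a i ^- 2).

Definition c (i : 'I_n) : R :=
  (nD + se) * (2 * nD + se) / 12
  + (se * (se + nD)
     + D%:R ^+ 2 * n%:R ^+ 2 * (1 + 1 / (d33072 * pi * idx i)))
    / (d33072 * pi * idx i).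

Definition rho1 : R :=
  d019245 * nD * k * H_M
  * (\sum_i 1 / idx i
     + \sum_i \sum_(l | l != i)
         a l / a i * (1 / `|idx i - idx l| + 1 / (idx i + idx l))).

Definition rho2 : R := d03849 * nD * k * \sum_i 1 / (idx i * a i).

Definition rho3 : R :=
  k * H_M * (\sum_s a s ^+ 2) * Num.sqrt (\sum_i c i ^+ 2 / a i ^+ 2).

Definition rho4 : R := d019245 * nD * k * \sum_i 1 / (idx i * a i).

Definition sigma_y : R :=
  H_M / 2 * r ^- (2 * D) * (sigma + alpha0 * norm_a) ^+ 2.

Definition sigma_eta : R :=
  Delta_Q p * q ^- D + eps * omega_h * sigma_y / (r ^+ 2 - q).

Definition Delta_G : R :=
  rho1 * sigma + rho2 * (sigma_eta / alpha0) + rho3 * alpha0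
  + rho4 * (sigma ^+ 2 * H_M / alpha0).

Definition Delta : R :=
  2 * k / alpha0
  * (H_M / 2 * (sigma + alpha0 * norm_a) ^+ 2 + sigma_eta) * norm_ainv.

Definition Delta_out : R :=
  k * D%:R * H_M / alpha0 * norm_ainv * (sigma + alpha0 * norm_a)
  * (1 + r ^- D)
  * (2 * se * k * (sigma_y + sigma_eta) / alpha0 * norm_ainv
     + alpha0 * norm_a
       * (lambda * se
          + 2 * pi / ((1 - se) * D%:R)
            * (pi * se / ((1 - se) * D%:R) + 1))
       / r).

Definition Delta_Y : R :=
  k * H_M * Delta_G
  + rho1 * (Delta + se * Delta_out)
  + omega_h * rho2 / alpha0 * (sigma_y + sigma_eta)
  + rho2 * lambda * (sigma_eta * q + eps * omega_h * sigma_y) / (alpha0 * r)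
  + rho3 * alpha0 * lambda
  + 2 * rho4 * sigma * alpha0^-1 * H_M * (Delta + se * Delta_out)
  + Delta_out
  + eps * rho4 * alpha0^-1 * H_M * (Delta + se * Delta_out) ^+ 2
  + rho4 * alpha0^-1 * lambda / r * H_M
    * (sigma + eps * (Delta + se * Delta_out)) ^+ 2.

Definition cond_a : Prop :=
  (2 * n + 1 <= n * D * Num.truncn (1 / se))%N.

Definition cond_b : Prop :=
  eps * Num.max (lambda + k * H_m) (omega_h + 2 * lambda - eps * lambda ^+ 2)
  < 2.

(* Inverses are total here (0^-1 = 0), so the first three clauses state that
   the expressions in the inequality are defined; all other denominators are
   nonzero under cond_b and the standing sign assumptions. *)
Definition cond_c : Prop :=
  [/\ 1 - se != 0, 1 - eps * omega_h != 0, 1 - eps * k * H_m != 0 &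
      (sigma0 p + se * Delta_G * r ^+ D) * `|1 - eps * k * H_m| ^- D
      + se * Delta_G
      + se ^+ 3 * Delta_Y / (r - `|1 - eps * k * H_m|)
      < sigma].

End Constants.

(* Main.v *)
(* Divided by [r ^ j] and [r ^ (2 j)], r = 1 - eps * lambda, the errors become
   sequences [x], [z] that have to stay bounded. The product of the demodulation
   signal with the undelayed measurement averages to the gradient term k H x;
   subtracting centred discrete primitives of the oscillating remainder
   (summation by parts) turns [x] into [g = x + eps * correction], which obeys a
   contraction of factor (1 - eps k H_m) / r up to a perturbation of order
   eps^(3/2), so that max (initial value, perturbation / gap) bounds [g].

   The constants at eps_star do not dominate those at eps termwise: the gain
   eps / (r^2 - q) of the filter can grow when eps decreases, the delayed inputs
   cost a further factor r^-D, and no dither is applied up to time D_M. All this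
   is absorbed by slack in condition (c): its [Delta_out] term forces
   sqrt eps_star < 1/13, so the sine bounds behind the [rho]s hold with room to
   spare, and the bound obtained on [x] is below sigma by at least
   2 (sqrt eps_star - sqrt eps) [Delta_G]. *)

(* The normalization is exact because the map is quadratic: scaling the error by [r^-j] scales the
   measurement by [r^-2j], and the dither amplitude [alpha] becomes the constant [alpha0]. The
   period [T] is of order [n D / sqrt eps] and primitives of [T]-periodic signals have size [T], so
   the correction is of order [eps T], that is [sqrt eps]. The perturbation is then of order
   [eps^(3/2)], and dividing it by the gap [eps (k H_m - lambda)] leaves
   [sqrt eps * Delta_Y / (k H_m - lambda)]. The obstacle in the induction is circularity: the
   estimates of one step presuppose the bounds on [x] and [z], and recovering the next [x] from the
   next [g] would presuppose the bound being proved. The next [x] is therefore bounded from the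
   current [g], with the primitives advanced but the state kept old. The decimal 0.19245 is
   [1 / (3 sqrt 3)] to five digits, which is what [sin y >= (3 sqrt 3 / (2 pi)) y], valid up to
   [pi / 3], would give. Here the arguments stay below [8/15], where the factor [13/14] gives the
   smaller constant [7/39]; the difference pays for the losses between [eps_star] and [eps]. *)
Require Import Defs.
From mathcomp Require Import all_boot all_order all_algebra.
From mathcomp Require Import reals topology normedtype derive trigo.
From mathcomp Require Import zify ring lra.

Set Implicit Arguments.
Unset Strict Implicit.
Unset Printing Implicit Defensive.

Import Order.TTheory GRing.Theory Num.Theory.
Local Open Scope ring_scope.

(** * Euclidean geometry of column vectors *)

Section Dot.
Context {R : realType} {n : nat}.
Implicit Types (x y z : 'cV[R]_n) (P : 'M[R]_n) (t : R).

Definition dot x y : R := \sum_i x i 0 * y i 0.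

Lemma dotC x y : dot x y = dot y x.
Proof. by apply: eq_bigr => i _; rewrite mulrC. Qed.

Lemma dotDl x y z : dot (x + y) z = dot x z + dot y z.
Proof. by rewrite -big_split; apply: eq_bigr => i _; rewrite !mxE mulrDl. Qed.

Lemma dotDr x y z : dot z (x + y) = dot z x + dot z y.
Proof. by rewrite !(dotC z) dotDl. Qed.

Lemma dotZl t x y : dot (t *: x) y = t * dot x y.
Proof. by rewrite mulr_sumr; apply: eq_bigr => i _; rewrite !mxE mulrA. Qed.

Lemma dotZr t x y : dot x (t *: y) = t * dot x y.
Proof. by rewrite !(dotC x) dotZl. Qed.

Lemma dotNl x y : dot (- x) y = - dot x y.
Proof. by rewrite -scaleN1r dotZl mulN1r. Qed.

Lemma dotNr x y : dot x (- y) = - dot x y.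
Proof. by rewrite !(dotC x) dotNl. Qed.

Lemma dot_ge0 x : 0 <= dot x x.
Proof. by apply: sumr_ge0 => i _; rewrite -expr2 sqr_ge0. Qed.

Lemma dotE x y : dot x y = (x^T *m y) 0 0.
Proof. by rewrite mxE; apply: eq_bigr => i _; rewrite mxE. Qed.

Lemma dot_symmx P x y : P^T = P -> dot x (P *m y) = dot y (P *m x).
Proof.
by move=> sP; rewrite [RHS]dotC [LHS]dotE [RHS]dotE mulmxA trmx_mul sP.
Qed.

Lemma wnorm2E P x : wnorm2 P x = dot x (P *m x).
Proof. by rewrite /wnorm2 dotE mulmxA. Qed.

Lemma enormE x : enorm x = Num.sqrt (dot x x).
Proof. by congr Num.sqrt; apply: eq_bigr => i _; rewrite expr2. Qed.

Lemma enorm_ge0 x : 0 <= enorm x.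
Proof. exact: sqrtr_ge0. Qed.

Lemma sqr_enorm x : enorm x ^+ 2 = dot x x.
Proof. by rewrite enormE sqr_sqrtr ?dot_ge0. Qed.

Lemma enorm0 : enorm (0 : 'cV[R]_n) = 0.
Proof. by rewrite enormE -(scale0r 0) dotZl mul0r sqrtr0. Qed.

(** At [w x - v y] the form equals [w (u w - v^2)]. [P] is only semidefinite, so [w = 0] can occur
    with [y] nonzero, and [v = 0] then has to be shown. *)
Lemma psd_cauchy_schwarz P x y :
  P^T = P -> (forall z, 0 <= dot z (P *m z)) ->
  dot x (P *m y) ^+ 2 <= dot x (P *m x) * dot y (P *m y).
Proof.
move=> sP P_ge0.
have E s t : dot (s *: x + t *: y) (P *m (s *: x + t *: y)) =
   s ^+ 2 * dot x (P *m x) + 2 * s * t * dot x (P *m y) + t ^+ 2 * dot y (P *m y).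
  rewrite mulmxDr -!scalemxAr !dotDl !dotDr !dotZl !dotZr.
  by rewrite (dot_symmx y x sP); ring.
set u := dot x (P *m x) in E *; set v := dot x (P *m y) in E *.
set w := dot y (P *m y) in E *.
have w_ge0 : 0 <= w by exact: P_ge0.
have [w0|w_neq0] := eqVneq w 0.
  have [->|v_neq0] := eqVneq v 0; first by rewrite w0; nra.
  (* When [w = 0] the form is affine along [y]; this coefficient gives it the value -1. *)
  have := P_ge0 (1 *: x + (- (u + 1) / (2 * v)) *: y); rewrite E w0.
  suff -> : 1 ^+ 2 * u + 2 * 1 * (- (u + 1) / (2 * v)) * v
            + (- (u + 1) / (2 * v)) ^+ 2 * 0 = -1 by lra.
  by field.
have w_gt0 : 0 < w by rewrite lt_def w_neq0.
have := P_ge0 (w *: x + (- v) *: y); rewrite E.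
have -> : w ^+ 2 * u + 2 * w * - v * v + (- v) ^+ 2 * w = w * (u * w - v ^+ 2).
  by ring.
by rewrite pmulr_rge0 // subr_ge0.
Qed.

Lemma cauchy_schwarz x y : `|dot x y| <= enorm x * enorm y.
Proof.
have := @psd_cauchy_schwarz 1%:M x y (trmx1 _ _).
rewrite !mul1mx => /(_ (fun z => _)) CS.
rewrite -(@ler_pXn2r _ 2) ?nnegrE ?mulr_ge0 ?enorm_ge0 //.
rewrite exprMn !sqr_enorm real_normK ?num_real //; apply: CS => z.
by rewrite mul1mx dot_ge0.
Qed.

Lemma enormD x y : enorm (x + y) <= enorm x + enorm y.
Proof.
rewrite -(@ler_pXn2r _ 2) ?nnegrE ?addr_ge0 ?enorm_ge0 //.
rewrite sqrrD !sqr_enorm dotDl !dotDr (dotC y x).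
have := ler_normlW (cauchy_schwarz x y); lra.
Qed.

Lemma enormZ t x : enorm (t *: x) = `|t| * enorm x.
Proof.
by rewrite !enormE dotZl dotZr mulrA -expr2 sqrtrM ?sqr_ge0 // sqrtr_sqr.
Qed.

Lemma enormN x : enorm (- x) = enorm x.
Proof. by rewrite -scaleN1r enormZ normrN1 mul1r. Qed.

Lemma enormB x y : enorm (x - y) <= enorm x + enorm y.
Proof. by rewrite -(enormN y) enormD. Qed.

Lemma enorm_le_l2 x (b : 'I_n -> R) :
  (forall i, `|x i 0| <= b i) -> enorm x <= Num.sqrt (\sum_i b i ^+ 2).
Proof.
move=> le_xb; apply: ler_wsqrtr; apply: ler_sum => i _.
by rewrite -real_normK ?num_real // ler_sqr ?nnegrE ?(le_trans (normr_ge0 _) (le_xb i)).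
Qed.

Lemma sqr_sum_le (b : 'I_n -> R) :
  (forall i, 0 <= b i) -> \sum_i b i ^+ 2 <= (\sum_i b i) ^+ 2.
Proof.
move=> b_ge0; rewrite expr2 mulr_suml; apply: ler_sum => i _.
rewrite expr2 ler_wpM2l // (bigD1 i) //= lerDl.
by apply: sumr_ge0.
Qed.

Lemma enorm_le_l1 x (b : 'I_n -> R) :
  (forall i, `|x i 0| <= b i) -> enorm x <= \sum_i b i.
Proof.
move=> le_xb; have b_ge0 i : 0 <= b i := le_trans (normr_ge0 _) (le_xb i).
have s_ge0 : 0 <= \sum_i b i by apply: sumr_ge0.
apply: le_trans (enorm_le_l2 le_xb) _.
by rewrite -[leRHS](ger0_norm s_ge0) -sqrtr_sqr ler_wsqrtr // sqr_sum_le.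
Qed.

Lemma coord_le_enorm x i : `|x i 0| <= enorm x.
Proof.
rewrite -sqrtr_sqr; apply: ler_wsqrtr; rewrite (bigD1 i) //= lerDl.
by apply: sumr_ge0 => l _; apply: sqr_ge0.
Qed.

(** An operator norm bound without diagonalization: Cauchy-Schwarz for the form, applied to [P x]
    and [x], gives [|Px|^4 <= (c |Px|^2) (c |x|^2)], and [|Px|^2] cancels. *)
Lemma psd_enorm_le P (c : R) x :
  P^T = P -> (forall z, 0 <= dot z (P *m z) <= c * dot z z) ->
  enorm (P *m x) <= c * enorm x.
Proof.
move=> sP bP.
have P_ge0 z : 0 <= dot z (P *m z) by case/andP: (bP z).
have leP z : dot z (P *m z) <= c * dot z z by case/andP: (bP z).
have := psd_cauchy_schwarz (P *m x) x sP P_ge0.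
rewrite -sqr_enorm => CS.
have [/eqP|nz] := eqVneq (dot x x) 0.
  rewrite -sqr_enorm sqrf_eq0 => /eqP x0; rewrite x0 mulr0.
  have := leP x; rewrite -sqr_enorm x0 expr0n mulr0 => le0.
  have : dot x (P *m x) = 0 by apply/eqP; rewrite eq_le le0 P_ge0.
  move=> e0; move: CS; rewrite e0 mulr0 -exprM => CS.
  have : enorm (P *m x) ^+ (2 * 2) = 0.
    by apply/eqP; rewrite eq_le CS exprn_ge0 ?enorm_ge0.
  by move/eqP; rewrite expf_eq0 => /andP[_ /eqP ->].
(* The sign of [c] can be read off only at a vector with [dot x x > 0], hence the separate case
   above. *)
have c_ge0 : 0 <= c.
  have xx : 0 < dot x x by rewrite lt_def nz dot_ge0.
  by rewrite -(pmulr_lge0 _ xx); exact: le_trans (P_ge0 x) (leP x).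
have [->|w_neq0] := eqVneq (enorm (P *m x)) 0.
  by rewrite mulr_ge0 ?enorm_ge0.
have w_gt0 : 0 < enorm (P *m x) by rewrite lt_def w_neq0 enorm_ge0.
have le2 : enorm (P *m x) ^+ 2 <= (c * enorm x) ^+ 2.
  rewrite -(@ler_pM2l _ (enorm (P *m x) ^+ 2)) ?exprn_gt0 //.
  rewrite -expr2; apply: le_trans CS _.
  have -> : enorm (P *m x) ^+ 2 * (c * enorm x) ^+ 2 =
     (c * dot (P *m x) (P *m x)) * (c * dot x x).
    by rewrite -!sqr_enorm; ring.
  by apply: ler_pM; rewrite ?P_ge0 ?leP.
by rewrite -(@ler_pXn2r _ 2) ?nnegrE ?mulr_ge0 ?enorm_ge0.
Qed.

End Dot.

(** * Discrete primitives of the dithers *)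

Section Trigonometry.
Import numFieldNormedType.Exports.
Context {R : realType}.
Implicit Types (x y w t : R) (j : nat).

Lemma sin_mean_value x y : x <= y ->
  exists2 c, c \in `[x, y] & sin y - sin x = cos c * (y - x).
Proof.
move=> le_xy; apply: MVT_segment => //.
apply: derivable_within_continuous => c _; exact: derivable_sin.
Qed.

Lemma sin_lipschitz x y : `|sin x - sin y| <= `|x - y|.
Proof.
wlog le_yx : x y / y <= x => [th|].
  have [|/ltW le_xy] := leP y x; first exact: th.
  by rewrite distrC (distrC x); apply: th.
have [c _ ->] := sin_mean_value le_yx.
by rewrite normrM ler_piMl ?cos_max.
Qed.

Lemma norm_sin_le x : `|sin x| <= `|x|.
Proof. by have := sin_lipschitz x 0; rewrite sin0 !subr0. Qed.

Lemma cos_ge_quadratic x : 1 - x ^+ 2 / 2 <= cos x.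
Proof.
have xE : x = (x / 2) *+ 2 by rewrite -mulr_natr divfK ?pnatr_eq0.
rewrite [in cos _]xE cos_mulr2n cos2sin2.
have : sin (x / 2) ^+ 2 <= (x / 2) ^+ 2.
  rewrite -[leLHS]real_normK ?num_real // -[leRHS]real_normK ?num_real //.
  by rewrite ler_sqr ?nnegrE // norm_sin_le.
by nra.
Qed.

(* Two halvings improve the mean value bound [x (1 - x^2 / 2)]. *)
Lemma sin_ge_cubic x : 0 <= x <= 1 -> x * (1 - x ^+ 2 / 4) <= sin x.
Proof.
have coarse y : 0 <= y <= 1 -> y * (1 - y ^+ 2 / 2) <= sin y.
  case/andP=> y_ge0 y_le1.
  have [c cy] := sin_mean_value y_ge0.
  rewrite sin0 !subr0 mulrC => ->; rewrite ler_wpM2l //.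
  apply: le_trans (cos_ge_quadratic c); move: cy; rewrite in_itv /=.
  by case/andP=> c_ge0 le_cy; nra.
case/andP=> x_ge0 x_le1.
have xE : x = (x / 2) *+ 2 by rewrite -mulr_natr divfK ?pnatr_eq0.
rewrite [in sin _]xE sin_mulr2n.
have sh : x / 2 * (1 - (x / 2) ^+ 2 / 2) <= sin (x / 2) by apply: coarse; lra.
have ch := cos_ge_quadratic (x / 2).
set s := sin _ in sh *; set c := cos _ in ch *.
have p_ge0 : 0 <= 1 - (x / 2) ^+ 2 / 2 by nra.
have : (1 - (x / 2) ^+ 2 / 2) * (x / 2 * (1 - (x / 2) ^+ 2 / 2)) <= c * s.
  by apply: ler_pM => //; apply: mulr_ge0 => //; lra.
have x5_ge0 : 0 <= x ^+ 5 by apply: exprn_ge0.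
rewrite mulr2n => le_cs; rewrite (le_trans _ (lerD le_cs le_cs)) //.
rewrite -subr_ge0 (_ : _ - _ = x ^+ 5 / 64); last by field.
by rewrite divr_ge0.
Qed.

(** The range ends at [8/15] because [(8/15)^2 / 4 = 16/225] is just below [1/14]. *)
Lemma sin_ge_linear x : 0 <= x <= 8 / 15 -> 13 / 14 * x <= sin x.
Proof.
move=> xI; have := @sin_ge_cubic x; case/andP: xI => x_ge0 x_le th.
by apply: le_trans (th _); last (apply/andP; split; lra); nra.
Qed.

(** With [a = pi / 6], the equation [cos (3a) = 0] factors as [cos a (1 - 4 (sin a)^2) = 0]. This
    value is the source of both numerical bounds on [pi]. *)
Lemma sin_pi_sixth : sin (pi / 6) = 1 / 2 :> R.
Proof.
have pi_gt0 := pi_gt0 R; set a := pi / 6.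
have c_gt0 : 0 < cos a.
  by apply: cos_gt0_pihalf; rewrite /a; apply/andP; split; lra.
have s_gt0 : 0 < sin a by apply: sin_gt0_pi; rewrite /a; apply/andP; split; lra.
have : cos (a *+ 2 + a) = 0.
  rewrite -[RHS]cos_pihalf; congr cos; rewrite /a mulr2n; lra.
rewrite cosD cos_mulr2n sin_mulr2n => e.
have cs := cos2Dsin2 a; set c := cos a in e cs c_gt0 *; set s := sin a in e cs s_gt0 *.
have : c * (1 - 4 * s ^+ 2) = 0.
  rewrite -[RHS]e; have -> : c ^+ 2 = 1 - s ^+ 2 by lra.
  by ring.
move/eqP; rewrite mulf_eq0 gt_eqF //= => /eqP s2.
have : (s - 1 / 2) * (s + 1 / 2) = 0 by nra.
move/eqP; rewrite mulf_eq0 => /orP[] /eqP; lra.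
Qed.

Lemma pi_ge3 : 3 <= pi :> R.
Proof.
have := norm_sin_le (pi / 6); rewrite sin_pi_sixth.
have := pi_gt0 R => p; rewrite !ger0_norm; lra.
Qed.

(** Otherwise [a = pi / 6] exceeds [11/20], where the increasing lower bound [a - a^3 / 4] of the
    sine is already above [1/2]. *)
Lemma pi_le33 : pi <= 33 / 10 :> R.
Proof.
have [//|gt] := leP.
have lt4 : pi < 4 :> R by have := @pihalf_lt2 R; lra.
have := @sin_ge_cubic (pi / 6); rewrite sin_pi_sixth.
set a : R := pi / 6; have a_gt : 11 / 20 < a by rewrite /a; lra.
have a_lt : a < 2 / 3 by rewrite /a; lra.
have aI : 0 <= a <= 1 by apply/andP; split; lra.
move=> /(_ aI) le.
have : 0 <= (a - 11 / 20) * (1 - (a ^+ 2 + a * (11 / 20) + (11 / 20) ^+ 2) / 4).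
  by apply: mulr_ge0; nra.
by nra.
Qed.

(** From [sin (t + w/2) - sin (t - w/2) = 2 sin (w/2) cos t]. The shift by half a step is the choice
    of additive constant that makes the primitive a pure sine, of amplitude [1 / (2 sin (w/2))]. *)
Definition cos_prim w j : R := sin (w * j%:R - w / 2) / (2 * sin (w / 2)).
Definition sin_prim w j : R := - cos (w * j%:R - w / 2) / (2 * sin (w / 2)).

Lemma cos_primS w j : sin (w / 2) != 0 ->
  cos_prim w j.+1 - cos_prim w j = cos (w * j%:R).
Proof.
move=> nz; rewrite /cos_prim.
have -> : w * j.+1%:R - w / 2 = w * j%:R + w / 2.
  by rewrite -natr1; lra.
rewrite sinD sinB; by field; rewrite nz.
Qed.

Lemma sin_primS w j : sin (w / 2) != 0 ->
  sin_prim w j.+1 - sin_prim w j = sin (w * j%:R).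
Proof.
move=> nz; rewrite /sin_prim.
have -> : w * j.+1%:R - w / 2 = w * j%:R + w / 2.
  by rewrite -natr1; lra.
rewrite cosD cosB; by field; rewrite nz.
Qed.

Lemma prim_denom_bound t w : 0 < w / 2 <= 8 / 15 -> `|t| <= 1 ->
  `|t / (2 * sin (w / 2))| <= 14 / (13 * w).
Proof.
move=> wI t_le1; case/andP: (wI) => w_gt0 w_le.
have s_ge : 13 / 14 * (w / 2) <= sin (w / 2).
  by apply: sin_ge_linear; rewrite w_le ltW.
have s_gt0 : 0 < sin (w / 2) by lra.
rewrite normrM normfV (gtr0_norm (_ : 0 < 2 * _)); last lra.
apply: (@le_trans _ _ (2 * sin (w / 2))^-1); first by rewrite ler_piMl // invr_ge0; lra.
have -> : 14 / (13 * w) = (13 / 14 * w)^-1 by field; lra.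
by rewrite lef_pV2 ?posrE; lra.
Qed.

Lemma cos_prim_bound w j : 0 < w / 2 <= 8 / 15 ->
  `|cos_prim w j| <= 14 / (13 * w).
Proof. by move=> wI; apply: prim_denom_bound => //; apply: sin_max. Qed.

Lemma sin_prim_bound w j : 0 < w / 2 <= 8 / 15 ->
  `|sin_prim w j| <= 14 / (13 * w).
Proof.
by move=> wI; apply: prim_denom_bound => //; rewrite normrN; apply: cos_max.
Qed.

End Trigonometry.

Section PeriodicPrimitive.
Context {R : realType}.
Variables (f : nat -> R) (T : nat).
Hypothesis T_gt0 : (0 < T)%N.

Lemma odd_periodic_sum0 :
  f 0%N = 0 -> (forall j, (j <= T)%N -> f (T - j)%N = - f j) -> \sum_(0 <= j < T) f j = 0.
Proof.
move=> f0 odd_f; have fT : f T = 0 by rewrite -(subn0 T) odd_f // f0 oppr0.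
(* The extra term [f T = 0] makes the range symmetric under [j -> T - j]. *)
have : \sum_(0 <= j < T.+1) f j = - \sum_(0 <= j < T.+1) f j.
  rewrite {1}big_nat_rev -sumrN !big_nat; apply: eq_bigr => j /andP[_ lt_jT].
  by rewrite add0n subSS odd_f.
by rewrite big_nat_recr //= fT; lra.
Qed.

Variable F : R.
Hypothesis (f_per : forall j, f (j + T)%N = f j)
  (f_sum0 : \sum_(0 <= j < T) f j = 0) (f_le : forall j, `|f j| <= F).

Let P j := \sum_(0 <= i < j) f i.

Let P_S j : P j.+1 = P j + f j.
Proof. by rewrite /P big_nat_recr. Qed.

Let P_mod j : P j = P (j %% T).
Proof.
have per i : P (i + T)%N = P i.
  elim: i => [|i IH]; first by rewrite add0n /P f_sum0 big_geq.
  by rewrite addSn !P_S IH f_per.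
rewrite {1}(divn_eq j T); elim: (j %/ T)%N => [|q IH]; first by rewrite mul0n.
by rewrite mulSn -addnA addnC per.
Qed.

Let P_lip i d : `|P (i + d)%N - P i| <= d%:R * F.
Proof.
elim: d => [|d IH]; first by rewrite addn0 subrr normr0 mul0r.
rewrite addnS P_S -natr1 mulrDl mul1r addrAC.
by apply: le_trans (ler_normD _ _) _; rewrite lerD.
Qed.

Let P_osc i j : (i < T)%N -> (j < T)%N -> P j - P i <= T%:R * F / 2.
Proof.
move=> lt_iT lt_jT.
wlog: / `|P j - P i| <= T%:R * F / 2 => [|le]; last by exact: le_trans (ler_norm _) le.
apply; wlog le_ij : i j lt_iT lt_jT / (i <= j)%N => [th|].
  by case/orP: (leq_total i j) => ?; last rewrite distrC; apply: th.
have := P_lip i (j - i); rewrite subnKC // natrB //.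
have := P_lip 0 i; have := P_lip j (T - j).
rewrite add0n subnKC ?(ltnW lt_jT) // natrB ?(ltnW lt_jT) //.
have -> : P T = 0 by rewrite /P f_sum0.
have -> : P 0 = 0 by rewrite /P big_geq.
rewrite !ler_norml; set u := P i; set v := P j.
move=> /andP[? ?] /andP[? ?] /andP[? ?]; apply/andP; split; lra.
Qed.

(* Going around the period either way bounds the oscillation of the partial
   sums by [T * F / 2]; the primitive below is centred at their mid-range. *)
Lemma periodic_primitive : exists N : nat -> R,
  (forall j, N j.+1 - N j = f j) /\ forall j, `|N j| <= T%:R * F / 4.
Proof.
pose i0 := Ordinal T_gt0.
pose jM := [arg max_(i > i0) P (i : 'I_T)]%O; pose jm := [arg min_(i < i0) P (i : 'I_T)]%O.
have PM (i : 'I_T) : P i <= P jM.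
  by rewrite /jM; case: Order.TotalTheory.arg_maxP => // l _ /(_ i); apply.
have Pm (i : 'I_T) : P jm <= P i.
  by rewrite /jm; case: Order.TotalTheory.arg_minP => // l _ /(_ i); apply.
exists (fun j => P j - (P jM + P jm) / 2); split=> j; first by rewrite P_S; lra.
have := PM (Ordinal (ltn_pmod j T_gt0)); have := Pm (Ordinal (ltn_pmod j T_gt0)).
rewrite /= -P_mod; have := P_osc (ltn_ord jm) (ltn_ord jM).
by rewrite ler_norml => *; apply/andP; split; lra.
Qed.

End PeriodicPrimitive.

(** * Dithers, demodulation signals and the primitives of their products *)

Section Dither.
Context {R : realType} {n : nat}.
Variables (p : design R n) (eps : R).
Hypotheses (n_gt0 : (0 < n)%N) (D_M_gt0 : (0 < D_M p)%N)
  (a_gt0 : forall i, 0 < a p i) (eps_gt0 : 0 < eps)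
  (eps_small : (13 <= Num.truncn (1 / Num.sqrt eps))%N).

Local Notation T := (period p eps).
Local Notation w := (omega p eps).
Local Notation S := (dither p eps).
Local Notation M := (demod p eps).
Local Notation e := (Num.sqrt eps).
Local Notation D := (D_M p).
Local Notation idx i := ((i : 'I_n).+1%:R : R).

Let a_ge0 i : 0 <= a p i. Proof. exact/ltW. Qed.
Let a_neq0 i : a p i != 0. Proof. by rewrite gt_eqF. Qed.
Let idx_gt0 (i : 'I_n) : 0 < idx i. Proof. exact: ltr0Sn. Qed.
Let e_gt0 : 0 < e. Proof. by rewrite sqrtr_gt0. Qed.

Lemma periodE : T = (n * D * Num.truncn (1 / e))%N.
Proof.
apply/maxn_idPl/(@leq_trans (n * 1 * 13)); first by have := n_gt0; lia.
by rewrite !leq_mul.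
Qed.

Lemma period_ge : (13 * n <= T)%N.
Proof. by rewrite periodE mulnC -[n in (n * 13)%N]muln1 !leq_mul. Qed.

Let T_gt0 : (0 < T)%N.
Proof. by have := period_ge; lia. Qed.

Let TR_gt0 : 0 < T%:R :> R. Proof. by rewrite ltr0n. Qed.

(** This inequality turns [eps] times a primitive of size [T] into a quantity of order
    [sqrt eps]. *)
Lemma period_sqrt_le : T%:R * e <= n%:R * D%:R.
Proof.
rewrite periodE natrM natrM -mulrA ler_piMr ?mulr_ge0 //.
rewrite -ler_pdivlMr // truncn_le.
by rewrite divr_ge0 // ltW.
Qed.

Lemma omega_gt0 i : 0 < w i.
Proof. by rewrite /omega divr_gt0 ?mulr_gt0 ?pi_gt0 //; lra. Qed.

Let idx_ratio (i : 'I_n) : idx i / T%:R <= 1 / 13.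
Proof.
rewrite ler_pdivrMr //; have : (13 * i.+1 <= T)%N.
  by apply: leq_trans period_ge; rewrite leq_mul2l /= ltn_ord.
by rewrite -(ler_nat R) natrM; lra.
Qed.

Let inv_freq (x : R) : 0 < x ->
  14 / (13 * (2 * pi * x / T%:R)) = T%:R / x * (7 / (13 * pi)).
Proof.
have := @pi_gt0 R; move: (pi) => q q_gt0 x_gt0.
by field; rewrite !gt_eqF.
Qed.

Let pi_const : 7 / (13 * pi) <= 7 / 39 :> R.
Proof. by have := @pi_ge3 R => pi3; rewrite ler_pM2l // lef_pV2 ?posrE; lra. Qed.

(** [33/65] is [2 (33/10) / 13]. Being below [8/15], it also keeps the half-sums [(w i + w l) / 2]
    in the range of [sin_ge_linear]. *)
Lemma omega_le i : w i <= 33 / 65.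
Proof.
have -> : w i = 2 * pi * (idx i / T%:R) by rewrite /omega mulrA.
have := idx_ratio i; have := @pi_ge3 R; have := @pi_le33 R.
have := divr_ge0 (ltW (idx_gt0 i)) (ltW TR_gt0); nra.
Qed.

Let omega_inv i : 14 / (13 * w i) <= T%:R * (7 / 39) / idx i.
Proof.
have -> : 14 / (13 * w i) = T%:R / idx i * (7 / (13 * pi)).
  exact: inv_freq.
have -> : T%:R * (7 / 39) / idx i = T%:R / idx i * (7 / 39) by rewrite mulrAC.
by rewrite ler_wpM2l ?divr_ge0 ?pi_const.
Qed.

Lemma dither0 : S 0 = 0.
Proof. by apply/colP => i; rewrite !mxE mulr0 sin0 mulr0. Qed.

Lemma dither_le j : enorm (S j) <= norm_a p.
Proof.
apply: enorm_le_l2 => i; rewrite mxE normrM gtr0_norm //.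
by rewrite ler_piMr ?sin_max.
Qed.

Lemma demod_le j : enorm (M j) <= 2 * norm_ainv p.
Proof.
have -> : 2 * norm_ainv p = Num.sqrt (\sum_i (2 / a p i) ^+ 2).
  rewrite /norm_ainv -[2 in LHS]ger0_norm // -sqrtr_sqr -sqrtrM ?sqr_ge0 //.
  congr Num.sqrt; rewrite mulr_sumr; apply: eq_bigr => i _.
  by rewrite expr_div_n.
apply: enorm_le_l2 => i; rewrite mxE normrM gtr0_norm ?divr_gt0 //.
by rewrite ler_piMr ?sin_max ?divr_ge0.
Qed.

Definition max_freq : R := 2 * pi * n%:R / T%:R.

Lemma omega_le_max i : w i <= max_freq.
Proof.
rewrite /omega /max_freq ler_wpM2r ?invr_ge0 // ler_wpM2l ?ler_nat //.
by rewrite mulr_ge0 ?pi_ge0.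
Qed.

Lemma max_freq_ge0 : 0 <= max_freq.
Proof. by rewrite !mulr_ge0 ?invr_ge0 ?pi_ge0. Qed.

(** The floor of [1 / e] exceeds [1 / e - 1 = (1 - e) / e]; this is the origin of the factor
    [1 - sqrt eps] in the denominators of [Delta_out]. *)
Lemma max_freq_le : e < 1 -> max_freq <= 2 * pi * e / ((1 - e) * D%:R).
Proof.
move=> e_lt1; have D_gt0 : 0 < D%:R :> R by rewrite ltr0n.
have nR_gt0 : 0 < n%:R :> R by rewrite ltr0n.
set f := Num.truncn (1 / e); have f_gt : 1 / e < f.+1%:R.
  by rewrite /f; apply: truncnS_gt; rewrite num_real.
have f_gt0 : 0 < f%:R :> R by rewrite ltr0n; apply: leq_trans eps_small.
have -> : max_freq = 2 * pi / D%:R * f%:R^-1.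
  by rewrite /max_freq periodE -/f !natrM; field; rewrite !gt_eqF.
have -> : 2 * pi * e / ((1 - e) * D%:R) = 2 * pi / D%:R * ((1 - e) / e)^-1.
  by field; rewrite !gt_eqF //; lra.
rewrite ler_wpM2l ?divr_ge0 ?mulr_ge0 ?pi_ge0 //.
have e_inv : 1 / e * e = 1 by rewrite divfK // gt_eqF.
rewrite lef_pV2 ?posrE // ?divr_gt0 ?subr_gt0 //.
rewrite ler_pdivrMr //; rewrite -natr1 in f_gt.
have : 1 / e * e < (f%:R + 1) * e by rewrite ltr_pM2r.
by rewrite e_inv; lra.
Qed.

Lemma dither_lipschitz j d : enorm (S (j + d)%N - S j) <= norm_a p * (max_freq * d%:R).
Proof.
have md_ge0 : 0 <= max_freq * d%:R by rewrite mulr_ge0 // max_freq_ge0.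
have -> : norm_a p * (max_freq * d%:R) =
    Num.sqrt (\sum_i (a p i * (max_freq * d%:R)) ^+ 2).
  rewrite /norm_a -[X in _ * X]ger0_norm // -sqrtr_sqr -sqrtrM ?sumr_ge0 //; last first.
    by move=> i _; apply: sqr_ge0.
  congr Num.sqrt; rewrite mulr_suml; apply: eq_bigr => i _.
  by rewrite !exprMn.
apply: enorm_le_l2 => i; rewrite !mxE -mulrBr normrM gtr0_norm // ler_wpM2l //.
apply: le_trans (sin_lipschitz _ _) _.
rewrite -mulrBr natrD addrAC subrr add0r normrM !ger0_norm ?(ltW (omega_gt0 i)) //.
by rewrite ler_wpM2r // omega_le_max.
Qed.

Let omega_T i : w i * T%:R = (pi *+ 2) *+ i.+1.
Proof.
rewrite /omega divfK ?gt_eqF // -[in RHS]mulr_natr -[pi *+ 2]mulr_natr.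
by ring.
Qed.

Let sin_shift i (x : R) : sin (x + w i * T%:R) = sin x.
Proof. by rewrite omega_T (periodicn (@sinD2pi R)). Qed.

Lemma dither_periodic j : S (j + T)%N = S j.
Proof. by apply/colP => i; rewrite !mxE natrD mulrDr sin_shift. Qed.

Lemma demod_periodic j : M (j + T)%N = M j.
Proof. by apply/colP => i; rewrite !mxE natrD mulrDr sin_shift. Qed.

Let sin_reflect i j : (j <= T)%N -> sin (w i * (T - j)%:R) = - sin (w i * j%:R).
Proof.
by move=> le_jT; rewrite natrB // mulrBr addrC sin_shift sinN.
Qed.

Lemma dither_reflect j : (j <= T)%N -> S (T - j) = - S j.
Proof. by move=> lejT; apply/colP => i; rewrite !mxE sin_reflect // mulrN. Qed.

Lemma demod_reflect j : (j <= T)%N -> M (T - j) = - M j.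
Proof. by move=> lejT; apply/colP => i; rewrite !mxE sin_reflect // mulrN. Qed.

Definition prim1 j : 'cV[R]_n := \col_i (2 / a p i * sin_prim (w i) j).

Let sin_half_neq0 (x : R) : 0 < x / 2 <= 8 / 15 -> sin (x / 2) != 0.
Proof.
move=> xI; case/andP: (xI) => x0 x1; rewrite gt_eqF //.
have : 13 / 14 * (x / 2) <= sin (x / 2) by apply: sin_ge_linear; lra.
by lra.
Qed.

Let wI i : 0 < w i / 2 <= 8 / 15.
Proof. by have := omega_gt0 i; have := omega_le i => *; apply/andP; split; lra. Qed.

Lemma prim1S j : prim1 j.+1 - prim1 j = M j.
Proof.
by apply/colP => i; rewrite !mxE -mulrBr sin_primS ?sin_half_neq0.
Qed.

Lemma prim1_le j : enorm (prim1 j) <= T%:R * (14 / 39) * \sum_i 1 / (idx i * a p i).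
Proof.
rewrite mulr_sumr; apply: enorm_le_l1 => i; rewrite mxE normrM gtr0_norm ?divr_gt0 //.
have -> : T%:R * (14 / 39) * (1 / (idx i * a p i)) = 2 / a p i * (T%:R * (7 / 39) / idx i).
  have := idx_gt0 i; have := a_gt0 i; move: (_.+1%:R) (a p i) => x y *.
  by field; rewrite !gt_eqF.
rewrite ler_pM2l ?divr_gt0 //; apply: le_trans (omega_inv i).
exact: sin_prim_bound.
Qed.

(** Primitive of the matrix [M S^T - 1]. Off the diagonal, product-to-sum turns [2 sin sin] into a
    difference of cosines; on the diagonal [2 sin^2 - 1 = - cos (2 w)]. The absolute value makes the
    difference frequency positive, as [cos_prim_bound] requires, and is harmless because cosine is
    even. *)
Definition prim2 j : 'M[R]_n := \matrix_(i, l)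
  if i == l then - cos_prim (w i + w l) j
  else a p l / a p i * (cos_prim `|w i - w l| j - cos_prim (w i + w l) j).

Let wDI i l : 0 < (w i + w l) / 2 <= 8 / 15.
Proof.
have := omega_gt0 i; have := omega_le i; have := omega_gt0 l; have := omega_le l.
by move=> *; apply/andP; split; lra.
Qed.

Let wBE i l : `|w i - w l| = 2 * pi * `|idx i - idx l| / T%:R.
Proof.
have -> : w i - w l = 2 * pi / T%:R * (idx i - idx l) by rewrite /omega; ring.
by rewrite normrM ger0_norm ?divr_ge0 ?mulr_ge0 ?pi_ge0 //; ring.
Qed.

Let idxB_gt0 (i l : 'I_n) : i != l -> 0 < `|idx i - idx l|.
Proof. by rewrite normr_gt0 subr_eq0 eqr_nat eqSS. Qed.

Let wBI i l : i != l -> 0 < `|w i - w l| / 2 <= 8 / 15.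
Proof.
move=> ne_il; apply/andP; split.
  rewrite divr_gt0 // wBE divr_gt0 // mulr_gt0 ?idxB_gt0 // mulr_gt0 //.
  exact: pi_gt0.
have := omega_gt0 i; have := omega_le i; have := omega_gt0 l; have := omega_le l.
move=> *; suff : `|w i - w l| <= 33 / 65 by lra.
by rewrite ler_norml; apply/andP; split; lra.
Qed.

Lemma prim2S j y : prim2 j.+1 *m y - prim2 j *m y = dot (S j) y *: M j - y.
Proof.
apply/colP => i; rewrite !mxE -sumrB /dot mulr_suml.
have -> : y i 0 = \sum_l (i == l)%:R * y l 0.
  rewrite (bigD1 i) //= eqxx mul1r big1 ?addr0 // => l ne_li.
  by rewrite eq_sym (negPf ne_li) mul0r.
rewrite -sumrB; apply: eq_bigr => l _; rewrite !mxE -mulrBl.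
have nzD := sin_half_neq0 (wDI i l).
have := cos_primS j nzD; rewrite mulrDl cosD => eD.
have [eq_il|ne_il] := eqVneq i l.
  rewrite -eq_il in eD *; rewrite mul1r.
  have -> : - cos_prim (w i + w i) j.+1 - - cos_prim (w i + w i) j =
     2 * sin (w i * j%:R) ^+ 2 - 1.
    by rewrite -opprD eD -!expr2 cos2sin2; ring.
  by field.
have := cos_primS j (sin_half_neq0 (wBI ne_il)).
have -> : cos (`|w i - w l| * j%:R) = cos ((w i - w l) * j%:R).
  by rewrite -[RHS]cos_norm normrM (ger0_norm (_ : 0 <= j%:R)).
rewrite [(w i - w l) * _]mulrBl cosB mul0r subr0 -mulrBr => eB.
have -> : forall u v s t : R, u - v - (s - t) = (u - s) - (v - t) by move=> *; ring.
by rewrite eB eD; field.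
Qed.

Lemma prim2_le j (y : 'cV[R]_n) : enorm (prim2 j *m y) <=
  T%:R * (7 / 39) * (\sum_i 1 / idx i + \sum_i \sum_(l | l != i)
         a p l / a p i * (1 / `|idx i - idx l| + 1 / (idx i + idx l))) * enorm y.
Proof.
have bD i l : 14 / (13 * (w i + w l)) <= T%:R * (7 / 39) * (1 / (idx i + idx l)).
  have -> : w i + w l = 2 * pi * (idx i + idx l) / T%:R by rewrite /omega; ring.
  rewrite inv_freq ?addr_gt0 // div1r.
  by rewrite [leRHS]mulrAC ler_wpM2l ?pi_const // divr_ge0 // ltW ?addr_gt0.
have bB i l : i != l ->
    14 / (13 * `|w i - w l|) <= T%:R * (7 / 39) * (1 / `|idx i - idx l|).
  move=> /idxB_gt0 dgt.
  rewrite wBE inv_freq // div1r.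
  by rewrite [leRHS]mulrAC ler_wpM2l ?pi_const // divr_ge0 // ltW.
rewrite mulrDr mulrDl -[leRHS]mulrDl -mulrDr -big_split /= mulr_sumr mulr_suml.
apply: enorm_le_l1 => i; rewrite mxE (bigD1 i) //= mulrDr mulrDl.
apply: le_trans (ler_normD _ _) (lerD _ _).
  rewrite normrM ler_pM ?coord_le_enorm // mxE eqxx normrN.
  apply: le_trans (cos_prim_bound j (wDI i i)) _; apply: le_trans (bD i i) _.
  (* The diagonal frequency is [2 w i], which gives [1 / (2 i)]; [rho1] allows the weaker
     [1 / i]. *)
  rewrite ler_wpM2l ?mulr_ge0 ?invr_ge0 // !div1r lef_pV2 ?posrE ?addr_gt0 // lerDl.
  exact: ltW.
rewrite mulr_sumr mulr_suml; apply: le_trans (ler_norm_sum _ _ _) _.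
apply: ler_sum => l ne_li; rewrite normrM ler_pM ?coord_le_enorm //.
have ne_il : i != l by rewrite eq_sym.
rewrite mxE (negPf ne_il) normrM ger0_norm ?divr_ge0 // mulrCA ler_wpM2l ?divr_ge0 //.
apply: le_trans (ler_normB _ _) _; rewrite mulrDr; apply: lerD.
  by apply: le_trans (cos_prim_bound j (wBI ne_il)) (bB _ _ ne_il).
by apply: le_trans (cos_prim_bound j (wDI i l)) (bD _ _).
Qed.

(** A product of three sines is odd under [j -> T - j], so its sum over a period vanishes and a
    bounded primitive exists. This avoids a closed form, whose combinations of three frequencies
    [w i], [w l], [w s] can be arbitrarily resonant. *)
Lemma prim3_exists (H : 'M[R]_n) (h : R) :
  (forall x : 'cV[R]_n, `|dot x (H *m x)| <= h * enorm x ^+ 2) ->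
  exists N : nat -> 'cV[R]_n,
    (forall j, N j.+1 - N j = (dot (S j) (H *m S j) / 2) *: M j) /\
    forall j, enorm (N j) <= T%:R / 4 * (h * (\sum_s a p s ^+ 2)) * norm_ainv p.
Proof.
move=> hH.
have A2 : norm_a p ^+ 2 = \sum_s a p s ^+ 2.
  by rewrite sqr_sqrtr // sumr_ge0 // => i _; apply: sqr_ge0.
have h_ge0 : 0 <= h * (\sum_s a p s ^+ 2).
  have := le_trans (normr_ge0 _) (hH (\col_i a p i)).
  by rewrite sqr_enorm /dot; under eq_bigr do rewrite !mxE -expr2.
pose f i j := (dot (S j) (H *m S j) / 2) * M j i 0.
have f_le i j : `|f i j| <= h * (\sum_s a p s ^+ 2) / a p i.
  have -> : f i j = dot (S j) (H *m S j) * sin (w i * j%:R) / a p i.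
    by rewrite /f mxE; field; rewrite a_neq0.
  rewrite !normrM normfV (gtr0_norm (a_gt0 i)).
  have : `|dot (S j) (H *m S j)| <= h * (\sum_s a p s ^+ 2).
    apply: le_trans (hH _) _; rewrite -A2.
    (* No sign of [h] is given; if it is negative, the hypothesis forces both [norm_a p] and
       [enorm (S j)] to be 0. *)
    have [h0|h0] := lerP 0 h.
      by rewrite ler_wpM2l // lerXn2r ?nnegrE ?enorm_ge0 ?sqrtr_ge0 ?dither_le.
    have := le_trans (normr_ge0 _) (hH (S j)).
    rewrite -A2 in h_ge0; have := exprn_ge0 2 (enorm_ge0 (S j)).
    by have := @sqrtr_ge0 R (\sum_i a p i ^+ 2); rewrite -/(norm_a p); nra.
  set u := `|_|; set v := h * _ => le_uv.
  rewrite ler_pM2r ?invr_gt0 //; apply: le_trans le_uv.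
  by rewrite ler_piMr ?normr_ge0 ?sin_max.
have /fin_all_exists [N HN] i : exists N : nat -> R, (forall j, N j.+1 - N j = f i j) /\
    forall j, `|N j| <= T%:R * (h * (\sum_s a p s ^+ 2) / a p i) / 4.
  apply: periodic_primitive => //.
  - by move=> j; rewrite /f dither_periodic demod_periodic.
  - apply: odd_periodic_sum0 => //; first by rewrite /f dither0 mulmx0 -(scale0r 0) dotZl !mul0r.
    move=> j le_jT; rewrite /f dither_reflect // demod_reflect // mulmxN dotNl dotNr opprK.
    by rewrite mxE mulrN.
exists (fun j => \col_i N i j); split=> j.
  by apply/colP => i; rewrite !mxE (HN i).1 /f mxE.
move: (\sum_s a p s ^+ 2) h_ge0 HN => s2 h_ge0 HN.
have c_ge0 : 0 <= T%:R / 4 * (h * s2) by rewrite mulr_ge0 // divr_ge0.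
have -> : T%:R / 4 * (h * s2) * norm_ainv p =
    Num.sqrt (\sum_i (T%:R * (h * s2 / a p i) / 4) ^+ 2).
  rewrite /norm_ainv -[X in X * Num.sqrt _]ger0_norm // -sqrtr_sqr -sqrtrM ?sqr_ge0 //.
  congr Num.sqrt; rewrite mulr_sumr; apply: eq_bigr => i _.
  by rewrite -exprVn -exprMn; congr (_ ^+ 2); field; rewrite a_neq0.
by apply: enorm_le_l2 => i; rewrite mxE; apply: (HN i).2.
Qed.

End Dither.

(** * One step of the averaged system *)

Section AveragingStep.
Context {R : realType} {n : nat}.
Variables (H : 'M[R]_n) (Hm HM k al eps lam : R).
Hypotheses (H_sym : H^T = H)
  (H_ge : forall x : 'cV[R]_n, Hm * dot x x <= dot x (H *m x))
  (H_le : forall x : 'cV[R]_n, dot x (H *m x) <= HM * dot x x)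
  (Hm_ge0 : 0 <= Hm) (HM_ge0 : 0 <= HM) (k_gt0 : 0 < k) (al_gt0 : 0 < al)
  (eps_gt0 : 0 < eps) (lam_gt0 : 0 < lam) (lam_small : eps * lam < 1)
  (HM_small : eps * k * HM <= 1).

Implicit Types (x y z S M N : 'cV[R]_n) (K : 'M[R]_n).

Local Notation r := (1 - eps * lam).

Lemma H_psd x : 0 <= dot x (H *m x).
Proof. by apply: le_trans (H_ge x); rewrite mulr_ge0 ?dot_ge0. Qed.

Lemma H_enorm x : enorm (H *m x) <= HM * enorm x.
Proof. by apply: psd_enorm_le => // z; rewrite H_psd H_le. Qed.

Lemma H_dot x y : `|dot x (H *m y)| <= HM * (enorm x * enorm y).
Proof.
apply: le_trans (cauchy_schwarz _ _) _; rewrite mulrCA ler_wpM2l ?enorm_ge0 //.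
exact: H_enorm.
Qed.

(** [HM_small] makes [1 - eps k H] positive semidefinite, so the bound on its quadratic form is a
    bound on its norm. *)
Lemma contraction x : enorm (x - (eps * k) *: (H *m x)) <= (1 - eps * k * Hm) * enorm x.
Proof.
have -> : x - (eps * k) *: (H *m x) = (1%:M - (eps * k) *: H) *m x.
  by rewrite mulmxBl mul1mx scalemxAl.
have ek_gt0 : 0 < eps * k by rewrite mulr_gt0.
apply: psd_enorm_le => [|z]; first by rewrite linearB linearZ /= trmx1 H_sym.
rewrite mulmxBl mul1mx -scalemxAl dotDr dotNr dotZr.
have := H_ge z; have := H_le z; have := dot_ge0 z; set u := dot z _; set v := dot z _.
move=> u_ge0 le1 le2.
have h1 : eps * k * v <= eps * k * (HM * u) by rewrite ler_pM2l.
have h2 : eps * k * (Hm * u) <= eps * k * v by rewrite ler_pM2l.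
have h3 : eps * k * HM * u <= 1 * u by rewrite ler_wpM2r.
by apply/andP; split; lra.
Qed.

(** Expanding the measurement at [x + al S] and multiplying by [k / al * M] gives three oscillating
    factors, [M S^T - 1], [M] and [(S^T H S / 2) M]. [K], [m] and [N] stand for their primitives,
    each with the slowly varying coefficient that multiplies it. *)
Definition correction K (m N x : 'cV[R]_n) (z : R) : 'cV[R]_n :=
  k *: (K *m (H *m x)) + (k / al * (dot x (H *m x) / 2 - z)) *: m + (k * al) *: N.

Variables (K0 K1 : 'M[R]_n) (m0 m1 N0 N1 S M x x' : 'cV[R]_n) (z z' Y W : R).
Hypotheses (K_step : forall y, K1 *m y - K0 *m y = dot S y *: M - y)
  (m_step : m1 - m0 = M) (N_step : N1 - N0 = (dot S (H *m S) / 2) *: M)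
  (x_step : r *: x' = x - (eps * k / al * (Y - z)) *: M)
  (Y_split : Y = dot (x + al *: S) (H *m (x + al *: S)) / 2 + W).

Local Notation G0 := (correction K0 m0 N0 x z).
Local Notation g := (x + eps *: G0).
Local Notation g' := (x' + eps *: correction K1 m1 N1 x' z').

Let Y_expand :
  Y = dot x (H *m x) / 2 + al * dot S (H *m x) + al ^+ 2 * (dot S (H *m S) / 2) + W.
Proof.
rewrite Y_split mulmxDr -scalemxAr !dotDl !dotDr !dotZl !dotZr (dot_symmx x S H_sym).
by field.
Qed.

(** The increments of the primitives replace the oscillating terms exactly. Writing [x = g - eps G0]
    in the averaged gradient step [x - eps k H x] then costs only the term [eps^2 k H G0]. *)
Lemma x_step_averaged :
  r *: x' = (g - (eps * k) *: (H *m g)) + (eps ^+ 2 * k) *: (H *m G0)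
            - eps *: correction K1 m1 N1 x z - (eps * k / al * W) *: M.
Proof.
have -> : correction K1 m1 N1 x z = G0 + k *: (dot S (H *m x) *: M - H *m x)
    + (k / al * (dot x (H *m x) / 2 - z)) *: M
    + (k * al) *: ((dot S (H *m S) / 2) *: M).
  rewrite -K_step -N_step -m_step /correction.
  move: (K1 *m _) (K0 *m _) => u v; apply/colP => i; rewrite !mxE; ring.
rewrite x_step Y_expand mulmxDr -scalemxAr.
move: G0 (H *m G0) (H *m x) (dot _ _) (dot S _) (dot S _) => G HG Hx q1 q2 q3.
by apply/colP => i; rewrite !mxE; field; rewrite gt_eqF.
Qed.

(** The second half of the summation by parts: with the new primitives fixed, the correction at
    [(x', z')], multiplied by [r], is compared with the correction at [(x, z)]. The difference
    splits into a part linear in [r x' - x], a quadratic part, and [- eps lam N1], which comes from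
    a term independent of the state. *)
Lemma g_step_averaged :
  r *: g' = (g - (eps * k) *: (H *m g)) + (eps ^+ 2 * k) *: (H *m G0)
    - (eps * k / al * W) *: M
    + eps *: (k *: (K1 *m (H *m (r *: x' - x)))
       + (k / al * ((r * dot x' (H *m x') - dot x (H *m x)) / 2 - (r * z' - z))) *: m1
       - (k * al * (eps * lam)) *: N1).
Proof.
rewrite scalerDr [in LHS]x_step_averaged; move: (correction K0 m0 N0 x z) => G.
rewrite /correction.
rewrite [H *m (r *: x' - x)]mulmxBr -scalemxAr [K1 *m (_ - _)]mulmxBr -scalemxAr.
move: (H *m (x + _)) (H *m G) (dot x' _) (dot x _) (K1 *m _) (K1 *m _).
move=> u1 u2 q1 q2 u3 u4; apply/colP => i; rewrite !mxE; ring.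
Qed.

Variables (c1 c2 c3 sigma sigma_e w delta zeta : R).
Hypotheses (c1_ge0 : 0 <= c1)
  (K0_le : forall y, eps * k * enorm (K0 *m y) <= c1 * enorm y)
  (K1_le : forall y, eps * k * enorm (K1 *m y) <= c1 * enorm y)
  (m0_le : eps * k * enorm m0 <= c2) (m1_le : eps * k * enorm m1 <= c2)
  (N0_le : eps * k * enorm N0 <= c3) (N1_le : eps * k * enorm N1 <= c3)
  (x_le : enorm x <= sigma) (z_le : `|z| <= sigma_e)
  (W_le : k / al * `|W| * enorm M <= w)
  (dx_le : enorm (r *: x' - x) <= delta) (dz_le : `|r * z' - z| <= zeta).

Definition correction_bound : R :=
  c1 * HM * sigma + c2 / al * (HM / 2 * sigma ^+ 2 + sigma_e) + c3 * al.

Let ek_gt0 : 0 < eps * k. Proof. by rewrite mulr_gt0. Qed.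

Lemma correction_le K (m N y : 'cV[R]_n) (t : R) :
  (forall y, eps * k * enorm (K *m y) <= c1 * enorm y) ->
  eps * k * enorm m <= c2 -> eps * k * enorm N <= c3 ->
  enorm y <= sigma -> `|t| <= sigma_e ->
  enorm (eps *: correction K m N y t) <= correction_bound.
Proof.
move=> K_le m_le N_le y_le t_le; have sigma_ge0 := le_trans (enorm_ge0 y) y_le.
rewrite /correction !scalerDr !scalerA.
apply: le_trans (enormD _ _) (lerD (le_trans (enormD _ _) (lerD _ _)) _).
- rewrite enormZ gtr0_norm //; apply: le_trans (K_le _) _.
  rewrite -mulrA ler_wpM2l //; apply: le_trans (H_enorm _) _.
  by rewrite ler_wpM2l.
- rewrite enormZ normrM (gtr0_norm eps_gt0) normrM gtr0_norm ?divr_gt0 //.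
  have -> : forall u v : R, eps * (k / al * u) * v = (eps * k * v) / al * u.
    by move=> u v; field; rewrite gt_eqF.
  apply: ler_pM;
    rewrite ?normr_ge0 ?divr_ge0 ?mulr_ge0 ?enorm_ge0 ?(ltW eps_gt0) ?(ltW k_gt0) ?(ltW al_gt0) //.
    by rewrite ler_pM2r ?invr_gt0.
  apply: le_trans (ler_normB _ _) (lerD _ t_le).
  rewrite normrM normfV (ger0_norm (_ : 0 <= 2)) // ger0_norm ?H_psd // mulrAC.
  rewrite ler_pM2r ?invr_gt0 //; apply: le_trans (H_le _) _; rewrite ler_wpM2l //.
  by rewrite -sqr_enorm lerXn2r ?nnegrE ?enorm_ge0.
- rewrite enormZ gtr0_norm ?mulr_gt0 //.
  have -> : eps * (k * al) * enorm N = eps * k * enorm N * al by ring.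
  by rewrite ler_pM2r.
Qed.

Let sigma_ge0 : 0 <= sigma. Proof. exact: le_trans (enorm_ge0 x) x_le. Qed.

Let drift_le : enorm (g - (eps * k) *: (H *m g) + (eps ^+ 2 * k) *: (H *m G0)) <=
  (1 - eps * k * Hm) * enorm g + eps * k * HM * correction_bound.
Proof.
apply: le_trans (enormD _ _) (lerD (contraction _) _).
have -> : (eps ^+ 2 * k) *: (H *m G0) = (eps * k) *: (H *m (eps *: G0)).
  by rewrite -scalemxAr scalerA; congr (_ *: _); ring.
rewrite enormZ gtr0_norm // -mulrA ler_pM2l //; apply: le_trans (H_enorm _) _.
by rewrite ler_wpM2l // correction_le.
Qed.

Let noise_le : enorm ((eps * k / al * W) *: M) <= eps * w.
Proof.
have -> : (eps * k / al * W) *: M = eps *: ((k / al * W) *: M).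
  by rewrite scalerA !mulrA.
by rewrite enormZ (gtr0_norm eps_gt0) ler_pM2l // enormZ normrM gtr0_norm ?divr_gt0.
Qed.

(** Only the old state enters the corrections here, so no bound on [x'] or [z'] is presupposed;
    passing through [g'] would be circular. *)
Lemma x_step_le : r * enorm x' <=
  (1 - eps * k * Hm) * enorm g + eps * k * HM * correction_bound
  + correction_bound + eps * w.
Proof.
have r_gt0 : 0 < r by rewrite subr_gt0.
have -> : r * enorm x' = enorm (r *: x') by rewrite enormZ gtr0_norm.
rewrite x_step_averaged; apply: le_trans (enormB _ _) (lerD _ noise_le).
apply: le_trans (enormB _ _) (lerD drift_le _).
exact: correction_le.
Qed.

Lemma g_step_le : r * enorm g' <=
  (1 - eps * k * Hm) * enorm g + eps * k * HM * correction_bound + eps * w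
  + (c1 * HM * delta
     + c2 / al * (HM / 2 * (2 * sigma * delta + delta ^+ 2
                            + (r^-1 - 1) * (sigma + delta) ^+ 2) + zeta)
     + c3 * al * (eps * lam)).
Proof.
have r_gt0 : 0 < r by rewrite subr_gt0.
have -> : r * enorm g' = enorm (r *: g') by rewrite enormZ gtr0_norm.
rewrite g_step_averaged; apply: le_trans (enormD _ _) (lerD _ _).
  exact: le_trans (enormB _ _) (lerD drift_le noise_le).
have d_ge0 := le_trans (enorm_ge0 _) dx_le.
rewrite !scalerDr !scalerA scalerN scalerA.
apply: le_trans (enormB _ _) (lerD (le_trans (enormD _ _) (lerD _ _)) _).
- rewrite enormZ gtr0_norm //; apply: le_trans (K1_le _) _.
  rewrite -mulrA ler_wpM2l //; apply: le_trans (H_enorm _) _.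
  by rewrite ler_wpM2l.
- rewrite enormZ normrM (gtr0_norm eps_gt0) normrM gtr0_norm ?divr_gt0 //.
  have -> : forall u v : R, eps * (k / al * u) * v = (eps * k * v) / al * u.
    by move=> u v; field; rewrite gt_eqF.
  apply: ler_pM;
    rewrite ?normr_ge0 ?divr_ge0 ?mulr_ge0 ?enorm_ge0 ?(ltW eps_gt0) ?(ltW k_gt0) ?(ltW al_gt0) //.
    by rewrite ler_pM2r ?invr_gt0.
  apply: le_trans (ler_normB _ _) (lerD _ dz_le).
  have := dx_le; set d := r *: x' - x => d_le.
  (* Since [r x' = x + d], the quadratic form carries a factor [r^-1] instead of 1; this produces
     the [(r^-1 - 1) (sigma + delta)^2] term. *)
  have -> : r * dot x' (H *m x') = r^-1 * dot (x + d) (H *m (x + d)).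
    rewrite /d [x + _]addrC subrK -scalemxAr dotZl dotZr; move: (r) r_gt0 => t t_gt0.
    by field; rewrite gt_eqF.
  clearbody d; have E : dot (x + d) (H *m (x + d)) =
     dot x (H *m x) + (2 * dot x (H *m d) + dot d (H *m d)).
    by rewrite mulmxDr !dotDl !dotDr (dot_symmx d x H_sym); ring.
  have b1 : `|dot x (H *m d)| <= HM * (sigma * delta).
    by apply: le_trans (H_dot _ _) _; rewrite ler_wpM2l // ler_pM ?enorm_ge0.
  have b2 : `|dot d (H *m d)| <= HM * (delta * delta).
    by apply: le_trans (H_dot _ _) _; rewrite ler_wpM2l // ler_pM ?enorm_ge0.
  have b3 : `|dot (x + d) (H *m (x + d))| <= HM * ((sigma + delta) * (sigma + delta)).
    have xd : enorm (x + d) <= sigma + delta by apply: le_trans (enormD _ _) (lerD _ _).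
    by apply: le_trans (H_dot _ _) _; rewrite ler_wpM2l // ler_pM ?enorm_ge0.
  have ri : 0 <= r^-1 - 1.
    rewrite subr_ge0 invf_ge1 //; have := mulr_gt0 eps_gt0 lam_gt0; move: lam_small; lra.
  have -> : r^-1 * dot (x + d) (H *m (x + d)) - dot x (H *m x) =
     (r^-1 - 1) * dot (x + d) (H *m (x + d)) + (2 * dot x (H *m d) + dot d (H *m d)).
    by move: E; set q := dot (x + d) _; move: (r^-1) => t ->; ring.
  rewrite normrM normfV (ger0_norm (_ : 0 <= 2)) //.
  have b4 : `|(r^-1 - 1) * dot (x + d) (H *m (x + d)) + (2 * dot x (H *m d) + dot d (H *m d))|
     <= (r^-1 - 1) * (HM * ((sigma + delta) * (sigma + delta)))
        + (2 * (HM * (sigma * delta)) + HM * (delta * delta)).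
    apply: le_trans (ler_normD _ _) (lerD _ (le_trans (ler_normD _ _) (lerD _ b2))).
      by rewrite normrM ger0_norm // ler_wpM2l.
    by rewrite normrM ger0_norm // ler_wpM2l.
  by move: b4; set l := `|_|; move: (r^-1) => ri' b4; lra.
- rewrite enormZ gtr0_norm ?mulr_gt0 //.
  have -> : eps * (k * al * (eps * lam)) * enorm N1 =
     eps * k * enorm N1 * (al * (eps * lam)) by ring.
  by rewrite -[leRHS]mulrA ler_pM2r ?mulr_gt0.
Qed.

End AveragingStep.

(** * Contraction factors and filter gains as functions of the step size *)

Section GainBounds.
Context {R : realType}.
Implicit Types (es eps lam w u : R).

Lemma decay_bounds es lam u :
  0 < es -> 0 < lam -> lam < u -> es * (lam + u) < 2 ->
  [/\ 0 < 1 - es * lam, 1 - es * lam < 1 & `|1 - es * u| < 1 - es * lam].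
Proof.
move=> es_gt0 lam_gt0 lt_lu lt2.
have h1 : 0 < es * lam by rewrite mulr_gt0.
have h2 : es * lam < es * u by rewrite ltr_pM2l.
by split; rewrite ?ltr_norml; lra.
Qed.

Lemma filter_bounds es lam w :
  0 < es -> 0 < lam -> 2 * lam < w -> es * lam < 1 ->
  es * (w + 2 * lam - es * lam ^+ 2) < 2 -> `|1 - es * w| < (1 - es * lam) ^+ 2.
Proof.
move=> es_gt0 lam_gt0 lt_lw lt1 lt2.
have h1 : es * (2 * lam) < es * w by rewrite ltr_pM2l.
have h2 := sqr_ge0 (es * lam).
by rewrite ltr_norml; apply/andP; split; lra.
Qed.

(** The function [t (w + 2 lam - t lam^2)] is increasing as long as [t lam < 1]. *)
Lemma filter_cond_mono eps es lam w :
  0 < eps -> eps <= es -> 0 < lam -> 2 * lam < w -> es * lam < 1 ->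
  es * (w + 2 * lam - es * lam ^+ 2) < 2 ->
  eps * (w + 2 * lam - eps * lam ^+ 2) < 2.
Proof.
move=> eps_gt0 le_es lam_gt0 lt_lw lt1 lt2.
have h1 : eps * lam <= es * lam by rewrite ler_pM2r.
have h2 : 0 <= (es - eps) * (w + 2 * lam - lam * (es * lam + eps * lam)).
  rewrite mulr_ge0 ?subr_ge0 //.
  have : lam * (es * lam + eps * lam) <= lam * 2 by rewrite ler_wpM2l ?ltW //; lra.
  lra.
lra.
Qed.

(* For [eps w <= 1] the gain [eps / (r^2 - q)] decreases with [eps], so it has
   to be traded against [b]; for [eps w > 1] it increases. *)
Lemma filter_gain_mono eps es lam w a b :
  0 < eps -> eps <= es -> 0 < lam -> 2 * lam < w -> es * lam < 1 ->
  es * (w + 2 * lam - es * lam ^+ 2) < 2 -> 0 <= a -> a <= b ->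
  a * (w - 2 * lam + es * lam ^+ 2) <= b * (w - 2 * lam + eps * lam ^+ 2) ->
  eps * a / ((1 - eps * lam) ^+ 2 - `|1 - eps * w|)
    <= es * b / ((1 - es * lam) ^+ 2 - `|1 - es * w|).
Proof.
move=> eps_gt0 le_es lam_gt0 lt_lw lt1 lt2 a_ge0 le_ab trade.
have es_gt0 : 0 < es by lra.
have lt1' : eps * lam < 1 by apply: le_lt_trans lt1; rewrite ler_pM2r.
have lt2' := filter_cond_mono eps_gt0 le_es lam_gt0 lt_lw lt1 lt2.
have := filter_bounds eps_gt0 lam_gt0 lt_lw lt1' lt2'.
have := filter_bounds es_gt0 lam_gt0 lt_lw lt1 lt2.
rewrite -subr_gt0 => ds; rewrite -subr_gt0 => dp.
rewrite ler_pdivrMr // mulrAC ler_pdivlMr //.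
have b_ge0 : 0 <= b by lra.
have [le1|gt1] := leP (eps * w) 1.
  have -> : `|1 - eps * w| = 1 - eps * w by rewrite ger0_norm //; lra.
  have -> : eps * a * ((1 - es * lam) ^+ 2 - `|1 - es * w|) =
    eps * (a * ((1 - es * lam) ^+ 2 - `|1 - es * w|)) by ring.
  (* At [eps] the analogous relation is an equality; at [es] only this direction holds, since
     [es * w] may exceed 1. *)
  have le_s : (1 - es * lam) ^+ 2 - `|1 - es * w| <= es * (w - 2 * lam + es * lam ^+ 2).
    by have := ler_norm (1 - es * w); lra.
  have h : a * ((1 - es * lam) ^+ 2 - `|1 - es * w|)
      <= a * (es * (w - 2 * lam + es * lam ^+ 2)) by rewrite ler_wpM2l.
  have h' : es * (a * (w - 2 * lam + es * lam ^+ 2)) <=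
    es * (b * (w - 2 * lam + eps * lam ^+ 2)) by rewrite ler_pM2l.
  have h2 : eps * (a * ((1 - es * lam) ^+ 2 - `|1 - es * w|)) <=
     eps * (es * (b * (w - 2 * lam + eps * lam ^+ 2))).
    by rewrite ler_pM2l //; lra.
  by apply: le_trans h2 _; rewrite le_eqVlt; apply/orP; left; apply/eqP; ring.
have gt1' : 1 < es * w.
  by apply: lt_le_trans gt1 _; rewrite ler_wpM2r //; lra.
have -> : `|1 - eps * w| = eps * w - 1 by rewrite ltr0_norm; lra.
have -> : `|1 - es * w| = es * w - 1 by rewrite ltr0_norm; lra.
have h : eps * ((1 - es * lam) ^+ 2 - (es * w - 1)) <=
    es * ((1 - eps * lam) ^+ 2 - (eps * w - 1)).
  rewrite -subr_ge0.
  have -> : es * ((1 - eps * lam) ^+ 2 - (eps * w - 1)) -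
     eps * ((1 - es * lam) ^+ 2 - (es * w - 1)) =
     (es - eps) * (2 - (eps * lam) * (es * lam)) by ring.
  apply: mulr_ge0; first lra.
  have : (eps * lam) * (es * lam) <= 1 * 1.
    by apply: ler_pM; rewrite ?mulr_ge0 ?ltW.
  lra.
have h2 : a * (eps * ((1 - es * lam) ^+ 2 - (es * w - 1))) <=
    b * (es * ((1 - eps * lam) ^+ 2 - (eps * w - 1))).
  apply: ler_pM => //; rewrite mulr_ge0 //; first lra.
  by move: ds; rewrite (_ : `|1 - es * w| = es * w - 1) ?ltr0_norm; lra.
lra.
Qed.

Lemma bernoulli_ineq u d : 0 <= u -> u <= 1 -> 1 - d%:R * u <= (1 - u) ^+ d.
Proof.
move=> u_ge0 u_le1; elim: d => [|d IH]; first by rewrite mul0r subr0 expr0.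
rewrite exprS -natr1.
have : (1 - u) * (1 - d%:R * u) <= (1 - u) * (1 - u) ^+ d by rewrite ler_wpM2l //; lra.
have : 0 <= d%:R * u ^+ 2 by rewrite mulr_ge0 ?sqr_ge0.
lra.
Qed.

End GainBounds.

(** * Invariance of the error bounds *)

(** The difference telescopes into the increments [r v (s+i+1) - v (s+i)] weighted by [r^i <= 1]. It
    measures how far a delayed state can be from the current one in normalized coordinates. *)
Lemma discounted_telescope (R : realType) (n : nat) (v : nat -> 'cV[R]_n) (r c : R) s d :
  0 <= r <= 1 -> (forall i, (i < d)%N -> enorm (r *: v (s + i).+1 - v (s + i)%N) <= c) ->
  enorm (v s - r ^+ d *: v (s + d)%N) <= d%:R * c.
Proof.
case/andP=> r_ge0 r_le1; elim: d => [|d IH] step.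
  by rewrite addn0 scale1r subrr enorm0 mul0r.
have -> : v s - r ^+ d.+1 *: v (s + d.+1)%N =
    (v s - r ^+ d *: v (s + d)%N) - r ^+ d *: (r *: v (s + d).+1 - v (s + d)%N).
  by rewrite addnS scalerBr scalerA -exprSr opprB addrA subrK.
apply: le_trans (enormB _ _) _; rewrite -natr1 mulrDl mul1r lerD //.
  by apply: IH => i lt_id; apply: step; apply: ltnW.
rewrite enormZ ger0_norm ?exprn_ge0 //; apply: le_trans (step d (ltnSn d)).
by rewrite ler_piMl ?enorm_ge0 // exprn_ile1.
Qed.

Lemma early_bound (D d j : nat) : (d <= D)%N -> (j - d <= D)%N -> (j <= D + D)%N.
Proof. by lia. Qed.

(** For [j > D] the minimum counts the startup times [D < i <= 2D] with [i < j]; truncated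
    subtraction makes it 0 earlier. It is multiplied by [tau] in the bound on the averaged state. *)
Lemma startup_minn (D j : nat) :
  minn (j.+1 - D.+1) D = (minn (j - D.+1) D + (D < j <= D + D))%N.
Proof. by lia. Qed.

Section Induction.
Context {R : realType} {n : nat}.
Variables (H : 'M[R]_n) (Hm HM k al eps lam w : R) (D : nat).
Hypotheses (H_sym : H^T = H)
  (H_ge : forall x : 'cV[R]_n, Hm * dot x x <= dot x (H *m x))
  (H_le : forall x : 'cV[R]_n, dot x (H *m x) <= HM * dot x x)
  (Hm_gt0 : 0 < Hm) (le_HmM : Hm <= HM) (k_gt0 : 0 < k) (al_gt0 : 0 < al)
  (eps_gt0 : 0 < eps) (lam_gt0 : 0 < lam) (lam_small : eps * lam < 1)
  (HM_small : eps * k * HM <= 1) (lt_lam : lam < k * Hm) (w_gt0 : 0 < w).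

Local Notation r := (1 - eps * lam).

Variables (S M m N : nat -> 'cV[R]_n) (K : nat -> 'M[R]_n) (A B freq c1 c2 c3 : R).
Hypotheses (A_ge0 : 0 <= A) (B_ge0 : 0 <= B) (freq_ge0 : 0 <= freq)
  (S_le : forall j, enorm (S j) <= A) (M_le : forall j, enorm (M j) <= 2 * B)
  (S0 : S 0%N = 0)
  (S_lip : forall j d, enorm (S (j + d)%N - S j) <= A * (freq * d%:R))
  (K_step : forall j y, K j.+1 *m y - K j *m y = dot (S j) y *: M j - y)
  (m_step : forall j, m j.+1 - m j = M j)
  (N_step : forall j, N j.+1 - N j = (dot (S j) (H *m S j) / 2) *: M j)
  (c1_ge0 : 0 <= c1) (c2_ge0 : 0 <= c2) (c3_ge0 : 0 <= c3)
  (K_le : forall j y, eps * k * enorm (K j *m y) <= c1 * enorm y)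
  (m_le : forall j, eps * k * enorm (m j) <= c2)
  (N_le : forall j, eps * k * enorm (N j) <= c3).

Variables (x u : nat -> 'cV[R]_n) (z : nat -> R) (delay : nat -> nat).
Local Notation Y j := (dot (u j) (H *m u j) / 2).
Hypotheses (delay_le : forall j, (delay j <= D)%N)
  (u_late : forall j, (D <= j)%N -> (D < j - delay j)%N ->
     u j = r ^- delay j *: (x (j - delay j)%N + al *: S (j - delay j)%N))
  (u_early : forall j, (D <= j)%N -> (j - delay j <= D)%N -> u j = r ^- (j - D) *: x D)
  (x_step : forall j, (D <= j)%N ->
     r *: x j.+1 = x j - (eps * k / al * (Y j - z j)) *: M j)
  (z_step : forall j, (D <= j)%N ->
     r ^+ 2 * z j.+1 = (1 - eps * w) * z j + eps * w * Y j).

(* [noise] bounds the effect of the delay, [G] the averaged state, [tau] its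
   growth in one step of the startup phase, and [gam] its distance to [x]. *)
Variables (sigma sigma1 sigma_e sigma_y x0 delta noise G tau gam : R).
Local Notation corr := (correction_bound HM al c1 c2 c3 sigma sigma_e).
Local Notation inc := (delta + al * A * (freq + eps * lam)).
Local Notation zeta := (eps * (w * (sigma_e + sigma_y) + lam * sigma_e)).
Local Notation drift := (c1 * HM * delta
     + c2 / al * (HM / 2 * (2 * sigma * delta + delta ^+ 2
                            + (r^-1 - 1) * (sigma + delta) ^+ 2) + zeta)
     + c3 * al * (eps * lam)).
Hypotheses (sigma1_ge0 : 0 <= sigma1) (sigma_y_ge0 : 0 <= sigma_y) (sigma_e_gt0 : 0 < sigma_e)
  (le_sigma : sigma1 <= sigma) (tau_ge0 : 0 <= tau)
  (init_x : enorm (x D) <= x0) (init_x1 : x0 <= sigma1) (init_z : `|z D| < sigma_e)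
  (sigma_yE : HM / 2 * (r ^- D * (sigma1 + al * A)) ^+ 2 <= sigma_y)
  (filter_gain : eps * w * sigma_y < (r ^+ 2 - `|1 - eps * w|) * sigma_e)
  (deltaE : eps * k / al * (sigma_y + sigma_e) * (2 * B) <= delta)
  (noiseE : k / al * (HM / 2 * (D%:R * (r ^- D * inc))
              * ((1 + r ^- D) * (sigma1 + al * A))) * (2 * B) <= noise)
  (G_init : x0 + corr <= G)
  (G_drift : eps * k * HM * corr + eps * noise + drift <= eps * (k * Hm - lam) * G)
  (tauE : eps * noise <= r * tau)
  (gamE : corr <= r * gam) (sigma1E : G + D%:R * tau + gam <= sigma1).

Let r_gt0 : 0 < r. Proof. by rewrite subr_gt0. Qed.
Let r_le1 : r <= 1. Proof. by rewrite gerBl ltW // mulr_gt0. Qed.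
Let HM_gt0 : 0 < HM. Proof. exact: lt_le_trans le_HmM. Qed.
Let Hm_ge0 := ltW Hm_gt0.
Let HM_ge0 := ltW HM_gt0.
Let psd y : 0 <= dot y (H *m y) := H_psd H_ge Hm_ge0 y.
Let rV_ge0 d : 0 <= r ^- d. Proof. by rewrite invr_ge0 exprn_ge0 // ltW. Qed.
Let rV_mono d d' : (d <= d')%N -> r ^- d <= r ^- d'.
Proof.
move=> le_d; rewrite lef_pV2 ?posrE ?exprn_gt0 //.
by apply: ler_wiXn2l; rewrite // ltW.
Qed.
Let rV_ge1 d : 1 <= r ^- d. Proof. by have := rV_mono (leq0n d); rewrite expr0 invr1. Qed.
Let delta_ge0 : 0 <= delta.
Proof.
apply: le_trans deltaE; apply: mulr_ge0; last by rewrite mulr_ge0.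
apply: mulr_ge0; last by rewrite addr_ge0 // ltW.
by rewrite divr_ge0 ?mulr_ge0 // ltW.
Qed.
Let alA_ge0 : 0 <= al * A. Proof. by rewrite mulr_ge0 // ltW. Qed.
Let amp_ge0 : 0 <= sigma1 + al * A. Proof. exact: addr_ge0. Qed.
Let el_ge0 : 0 <= eps * lam. Proof. by rewrite mulr_ge0 // ltW. Qed.

Definition bounded_upto j := forall s, (D <= s <= j)%N ->
  enorm (x s) <= sigma1 /\ `|z s| < sigma_e.

Let bounded_uptoW j s : (s <= j)%N -> bounded_upto j -> bounded_upto s.
Proof.
by move=> le_sj bj i /andP[le_Di le_is]; apply: bj; rewrite le_Di (leq_trans le_is).
Qed.

Let v s := x s + al *: S s.

Let v_le j s : bounded_upto j -> (D <= s <= j)%N -> enorm (v s) <= sigma1 + al * A.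
Proof.
move=> bj /bj[x_le _]; apply: le_trans (enormD _ _) (lerD x_le _).
by rewrite enormZ gtr0_norm // ler_pM2l.
Qed.

Let u_le j : bounded_upto j -> (D <= j)%N -> enorm (u j) <= r ^- D * (sigma1 + al * A).
Proof.
move=> bj le_Dj; have [early|late] := leqP (j - delay j) D.
  rewrite u_early // enormZ ger0_norm //; apply: ler_pM; rewrite ?enorm_ge0 //.
    by apply: rV_mono; rewrite leq_subLR (early_bound (delay_le j)).
  have [xD _] := bj D (introT andP (conj (leqnn D) le_Dj)).
  by apply: le_trans xD _; rewrite lerDl.
rewrite u_late // enormZ ger0_norm //; apply: ler_pM; rewrite ?enorm_ge0 ?rV_mono //.
by apply: v_le bj _; rewrite (ltnW late) leq_subr.
Qed.

Let Y_ge0 j : 0 <= Y j.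
Proof. by rewrite divr_ge0. Qed.

Let Y_le j : bounded_upto j -> (D <= j)%N -> Y j <= sigma_y.
Proof.
move=> bj le_Dj; apply: le_trans sigma_yE.
have := H_le (u j); rewrite -sqr_enorm => le1.
have le2 : enorm (u j) ^+ 2 <= (r ^- D * (sigma1 + al * A)) ^+ 2.
  by rewrite lerXn2r ?nnegrE ?enorm_ge0 ?mulr_ge0 ?u_le.
by have := ler_wpM2l HM_ge0 le2; lra.
Qed.

Let x_increment j : bounded_upto j -> (D <= j)%N -> enorm (r *: x j.+1 - x j) <= delta.
Proof.
move=> bj le_Dj; rewrite x_step // addrAC subrr sub0r enormN enormZ.
have [_ z_le] := bj j (introT andP (conj le_Dj (leqnn j))).
apply: le_trans deltaE; apply: ler_pM; rewrite ?enorm_ge0 // normrM ger0_norm; last first.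
  by rewrite divr_ge0 ?mulr_ge0 // ltW.
rewrite ler_wpM2l ?divr_ge0 ?mulr_ge0 ?(ltW al_gt0) ?(ltW k_gt0) ?(ltW eps_gt0) //.
apply: le_trans (ler_normB _ _) (lerD _ (ltW z_le)).
by rewrite ger0_norm ?Y_ge0 // Y_le.
Qed.

Let v_increment j : bounded_upto j -> (D <= j)%N -> enorm (r *: v j.+1 - v j) <= inc.
Proof.
move=> bj le_Dj.
have -> : r *: v j.+1 - v j = (r *: x j.+1 - x j) + al *: (S (j + 1)%N - S j)
    - (al * (eps * lam)) *: S j.+1.
  rewrite /v addn1; apply/colP => i; rewrite !mxE; ring.
rewrite mulrDr [al * A * freq + _]addrC addrA addrAC.
apply: le_trans (enormB _ _) (lerD (le_trans (enormD _ _) (lerD _ _)) _).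
- exact: x_increment.
- rewrite enormZ gtr0_norm //; have := S_lip j 1; rewrite mulr1 => le.
  by rewrite -mulrA ler_pM2l.
- rewrite enormZ ger0_norm; last exact: mulr_ge0 (ltW al_gt0) el_ge0.
  by rewrite mulrAC ler_wpM2r // ler_wpM2l // ltW.
Qed.

Let inc_ge0 : 0 <= inc.
Proof. by rewrite addr_ge0 // mulr_ge0 // addr_ge0. Qed.

(* The input is not dithered up to time [D], whence the doubled bound. *)
Definition startup j := (D < j <= D + D)%N.

Let u_v_le j : bounded_upto j -> (D <= j)%N ->
  enorm (u j - v j) <= (1 + (startup j)%:R) * (D%:R * (r ^- D * inc)).
Proof.
move=> bj le_Dj.
have base_ge0 : 0 <= D%:R * (r ^- D * inc) by rewrite mulr_ge0 // mulr_ge0.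
have [early|late] := leqP (j - delay j) D; last first.
  apply: (@le_trans _ _ (D%:R * (r ^- D * inc))); last first.
    by rewrite ler_peMl // lerDl.
  set s := (j - delay j)%N in late *; have sj : (s + delay j)%N = j.
    by rewrite /s subnK // ltnW // -subn_gt0 (leq_ltn_trans _ late).
  have -> : u j - v j = r ^- delay j *: (v s - r ^+ delay j *: v (s + delay j)%N).
    rewrite sj scalerBr scalerA mulVf ?scale1r ?u_late //.
    by rewrite expf_neq0 // gt_eqF.
  rewrite enormZ ger0_norm // mulrCA.
  have tele : enorm (v s - r ^+ delay j *: v (s + delay j)%N) <= (delay j)%:R * inc.
    apply: discounted_telescope; first by rewrite ltW.
    move=> i lt_i; apply: v_increment; last by rewrite ltnW // ltn_addr.
    by apply: bounded_uptoW bj; rewrite -sj leq_add2l ltnW.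
  apply: ler_pM; rewrite ?enorm_ge0 ?rV_mono //; apply: le_trans tele _.
  by rewrite ler_wpM2r // ler_nat.
have le_j2D := early_bound (delay_le j) early.
rewrite u_early //.
have -> : r ^- (j - D) *: x D - v j =
    r ^- (j - D) *: (x D - r ^+ (j - D) *: x (D + (j - D))%N) - al *: S j.
  rewrite subnKC // scalerBr scalerA mulVf ?scale1r; last by rewrite expf_neq0 // gt_eqF.
  by rewrite /v opprD addrA.
have tele : enorm (x D - r ^+ (j - D) *: x (D + (j - D))%N) <= (j - D)%:R * delta.
  apply: discounted_telescope; first by rewrite ltW.
  move=> i lt_i; apply: x_increment; last by rewrite leq_addr.
  by apply: bounded_uptoW bj; rewrite -(subnKC le_Dj) leq_add2l ltnW.
(* The early input lacks its dither. Since [S 0 = 0], the missing term is a Lipschitz increment over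
   [j <= 2D] steps, twice what a delay alone can cost. *)
have tS : enorm (al *: S j) <= al * A * freq * j%:R.
  rewrite enormZ gtr0_norm // -!mulrA ler_pM2l //.
  by have := S_lip 0 j; rewrite add0n S0 subr0.
apply: le_trans (enormB _ _) _; rewrite [enorm (_ ^- _ *: _)]enormZ ger0_norm //.
have q1 : r ^- (j - D) * enorm (x D - r ^+ (j - D) *: x (D + (j - D))%N) <=
    r ^- D * ((j - D)%:R * delta).
  by apply: ler_pM; rewrite ?enorm_ge0 ?rV_mono // leq_subLR.
have q2 : al * A * freq * j%:R <= r ^- D * (al * A * freq * j%:R).
  by rewrite ler_peMl // mulr_ge0 // mulr_ge0.
apply: le_trans (lerD q1 (le_trans tS q2)) _.
have -> : r ^- D * ((j - D)%:R * delta) + r ^- D * (al * A * freq * j%:R) =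
  r ^- D * ((j - D)%:R * delta + al * A * freq * j%:R) by rewrite mulrDr.
have -> : (1 + (startup j)%:R) * (D%:R * (r ^- D * inc)) =
  r ^- D * ((1 + (startup j)%:R) * D%:R * inc) by ring.
rewrite ler_wpM2l // mulrDr lerD //.
  rewrite ler_wpM2r // (@le_trans _ _ D%:R) ?ler_nat ?leq_subLR //.
  by rewrite ler_peMl // lerDl.
(* An early input outside the startup phase occurs only at [j = D], where no doubling takes
   place. *)
have le_j : j%:R <= (1 + (startup j)%:R) * D%:R :> R.
  rewrite /startup le_j2D andbT; case: ltnP => [lt_Dj|le_jD].
    by rewrite (_ : 1 + true%:R = 2%:R) // -natrM ler_nat mul2n -addnn.
  by rewrite addr0 mul1r ler_nat.
apply: (@le_trans _ _ (al * A * freq * ((1 + (startup j)%:R) * D%:R))).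
  by rewrite ler_wpM2l // mulr_ge0.
rewrite mulrC ler_wpM2l ?mulr_ge0 ?addr_ge0 //.
by rewrite ler_wpM2l // lerDl.
Qed.

Let noise_bound j : bounded_upto j -> (D <= j)%N ->
  k / al * `|Y j - dot (v j) (H *m v j) / 2| * enorm (M j)
  <= (1 + (startup j)%:R) * noise.
Proof.
move=> bj le_Dj.
(* The difference of two squares for a symmetric form; the factor [u + v] explains [1 + r^-D] in
   [Delta_out]. *)
have -> : Y j - dot (v j) (H *m v j) / 2 = dot (u j - v j) (H *m (u j + v j)) / 2.
  move: (u j) (v j) => a b.
  rewrite mulmxDr !dotDl !dotDr !dotNl (dot_symmx a b H_sym).
  by rewrite -mulrBl; congr (_ / 2); ring.
have uv := u_v_le bj le_Dj.
have uv' : enorm (u j + v j) <= (1 + r ^- D) * (sigma1 + al * A).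
  apply: le_trans (enormD _ _) _; rewrite mulrDl mul1r addrC lerD ?u_le //.
  by apply: (v_le bj); rewrite le_Dj leqnn.
have q1 : `|dot (u j - v j) (H *m (u j + v j)) / 2| <=
   HM / 2 * ((1 + (startup j)%:R) * (D%:R * (r ^- D * inc))
     * ((1 + r ^- D) * (sigma1 + al * A))).
  rewrite normrM normfV (ger0_norm (_ : 0 <= 2)) // [HM / 2 * _]mulrAC ler_pM2r ?invr_gt0 //.
  apply: le_trans (H_dot H_sym H_ge H_le Hm_ge0 _ _) _.
  by rewrite ler_wpM2l // ler_pM ?enorm_ge0.
have kal_ge0 : 0 <= k / al by rewrite divr_ge0 // ltW.
have st_ge0 : 0 <= 1 + (startup j)%:R :> R by rewrite addr_ge0.
apply: le_trans (ler_wpM2l st_ge0 noiseE).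
apply: (@le_trans _ _ (k / al * (HM / 2 * ((1 + (startup j)%:R) * (D%:R * (r ^- D * inc))
     * ((1 + r ^- D) * (sigma1 + al * A)))) * (2 * B))).
  apply: ler_pM (M_le j); [exact: mulr_ge0|exact: enorm_ge0|].
  by rewrite ler_wpM2l.
by rewrite le_eqVlt; apply/orP; left; apply/eqP; ring.
Qed.

Let z_next j : bounded_upto j -> (D <= j)%N -> `|z j.+1| < sigma_e.
Proof.
move=> bj le_Dj; have [_ z_lt] := bj j (introT andP (conj le_Dj (leqnn j))).
have r2_gt0 : 0 < r ^+ 2 by rewrite exprn_gt0.
have ew_gt0 : 0 < eps * w by rewrite mulr_gt0.
rewrite -(ltr_pM2l r2_gt0) -[X in X * _](ger0_norm (ltW r2_gt0)) -normrM z_step //.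
apply: le_lt_trans (ler_normD _ _) _; rewrite !normrM.
rewrite [`|dot _ _|]ger0_norm //.
have -> : `|eps| * `|w| * (dot (u j) (H *m u j) * `|2^-1|) = eps * w * Y j.
  by rewrite !gtr0_norm ?invr_gt0.
have h1 : eps * w * Y j <= eps * w * sigma_y by rewrite ler_pM2l // Y_le.
have h2 : `|1 - eps * w| * `|z j| <= `|1 - eps * w| * sigma_e.
  by rewrite ler_wpM2l // ltW.
by move: filter_gain; move: h1 h2; set a := eps * w * Y j; set b := `|_| * `|z j|; lra.
Qed.

Let G_fun j := x j + eps *: correction H k al (K j) (m j) (N j) (x j) (z j).
Let extra j : R := tau * (minn (j - D.+1) D)%:R.

Let extraS j : extra j.+1 = extra j + (startup j)%:R * tau.
Proof.
rewrite /extra mulrC [tau * _]mulrC -mulrDl; congr (_ * tau); rewrite -natrD; congr (_%:R).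
exact: startup_minn.
Qed.

Let drift_ge0 : 0 <= drift.
Proof.
have sg : 0 <= sigma by apply: le_trans le_sigma.
have ri : 0 <= r^-1 - 1 by rewrite subr_ge0; have := rV_ge1 1; rewrite expr1.
have l0 := ltW lam_gt0; have e0 := ltW eps_gt0; have w0 := ltW w_gt0; have a0 := ltW al_gt0.
have se0 := ltW sigma_e_gt0; have sd0 : 0 <= sigma + delta by rewrite addr_ge0.
apply: addr_ge0; last by rewrite mulr_ge0 // mulr_ge0.
apply: addr_ge0; first by rewrite mulr_ge0 // mulr_ge0.
apply: mulr_ge0; first by rewrite divr_ge0.
apply: addr_ge0; last first.
  by rewrite mulr_ge0 // addr_ge0 // mulr_ge0 // addr_ge0.
apply: mulr_ge0; first by rewrite divr_ge0.
apply: addr_ge0; last by rewrite mulr_ge0 ?sqr_ge0.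
by rewrite addr_ge0 ?sqr_ge0 // mulr_ge0 // mulr_ge0.
Qed.

(** The bounds on [x], [z] and the averaged state support each other and are carried together. At
    each step [z] comes first, from the filter; then [x], from the current averaged state; the next
    averaged state last, since its increments use both. *)
Lemma averaged_bounds j : (D <= j)%N ->
  bounded_upto j /\ enorm (G_fun j) <= G + extra j.
Proof.
move=> /subnKC <-; elim: (j - D)%N => [|d [bj Gj]].
  rewrite addn0; split=> [s /andP[le1 le2]|].
    have -> : s = D by apply/eqP; rewrite eqn_leq le1 le2.
    by split=> //; apply: le_trans init_x1.
  rewrite /extra subnS subnn min0n mulr0 addr0; apply: le_trans G_init.
  apply: le_trans (enormD _ _) (lerD init_x _).
  apply: correction_le => //; last exact: ltW.
  exact: le_trans (le_trans init_x init_x1) le_sigma.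
rewrite addnS; set i := (D + d)%N in bj Gj *; have le_Di : (D <= i)%N by rewrite leq_addr.
have [xi_le zi_lt] := bj i (introT andP (conj le_Di (leqnn i))).
have z1 := z_next bj le_Di.
have xi_le' := le_trans xi_le le_sigma.
set W := Y i - dot (v i) (H *m v i) / 2.
have Y_split : Y i = dot (x i + al *: S i) (H *m (x i + al *: S i)) / 2 + W.
  by rewrite /W addrC subrK.
have W_le := noise_bound bj le_Di; rewrite -/W in W_le.
have qm_ge0 : 0 <= 1 - eps * k * Hm.
  have : eps * k * Hm <= eps * k * HM by rewrite ler_pM2l // mulr_gt0.
  by move: HM_small; lra.
have qG : (1 - eps * k * Hm) * enorm (G_fun i) <= (1 - eps * k * Hm) * (G + extra i).
  by rewrite ler_wpM2l.
have ex_ge0 : 0 <= extra i by rewrite mulr_ge0.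
have st_ge0 : 0 <= (startup i)%:R :> R by [].
have stau : (startup i)%:R * (eps * noise) <= r * ((startup i)%:R * tau).
  by rewrite [leRHS]mulrCA ler_wpM2l.
(* The part accumulated during startup only has to persist: the contraction factor is at most [r],
   so no share of the drift budget is spent on it. *)
have qex : (1 - eps * k * Hm) * extra i <= r * extra i.
  rewrite ler_wpM2r //; have : eps * lam <= eps * (k * Hm) by rewrite ler_pM2l // ltW.
  lra.
have main : (1 - eps * k * Hm) * enorm (G_fun i) + eps * k * HM * corr
    + eps * ((1 + (startup i)%:R) * noise) + drift <= r * (G + extra i.+1).
  rewrite extraS; move: G_drift qG stau qex.
  set dd := drift; set cc := eps * k * HM * corr; set gg := _ * enorm _.
  move: (extra i) ((startup i)%:R : R) => xx ss; lra.
have x1 : enorm (x i.+1) <= sigma1.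
  have := x_step_le H_sym H_ge H_le Hm_ge0 HM_ge0 k_gt0 al_gt0 eps_gt0 lam_small HM_small
    (K_step i) (m_step i) (N_step i) (x_step le_Di) Y_split
    c1_ge0 (K_le i) (K_le i.+1) (m_le i) (m_le i.+1) (N_le i) (N_le i.+1)
    xi_le' (ltW zi_lt) W_le.
  move=> le1; rewrite -(ler_pM2l r_gt0).
  have le2 : r * (G + extra i.+1 + gam) <= r * sigma1.
    rewrite ler_pM2l //; apply: le_trans sigma1E; rewrite lerD2r lerD2l /extra mulrC.
    by rewrite ler_wpM2r // ler_nat geq_minr.
  apply: le_trans le2; move: le1 main gamE drift_ge0; rewrite -/(G_fun i).
  set dd := drift; set cc := corr; set gg := _ * enorm _; lra.
split.
  move=> s /andP[le_Ds]; rewrite leq_eqVlt ltnS => /orP[/eqP -> //|le_si].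
  by apply: bj; rewrite le_Ds.
rewrite -(ler_pM2l r_gt0); apply: le_trans main.
have dz : `|r * z i.+1 - z i| <= zeta.
  (* The filter equation rearranged so that every term has a factor [eps]. *)
  have -> : r * z i.+1 - z i = eps * lam * (r * z i.+1) - eps * w * (z i - Y i).
    have := z_step le_Di; set t := Y i; lra.
  apply: le_trans (ler_normB _ _) _.
  rewrite !normrM !(gtr0_norm eps_gt0) (gtr0_norm lam_gt0) (gtr0_norm w_gt0) (gtr0_norm r_gt0).
  have h1 : r * `|z i.+1| <= 1 * sigma_e by rewrite ler_pM // ltW.
  have h2 : `|z i - Y i| <= sigma_e + sigma_y.
    apply: le_trans (ler_normB _ _) (lerD (ltW zi_lt) _).
    by rewrite ger0_norm ?Y_ge0 // Y_le.
  have h3 : eps * lam * (r * `|z i.+1|) <= eps * lam * (1 * sigma_e) by rewrite ler_wpM2l.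
  have h4 : eps * w * `|z i - Y i| <= eps * w * (sigma_e + sigma_y).
    by rewrite ler_wpM2l // mulr_ge0 ?ltW.
  by move: h3 h4; set t := eps * w * `|_|; set t' := _ * (r * _); lra.
exact: (g_step_le H_sym H_ge H_le Hm_ge0 HM_ge0 k_gt0 al_gt0 eps_gt0 lam_gt0 lam_small HM_small
    (K_step i) (m_step i) (N_step i) (x_step le_Di) Y_split
    c1_ge0 (K_le i) (K_le i.+1) (m_le i) (m_le i.+1) (N_le i) (N_le i.+1)
    xi_le' (ltW zi_lt) W_le (x_increment bj le_Di) dz).
Qed.

Lemma error_bounds j : (D <= j)%N -> enorm (x j) <= sigma1 /\ `|z j| < sigma_e.
Proof.
by move=> le_Dj; have [bj _] := averaged_bounds le_Dj; apply: bj; rewrite le_Dj leqnn.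
Qed.

End Induction.

(** * Consequences of the conditions on [eps_star] *)

Section Margins.
Context {R : realType} {n : nat}.
Variables (p : design R n) (k lambda sigma es : R).
Hypotheses (n_gt0 : (0 < n)%N) (D_M_gt0 : (0 < D_M p)%N)
  (H_m_gt0 : 0 < H_m p) (H_mM : H_m p <= H_M p)
  (sigma0_gt0 : 0 < sigma0 p) (Delta_Q_gt0 : 0 < Delta_Q p)
  (a_gt0 : forall i, 0 < a p i) (alpha0_gt0 : 0 < alpha0 p)
  (omega_h_gt0 : 0 < omega_h p) (k_gt0 : 0 < k) (lambda_gt0 : 0 < lambda)
  (lt_lambda_kH : lambda < k * H_m p) (lt_lambda_omega : 2 * lambda < omega_h p)
  (lt_sigma : sigma0 p < sigma) (es_gt0 : 0 < es)
  (ca : cond_a p es) (cb : cond_b p k lambda es) (cc : cond_c p k lambda sigma es).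

Local Notation D := (D_M p).
Local Notation E := (Num.sqrt es).
Local Notation A := (norm_a p).
Local Notation B := (norm_ainv p).
Local Notation al := (alpha0 p).
Local Notation kap := (k * H_M p).
Local Notation gap := (k * H_m p - lambda).
Local Notation r := (1 - es * lambda).
Local Notation q := `|1 - es * omega_h p|.
Local Notation Sy := (sigma_y p lambda sigma es).
Local Notation Se := (sigma_eta p lambda sigma es).
Local Notation DG := (Delta_G p k lambda sigma es).
Local Notation Dl := (Delta p k lambda sigma es).
Local Notation Do := (Delta_out p k lambda sigma es).
Local Notation DY := (Delta_Y p k lambda sigma es).

Lemma cond_b_decay : es * (lambda + k * H_m p) < 2.
Proof.
apply: le_lt_trans cb; rewrite ler_pM2l //.
by rewrite le_max lexx.
Qed.

Lemma cond_b_filter : es * (omega_h p + 2 * lambda - es * lambda ^+ 2) < 2.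
Proof.
apply: le_lt_trans cb; rewrite ler_pM2l //.
by rewrite le_max lexx orbT.
Qed.

Lemma decay_base_gt0 : 0 < r.
Proof. by case: (decay_bounds es_gt0 lambda_gt0 lt_lambda_kH cond_b_decay). Qed.

Lemma decay_base_lt1 : r < 1.
Proof. by case: (decay_bounds es_gt0 lambda_gt0 lt_lambda_kH cond_b_decay). Qed.

Let rE : `|1 - es * lambda| = r. Proof. exact/gtr0_norm/decay_base_gt0. Qed.

Lemma filter_lt_decay : q < r ^+ 2.
Proof.
apply: filter_bounds => //; last exact: cond_b_filter.
by have := decay_base_gt0; lra.
Qed.

Let E_gt0 : 0 < E. Proof. by rewrite sqrtr_gt0. Qed.

Let E2 : E ^+ 2 = es. Proof. by rewrite sqr_sqrtr // ltW. Qed.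

(** Condition (a) makes the floor of [1 / E] positive, hence [E <= 1]; the definedness clause of (c)
    excludes equality. *)
Let E_lt1 : E < 1.
Proof.
have : (0 < Num.truncn (1 / E))%N.
  by move: ca; rewrite /cond_a; case: Num.truncn => //; rewrite muln0 addn1.
rewrite truncn_gt_nat => h; have := E_gt0 => Egt0.
rewrite lt_neqAle; case: cc; rewrite subr_eq0 eq_sym => -> _ _ _ /=.
by rewrite -[E]mul1r -ler_pdivlMr.
Qed.

Let kap_gt : lambda < kap.
Proof. by apply: lt_le_trans lt_lambda_kH _; rewrite ler_pM2l. Qed.

Let kap_gt0 : 0 < kap. Proof. by have := kap_gt; have := lambda_gt0; lra. Qed.
Let gap_gt0 : 0 < gap. Proof. by rewrite subr_gt0. Qed.
Let gap_le : gap <= kap.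
Proof.
have : k * H_m p <= kap by rewrite ler_pM2l.
by have := lambda_gt0; lra.
Qed.
Let H_M_gt0 : 0 < H_M p. Proof. exact: lt_le_trans H_m_gt0 H_mM. Qed.
Let sigma_gt0 : 0 < sigma. Proof. exact: lt_trans sigma0_gt0 lt_sigma. Qed.
Let D_gt0 : 0 < D%:R :> R. Proof. by rewrite ltr0n. Qed.
Let nR_ge1 : 1 <= n%:R :> R. Proof. by rewrite ler1n. Qed.
Let D_ge1 : 1 <= D%:R :> R. Proof. by rewrite ler1n. Qed.
Let nD_gt0 : 0 < n%:R * D%:R :> R. Proof. by rewrite mulr_gt0 // ltr0n. Qed.
Let idx_gt0 (i : 'I_n) : 0 < i.+1%:R :> R. Proof. exact: ltr0Sn. Qed.
Let ainv_ge0 i : 0 <= (a p i)^-1. Proof. by rewrite invr_ge0 ltW. Qed.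

Lemma norm_a_ge0 : 0 <= A. Proof. exact: sqrtr_ge0. Qed.
Lemma norm_ainv_ge0 : 0 <= B. Proof. exact: sqrtr_ge0. Qed.

Let i0 := Ordinal n_gt0.

Let norm_a_ge : a p i0 <= A.
Proof.
rewrite -[leLHS](gtr0_norm (a_gt0 i0)) -sqrtr_sqr ler_wsqrtr // (bigD1 i0) //= lerDl.
by apply: sumr_ge0 => i _; apply: sqr_ge0.
Qed.

Let norm_ainv_ge : (a p i0)^-1 <= B.
Proof.
rewrite -[leLHS]ger0_norm // -sqrtr_sqr ler_wsqrtr // (bigD1 i0) //= exprVn lerDl.
by apply: sumr_ge0 => i _; rewrite -exprVn; apply: sqr_ge0.
Qed.

Let norm_prod_ge1 : 1 <= A * B.
Proof.
rewrite -[leLHS](divff (lt0r_neq0 (a_gt0 i0))).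
by apply: ler_pM => //; rewrite ?ainv_ge0 ?(ltW (a_gt0 i0)).
Qed.

Let inv_sum_ge : 1 <= A * \sum_(i < n) 1 / (i.+1%:R * a p i).
Proof.
have : (a p i0)^-1 <= \sum_(i < n) 1 / (i.+1%:R * a p i).
  rewrite (bigD1 i0) //= mul1r mul1r lerDl; apply: sumr_ge0 => i _.
  by rewrite divr_ge0 // mulr_ge0 ?ltW.
move=> le; rewrite -[leLHS](divff (lt0r_neq0 (a_gt0 i0))).
by apply: ler_pM => //; rewrite ?ainv_ge0 ?(ltW (a_gt0 i0)).
Qed.

Lemma d019245_bounds : 19 / 100 < @d019245 R < 2 / 10.
Proof. by rewrite /d019245 /d03849; apply/andP; split; lra. Qed.

Let d_gt0 : 0 < @d019245 R. Proof. by case/andP: d019245_bounds; lra. Qed.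

Lemma d03849E : @d03849 R = 2 * @d019245 R.
Proof. by rewrite /d019245; lra. Qed.

Let sum_ge0 : 0 <= \sum_(i < n) 1 / (i.+1%:R * a p i).
Proof. by apply: sumr_ge0 => i _; rewrite divr_ge0 // mulr_ge0 ?ltW. Qed.

Lemma rho1_ge : @d019245 R * (n%:R * D%:R) * kap <= rho1 p k.
Proof.
rewrite /rho1; set Q := _ + _; have Q_ge1 : 1 <= Q.
  rewrite /Q (bigD1 i0) //= divr1 -addrA lerDl addr_ge0 //.
    by apply: sumr_ge0 => i _; rewrite divr_ge0.
  apply: sumr_ge0 => i _; apply: sumr_ge0 => l _.
  by rewrite mulr_ge0 ?divr_ge0 ?addr_ge0 ?divr_ge0 ?addr_ge0 // ltW.
have -> : @d019245 R * (n%:R * D%:R) * k * H_M p * Q =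
  @d019245 R * (n%:R * D%:R) * kap * Q by ring.
by rewrite ler_peMr // ltW // mulr_gt0 ?kap_gt0 // mulr_gt0.
Qed.

Lemma rho1_ge0 : 0 <= rho1 p k.
Proof. by apply: le_trans rho1_ge; rewrite ltW // mulr_gt0 ?kap_gt0 // mulr_gt0. Qed.

Lemma rho2_ge0 : 0 <= rho2 p k.
Proof.
rewrite /rho2 d03849E; move: (@d019245 R) (ltW d_gt0) => d d_ge0.
by rewrite !mulr_ge0 // ltW.
Qed.

Lemma rho4E : rho4 p k = rho2 p k / 2.
Proof. by rewrite /rho4 /rho2 d03849E; lra. Qed.

Lemma rho3_ge0 : 0 <= rho3 p k es.
Proof.
rewrite /rho3 !mulr_ge0 ?sqrtr_ge0 ?(ltW k_gt0) ?(ltW H_M_gt0) //.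
by apply: sumr_ge0 => i _; apply: sqr_ge0.
Qed.

Let rD_gt0 d : 0 < r ^+ d. Proof. exact/exprn_gt0/decay_base_gt0. Qed.
Let rD_le1 d : r ^+ d <= 1.
Proof. by apply: exprn_ile1; rewrite ltW ?decay_base_gt0 ?decay_base_lt1. Qed.
Let rV_ge1 d : 1 <= r ^- d.
Proof. by rewrite invf_ge1. Qed.
Let amp_gt0 : 0 < sigma + al * A.
Proof. by rewrite ltr_wpDr // mulr_ge0 ?norm_a_ge0 ?ltW. Qed.

Lemma sigma_y_ge : H_M p / 2 * (sigma + al * A) ^+ 2 <= Sy.
Proof.
rewrite /sigma_y rE [leRHS]mulrAC ler_peMr ?rV_ge1 //.
by rewrite mulr_ge0 ?sqr_ge0 // divr_ge0 // ltW.
Qed.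

Lemma sigma_y_gt0 : 0 < Sy.
Proof. by apply: lt_le_trans sigma_y_ge; rewrite mulr_gt0 ?exprn_gt0 // divr_gt0. Qed.

(** Because [q >= 1 - es w], the denominator [r^2 - q] is at most [es] times the expression in the
    statement, and [es] cancels: the filter contribution does not become small with the step. *)
Lemma sigma_eta_ge : Delta_Q p * q ^- D
    + omega_h p * Sy / (omega_h p - 2 * lambda + es * lambda ^+ 2) <= Se.
Proof.
have ql := filter_lt_decay.
rewrite /sigma_eta rE lerD2l.
have dp : 0 < omega_h p - 2 * lambda + es * lambda ^+ 2.
  by have := mulr_gt0 es_gt0 (exprn_gt0 2 lambda_gt0); have := lt_lambda_omega; lra.
rewrite ler_pdivrMr // mulrAC ler_pdivlMr ?subr_gt0 //.
have -> : es * omega_h p * Sy * (omega_h p - 2 * lambda + es * lambda ^+ 2) =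
  omega_h p * Sy * (es * (omega_h p - 2 * lambda + es * lambda ^+ 2)) by ring.
rewrite (ler_pM2l (mulr_gt0 omega_h_gt0 sigma_y_gt0)).
by have := ler_norm (1 - es * omega_h p); lra.
Qed.

Let q_neq0 : q != 0.
Proof. by case: cc => _ h _ _; rewrite normr_eq0. Qed.

Let q_gt0 : 0 < q. Proof. by rewrite lt_def q_neq0 normr_ge0. Qed.

(** Normalization multiplies the initial filter error by [r^-2D], while [sigma_eta] provides [q^-D];
    [q < r^2] reconciles the two. *)
Let DQ_le : Delta_Q p * r ^- (2 * D) <= Delta_Q p * q ^- D.
Proof.
rewrite ler_pM2l // lef_pV2 ?posrE ?exprn_gt0 //; last exact: decay_base_gt0.
by rewrite exprM lerXn2r ?nnegrE ?normr_ge0 ?sqr_ge0 // ltW // filter_lt_decay.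
Qed.

Let DQ_gt0 : 0 < Delta_Q p * q ^- D.
Proof. by rewrite mulr_gt0 // invr_gt0 exprn_gt0. Qed.

Lemma sigma_y_le_eta : Sy <= Se.
Proof.
apply: le_trans sigma_eta_ge.
set X := omega_h p - 2 * lambda + es * lambda ^+ 2.
apply: (@le_trans _ _ (omega_h p * Sy / X)); last by rewrite lerDr ltW // DQ_gt0.
rewrite /X {X}.
have el : es * lambda < 1 by have := decay_base_gt0; lra.
have h1 : es * lambda * lambda <= 1 * lambda by rewrite ler_pM2r // ltW.
have dp : 0 < omega_h p - 2 * lambda + es * lambda ^+ 2.
  by have := mulr_gt0 es_gt0 (exprn_gt0 2 lambda_gt0); have := lt_lambda_omega; lra.
rewrite ler_pdivlMr // mulrC ler_pM2r ?sigma_y_gt0 //.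
by have := lambda_gt0; lra.
Qed.

Lemma sigma_eta_gt0 : 0 < Se. Proof. exact: lt_le_trans sigma_y_gt0 sigma_y_le_eta. Qed.

(** The factor [omega_h / (omega_h - 2 lambda + ...)] is kept because it grows as [omega_h]
    approaches [2 lambda], which is exactly when the filter gain is most sensitive to [eps]. *)
Lemma rho2_term_ge : @d019245 R * (n%:R * D%:R) * kap * (sigma + al * A) *
    (omega_h p / (omega_h p - 2 * lambda + es * lambda ^+ 2)) <= rho2 p k * (Se / al).
Proof.
set X := omega_h p / _.
have X_gt0 : 0 < X.
  have := mulr_gt0 es_gt0 (exprn_gt0 2 lambda_gt0) => h.
  by rewrite divr_gt0 //; have := lt_lambda_omega; lra.
set s := \sum_(i < n) 1 / (i.+1%:R * a p i).
have h1 : X * (H_M p / 2 * (sigma + al * A) ^+ 2) <= Se.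
  apply: le_trans sigma_eta_ge; apply: (@le_trans _ _ (X * Sy)).
    by rewrite ler_pM2l // sigma_y_ge.
  by rewrite /X mulrAC lerDr ltW // DQ_gt0.
have h2 : al <= (sigma + al * A) * s.
  apply: (@le_trans _ _ (al * (A * s))); first by rewrite ler_peMr // ltW.
  by rewrite mulrA ler_wpM2r // lerDr ltW.
rewrite /rho2 -/s d03849E; move: (@d019245 R) d_gt0 => d d_gt0'.
rewrite [leRHS]mulrA ler_pdivlMr //.
have -> : 2 * d * (n%:R * D%:R) * k * s * Se = (2 * d * (n%:R * D%:R) * k) * (s * Se) by ring.
have -> : d * (n%:R * D%:R) * kap * (sigma + al * A) * X * al
   = (2 * d * (n%:R * D%:R) * k) * (X * (H_M p / 2) * (sigma + al * A) * al).
  by field.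
rewrite ler_pM2l; last by do 3!apply: mulr_gt0 => //.
apply: (@le_trans _ _ (X * (H_M p / 2) * (sigma + al * A) * ((sigma + al * A) * s))).
  by rewrite ler_pM2l //; do 2!apply: mulr_gt0 => //; apply: divr_gt0.
have -> : X * (H_M p / 2) * (sigma + al * A) * ((sigma + al * A) * s) =
   s * (X * (H_M p / 2 * (sigma + al * A) ^+ 2)) by ring.
by rewrite ler_wpM2l.
Qed.

(** The 4 is AM-GM: [(sigma + al A)^2 >= 4 sigma al A]. *)
Lemma rho2_term_ge4 : 4 * (@d019245 R * (n%:R * D%:R) * kap * sigma) <= rho2 p k * (Se / al).
Proof.
set s := \sum_(i < n) 1 / (i.+1%:R * a p i).
have h1 : 2 * H_M p * sigma * al * A <= Se.
  apply: le_trans (le_trans sigma_y_ge sigma_y_le_eta).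
  have : 0 <= H_M p * (sigma - al * A) ^+ 2 by rewrite mulr_ge0 ?sqr_ge0 // ltW.
  lra.
rewrite /rho2 -/s d03849E; move: (@d019245 R) d_gt0 => d d_gt0'.
rewrite [leRHS]mulrA ler_pdivlMr //.
have -> : 2 * d * (n%:R * D%:R) * k * s * Se = (2 * d * (n%:R * D%:R) * k) * (s * Se) by ring.
have -> : 4 * (d * (n%:R * D%:R) * kap * sigma) * al
   = (2 * d * (n%:R * D%:R) * k) * (2 * H_M p * sigma * al).
  by ring.
rewrite ler_pM2l; last by do 3!apply: mulr_gt0 => //.
apply: (@le_trans _ _ (s * (2 * H_M p * sigma * al * A))); last by rewrite ler_wpM2l.
have -> : s * (2 * H_M p * sigma * al * A) = 2 * H_M p * sigma * al * (A * s) by ring.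
by rewrite ler_peMr // ltW //; do 3!apply: mulr_gt0 => //.
Qed.

Lemma Delta_G_ge_rho2 : rho2 p k * (Se / al) <= DG.
Proof.
have h1 := mulr_ge0 rho1_ge0 (ltW sigma_gt0).
have h3 := mulr_ge0 rho3_ge0 (ltW alpha0_gt0).
have h4 : 0 <= rho4 p k * (sigma ^+ 2 * H_M p / al).
  rewrite rho4E; apply: mulr_ge0; first by rewrite divr_ge0 ?rho2_ge0.
  exact: divr_ge0 (mulr_ge0 (sqr_ge0 _) (ltW H_M_gt0)) (ltW alpha0_gt0).
by rewrite /Delta_G; lra.
Qed.

(** [19/20] is five times [19/100]: four shares come from [rho2_term_ge4] and one from [rho1_ge]. *)
Lemma Delta_G_ge : 19 / 20 * (n%:R * D%:R * kap * sigma) <= DG.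
Proof.
have h2 := rho2_term_ge4.
have h3 := mulr_ge0 rho3_ge0 (ltW alpha0_gt0).
have h4 : 0 <= rho4 p k * (sigma ^+ 2 * H_M p / al).
  rewrite rho4E; apply: mulr_ge0; first by rewrite divr_ge0 ?rho2_ge0.
  exact: divr_ge0 (mulr_ge0 (sqr_ge0 _) (ltW H_M_gt0)) (ltW alpha0_gt0).
have h1 : @d019245 R * (n%:R * D%:R) * kap * sigma <= rho1 p k * sigma.
  by rewrite ler_pM2r // rho1_ge.
have h0 : 19 / 100 * (n%:R * D%:R * kap * sigma) <= @d019245 R * (n%:R * D%:R * kap * sigma).
  rewrite ler_wpM2r //; last by case/andP: d019245_bounds; lra.
  by rewrite !mulr_ge0 ?(ltW sigma_gt0) ?(ltW k_gt0) ?(ltW H_M_gt0).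
by rewrite /Delta_G; lra.
Qed.

Lemma Delta_G_gt0 : 0 < DG.
Proof.
apply: lt_le_trans Delta_G_ge; apply: mulr_gt0; first by lra.
by do 2!apply: mulr_gt0 => //.
Qed.

Lemma Delta_ge0 : 0 <= Dl.
Proof.
rewrite /Delta; apply: mulr_ge0 => //; last exact: norm_ainv_ge0.
apply: mulr_ge0; first by rewrite divr_ge0 ?mulr_ge0 // ltW.
rewrite addr_ge0 ?(ltW sigma_eta_gt0) //; apply: mulr_ge0; last exact: sqr_ge0.
by rewrite divr_ge0 // ltW.
Qed.

Let oneE_gt0 : 0 < 1 - E. Proof. by have := E_lt1; lra. Qed.

Let Do_factor : Do = k * D%:R * H_M p / al * B * (sigma + al * A) * (1 + r ^- D)
  * (2 * E * k * (Sy + Se) / al * B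
     + al * A * (lambda * E
          + 2 * pi / ((1 - E) * D%:R) * (pi * E / ((1 - E) * D%:R) + 1)) / r).
Proof. by rewrite /Delta_out rE. Qed.

Let pref_ge0 : 0 <= k * D%:R * H_M p / al * B * (sigma + al * A).
Proof.
apply: mulr_ge0; last exact: ltW.
apply: mulr_ge0; last exact: norm_ainv_ge0.
by rewrite divr_ge0 ?mulr_ge0 // ltW.
Qed.

Let gain_ge0 : 0 <= 2 * E * k * (Sy + Se) / al * B.
Proof.
apply: mulr_ge0; last exact: norm_ainv_ge0.
rewrite divr_ge0 ?(ltW alpha0_gt0) //; apply: mulr_ge0.
  by rewrite !mulr_ge0 ?(ltW E_gt0) ?(ltW k_gt0).
by rewrite addr_ge0 ?(ltW sigma_y_gt0) ?(ltW sigma_eta_gt0).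
Qed.

Let freq_ge : 2 * pi / ((1 - E) * D%:R) <= lambda * E
  + 2 * pi / ((1 - E) * D%:R) * (pi * E / ((1 - E) * D%:R) + 1).
Proof.
have pi0 := pi_ge0 R.
have h1 := mulr_ge0 (ltW lambda_gt0) (ltW E_gt0).
have h2 : 0 <= 2 * pi / ((1 - E) * D%:R).
  by rewrite divr_ge0 ?mulr_ge0 ?(ltW oneE_gt0).
have h3 : 0 <= pi * E / ((1 - E) * D%:R).
  by rewrite divr_ge0 ?mulr_ge0 ?(ltW oneE_gt0) ?(ltW E_gt0).
have h4 := mulr_ge0 h2 h3; move: h1 h4; set x := 2 * pi / _; set y := pi * E / _; lra.
Qed.

(** The 12 is [2 * 2 * 3]: [1 + r^-D >= 2], the 2 of [2 pi], and [pi >= 3]. The dither amplitudes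
    disappear through [A B >= 1]. *)
Lemma Delta_out_ge : 12 * kap * (sigma + al * A) <= Do * (1 - E).
Proof.
have pi3 := @pi_ge3 R.
have h : al * A * (2 * pi / ((1 - E) * D%:R)) <= 2 * E * k * (Sy + Se) / al * B
     + al * A * (lambda * E
          + 2 * pi / ((1 - E) * D%:R) * (pi * E / ((1 - E) * D%:R) + 1)) / r.
  rewrite (le_trans _ (lerD gain_ge0 (lexx _))) // add0r.
  have A0 : 0 <= al * A by rewrite mulr_ge0 ?norm_a_ge0 // ltW.
  apply: le_trans (ler_wpM2l A0 freq_ge) _.
  rewrite ler_peMr //; last by rewrite invf_ge1 ?decay_base_gt0 // ltW // decay_base_lt1.
  apply: mulr_ge0 => //; apply: le_trans freq_ge.
  by rewrite divr_ge0 ?mulr_ge0 ?pi_ge0 ?(ltW oneE_gt0).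
have h2 : k * D%:R * H_M p / al * B * (sigma + al * A) * 2 <=
   k * D%:R * H_M p / al * B * (sigma + al * A) * (1 + r ^- D).
  by rewrite ler_wpM2l //; have := rV_ge1 D; lra.
rewrite Do_factor.
apply: (@le_trans _ _ (k * D%:R * H_M p / al * B * (sigma + al * A) * 2 *
   (al * A * (2 * pi / ((1 - E) * D%:R))) * (1 - E))); last first.
  rewrite ler_pM2r // ler_pM //; first by rewrite mulr_ge0.
  by rewrite mulr_ge0 ?divr_ge0 ?mulr_ge0 ?pi_ge0 ?norm_a_ge0 ?(ltW oneE_gt0) ?(ltW alpha0_gt0).
have -> : k * D%:R * H_M p / al * B * (sigma + al * A) * 2 *
   (al * A * (2 * pi / ((1 - E) * D%:R))) * (1 - E) =
   kap * (sigma + al * A) * (4 * pi * (A * B)).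
  move: (pi) (A) (B) oneE_gt0 => t u v E1; field.
  by rewrite !gt_eqF //; move: E1; lra.
have -> : 12 * kap * (sigma + al * A) = kap * (sigma + al * A) * 12 by ring.
rewrite (ler_pM2l (mulr_gt0 kap_gt0 amp_gt0)).
have : 3 * 1 <= pi * (A * B) by apply: ler_pM.
lra.
Qed.

Lemma Delta_out_gt0 : 0 < Do.
Proof.
rewrite -(pmulr_lgt0 _ oneE_gt0); apply: lt_le_trans Delta_out_ge.
by apply: mulr_gt0 => //; apply: mulr_gt0.
Qed.

Lemma Delta_Y_ge : kap * DG + Do <= DY.
Proof.
have DDo : 0 <= Dl + E * Do.
  by rewrite addr_ge0 ?Delta_ge0 // mulr_ge0 ?(ltW E_gt0) ?(ltW Delta_out_gt0).
have alV : 0 <= al^-1 by rewrite invr_ge0 ltW.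
have S0 := addr_ge0 (ltW sigma_y_gt0) (ltW sigma_eta_gt0).
have R4 : 0 <= rho4 p k by rewrite rho4E divr_ge0 ?rho2_ge0.
have rV : 0 <= r^-1 by rewrite invr_ge0 ltW // decay_base_gt0.
have w0 := ltW omega_h_gt0; have l0 := ltW lambda_gt0; have e0 := ltW es_gt0.
have M0 := ltW H_M_gt0; have s0 := ltW sigma_gt0.
have t1 := mulr_ge0 rho1_ge0 DDo.
have t2 : 0 <= omega_h p * rho2 p k / al * (Sy + Se).
  by rewrite mulr_ge0 // mulr_ge0 // mulr_ge0 // rho2_ge0.
have t3 : 0 <= rho2 p k * lambda * (Se * q + es * omega_h p * Sy) / (al * r).
  apply: divr_ge0; last exact: mulr_ge0 (ltW alpha0_gt0) (ltW decay_base_gt0).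
  apply: mulr_ge0; first exact: mulr_ge0 rho2_ge0 l0.
  apply: addr_ge0; first exact: mulr_ge0 (ltW sigma_eta_gt0) (normr_ge0 _).
  exact: mulr_ge0 (mulr_ge0 e0 w0) (ltW sigma_y_gt0).
have t4 : 0 <= rho3 p k es * al * lambda.
  by rewrite mulr_ge0 // mulr_ge0 ?rho3_ge0 // ltW.
have t5 : 0 <= 2 * rho4 p k * sigma * al^-1 * H_M p * (Dl + E * Do).
  by rewrite mulr_ge0 // mulr_ge0 // mulr_ge0 // mulr_ge0 // mulr_ge0.
have t6 : 0 <= es * rho4 p k * al^-1 * H_M p * (Dl + E * Do) ^+ 2.
  by rewrite mulr_ge0 ?sqr_ge0 // mulr_ge0 // mulr_ge0 // mulr_ge0.
have t7 : 0 <= rho4 p k * al^-1 * lambda / r * H_M p * (sigma + es * (Dl + E * Do)) ^+ 2.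
  by rewrite mulr_ge0 ?sqr_ge0 // mulr_ge0 // mulr_ge0 // mulr_ge0 // mulr_ge0.
by rewrite /Delta_Y rE; lra.
Qed.

(** In (c), the factor [|1 - es k H_m|] is below [r], and its distance to [r] is at most [es * gap].
    The first fact yields a second full [E DG], the second replaces the last quotient by
    [E DY / gap]. *)
Lemma cond_c_margin : sigma0 p * r ^- D + E * (2 * DG + DY / gap) < sigma.
Proof.
case: cc => _ _ nz; rewrite rE; apply: le_lt_trans.
have [r0 r1 qm_lt] := decay_bounds es_gt0 lambda_gt0 lt_lambda_kH cond_b_decay.
rewrite mulrA in qm_lt.
have qm_gt0 : 0 < `|1 - es * k * H_m p| by rewrite normr_gt0.
set qm := `|_| in qm_lt qm_gt0 *.
have DY0 : 0 <= DY.
  by apply: le_trans Delta_Y_ge; rewrite addr_ge0 ?(ltW Delta_out_gt0) // mulr_ge0 ?(ltW Delta_G_gt0) // ltW.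
have h1 : (sigma0 p + E * DG * r ^+ D) * r ^- D <= (sigma0 p + E * DG * r ^+ D) * qm ^- D.
  rewrite ler_wpM2l //.
    by rewrite addr_ge0 ?(ltW sigma0_gt0) // !mulr_ge0 ?(ltW E_gt0) ?(ltW Delta_G_gt0) ?(ltW (rD_gt0 _)).
  by rewrite lef_pV2 ?posrE ?exprn_gt0 // lerXn2r ?nnegrE ?ltW.
rewrite mulrDl mulfK ?gt_eqF // in h1.
have h2 : E * (DY / gap) <= E ^+ 3 * DY / (r - qm).
  have rq : 0 < r - qm by rewrite subr_gt0.
  rewrite mulrA ler_pdivrMr // mulrAC ler_pdivlMr //.
  have -> : E ^+ 3 * DY * gap = E * DY * (es * gap) by rewrite exprS E2; ring.
  rewrite ler_wpM2l ?mulr_ge0 ?(ltW E_gt0) //.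
  by have := ler_norm (1 - es * k * H_m p); rewrite -/qm; lra.
by lra.
Qed.

(** As [kap >= gap], the summand [kap DG] of [DY] contributes a third [E DG]. *)
Lemma gap_margin : 3 * (E * DG) + E * (Do / gap) < sigma.
Proof.
apply: le_lt_trans cond_c_margin.
have h0 : 0 <= sigma0 p * r ^- D by rewrite mulr_ge0 ?(ltW sigma0_gt0) // invr_ge0 ltW.
have h1 : DG + Do / gap <= DY / gap.
  rewrite ler_pdivlMr // mulrDl divfK ?gt_eqF //; apply: le_trans Delta_Y_ge; rewrite lerD2r.
  by rewrite mulrC ler_wpM2r // ltW // Delta_G_gt0.
have := ler_wpM2l (ltW E_gt0) h1; lra.
Qed.

Let Do_gap_ge : 12 * sigma <= Do / gap * (1 - E).
Proof.
rewrite mulrAC ler_pdivlMr //; apply: (@le_trans _ _ (12 * kap * sigma)).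
  by rewrite mulrAC ler_pM2r // ler_pM2l.
apply: le_trans Delta_out_ge.
by rewrite ler_pM2l ?mulr_gt0 // lerDl mulr_ge0 ?norm_a_ge0 // ltW.
Qed.

Let Do_gap_ge0 : 0 <= Do / gap.
Proof. by rewrite divr_ge0 ?(ltW Delta_out_gt0) // ltW. Qed.

Lemma E_margin : 3 * (19 / 20) * (E * (n%:R * D%:R * kap)) + 12 * E < 1.
Proof.
rewrite -(ltr_pM2r sigma_gt0) mul1r; apply: le_lt_trans gap_margin.
have h1 : E * (19 / 20 * (n%:R * D%:R * kap * sigma)) <= E * DG by rewrite ler_pM2l ?E_gt0 ?Delta_G_ge.
have h2 : 12 * sigma <= Do / gap.
  by apply: le_trans Do_gap_ge _; rewrite ler_piMr //; have := E_gt0; lra.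
have := ler_wpM2l (ltW E_gt0) h2; lra.
Qed.

(** Keeping the factor [1 - E] of [Delta_out_ge] gives [12 E < 1 - E], hence 13 rather than 12. *)
Lemma E_small : E < 1 / 13.
Proof.
have h1 : E * (12 * sigma) <= E * (Do / gap * (1 - E)) by rewrite ler_pM2l ?E_gt0 ?Do_gap_ge.
have h2 : E * (Do / gap) * (1 - E) < sigma * (1 - E).
  rewrite ltr_pM2r //; apply: le_lt_trans gap_margin.
  by rewrite lerDr mulr_ge0 // mulr_ge0 ?(ltW E_gt0) ?(ltW Delta_G_gt0).
have : sigma * (13 * E) < sigma * 1 by lra.
by rewrite ltr_pM2l //; lra.
Qed.

Lemma Delta_out_small : E * Do < gap * sigma.
Proof.
rewrite [ltRHS]mulrC -ltr_pdivrMr // -mulrA; apply: le_lt_trans gap_margin.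
by rewrite lerDr mulr_ge0 // mulr_ge0 ?(ltW E_gt0) ?(ltW Delta_G_gt0).
Qed.

(* AM-GM on the two terms of [E_margin]. *)
Lemma delay_small : 80 * (D%:R * (es * lambda)) <= 1.
Proof.
set y := E * (D%:R * kap).
have y_ge0 : 0 <= y by rewrite !mulr_ge0 ?(ltW E_gt0) ?(ltW k_gt0) ?(ltW H_M_gt0).
have h1 : D%:R * (es * lambda) <= E * y.
  have -> : D%:R * (es * lambda) = E * (E * (D%:R * lambda)).
    by rewrite -[X in X * lambda]E2; ring.
  rewrite /y.
  by rewrite !ler_pM2l ?E_gt0 // ltW // kap_gt.
have h2 : y <= E * (n%:R * D%:R * kap).
  by rewrite ler_pM2l ?E_gt0 // ler_pM2r // ler_peMl.
have := E_margin; have := E_gt0; have := sqr_ge0 (3 * (19 / 20) * y - 12 * E).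
have : (3 * (19 / 20) * y + 12 * E) ^+ 2 <= 1 -> 80 * (D%:R * (es * lambda)) <= 1.
  have := sqr_ge0 (3 * (19 / 20) * y - 12 * E); lra.
move=> fin _ E0 Em; apply: fin.
rewrite -(expr1n _ 2) lerXn2r ?nnegrE //; first by have := y_ge0; lra.
lra.
Qed.



(** * From [eps_star] to an arbitrary smaller step [eps] *)

Section SmallStep.
Variable eps : R.
Hypotheses (eps_gt0 : 0 < eps) (le_eps : eps <= es).

Local Notation e := (Num.sqrt eps).
Local Notation re := (1 - eps * lambda).
(* Margin of the bounds on the primitives of the dithers below the [rho]s. *)
Local Notation theta := (19 / 20 : R).
Local Notation T := (period p eps).
Local Notation w := (omega_h p).
Local Notation rate := (2 * DG + DY / gap).

Let e_gt0 : 0 < e. Proof. by rewrite sqrtr_gt0. Qed.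
Let e2 : e ^+ 2 = eps. Proof. by rewrite sqr_sqrtr // ltW. Qed.
Let e_le : e <= E. Proof. exact: ler_wsqrtr. Qed.
Let el_le : eps * lambda <= es * lambda. Proof. by rewrite ler_pM2r. Qed.
Let re_gt0 : 0 < re. Proof. by have := decay_base_gt0; have := el_le; lra. Qed.
Let re_lt1 : re < 1. Proof. by have := mulr_gt0 eps_gt0 lambda_gt0; lra. Qed.
Let le_r_re : r <= re. Proof. by rewrite lerD2l lerN2. Qed.
Let reV_gt0 d : 0 < re ^- d. Proof. by rewrite invr_gt0 exprn_gt0. Qed.
Let reV_ge1 d : 1 <= re ^- d.
Proof. by rewrite invf_ge1 ?exprn_gt0 // exprn_ile1 // ltW. Qed.
Let reV_le d : re ^- d <= r ^- d.
Proof. by rewrite lef_pV2 ?posrE ?exprn_gt0 ?decay_base_gt0 // lerXn2r ?nnegrE ?(ltW decay_base_gt0) ?(ltW re_gt0). Qed.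

Let truncn_ge13 : (13 <= Num.truncn (1 / e))%N.
Proof.
rewrite truncn_gt_nat ler_pdivlMr //; have := E_small; have := e_le; lra.
Qed.

(** [es kap] is at most the product of [E] and [E (n D kap)], both below 1 by the margins. *)
Let step_lt1 : eps * k * H_M p <= 1.
Proof.
have h1 : eps * kap <= E * (E * (n%:R * D%:R * kap)).
  have : es * kap <= E * (E * (n%:R * D%:R * kap)).
    rewrite -[X in X * kap]E2 -[E ^+ 2 * _]mulrA !ler_pM2l ?E_gt0 //.
    by rewrite -mulrA mulrA ler_peMl ?(ltW kap_gt0) //; apply: mulr_ege1.
  by apply: le_trans; rewrite ler_pM2r.
have h2 := E_margin; have h3 := E_small; have h4 := E_gt0.
have h5 : 0 <= E * (n%:R * D%:R * kap) by rewrite mulr_ge0 ?(ltW E_gt0) // mulr_ge0 ?(ltW kap_gt0) // ltW.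
have h6 : E * (E * (n%:R * D%:R * kap)) <= 1 * 1 by apply: ler_pM; rewrite ?(ltW E_gt0) //; lra.
by rewrite -mulrA; lra.
Qed.

Let h_le : es * lambda <= D%:R * (es * lambda).
Proof. by rewrite ler_peMl // mulr_ge0 // ltW. Qed.

Let r_ge : 79 / 80 <= r.
Proof. by have := delay_small; have := h_le; lra. Qed.

Let rD_ge : 79 / 80 <= r ^+ D.
Proof.
apply: le_trans (bernoulli_ineq D _ _); rewrite ?mulr_ge0 ?(ltW es_gt0) ?(ltW lambda_gt0) //.
  by have := delay_small; lra.
by have := decay_base_gt0; lra.
Qed.

Let rV_le : r ^- D <= 80 / 79.
Proof.
have -> : 80 / 79 = (79 / 80)^-1 :> R by rewrite invf_div.
by rewrite lef_pV2 ?posrE //; lra.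
Qed.

Let rV_sub : r ^- D - 1 <= 80 / 79 * (D%:R * (es * lambda)).
Proof.
have -> : r ^- D - 1 = r ^- D * (1 - r ^+ D).
  by rewrite mulrBr mulr1 mulVf // gt_eqF.
have h : 1 - D%:R * (es * lambda) <= r ^+ D.
  apply: bernoulli_ineq; rewrite ?mulr_ge0 ?(ltW es_gt0) ?(ltW lambda_gt0) //.
  by have := decay_base_gt0; lra.
apply: ler_pM rV_le _; rewrite ?invr_ge0 ?(ltW (rD_gt0 _)) //; last by lra.
by rewrite subr_ge0.
Qed.

(** One [DG] absorbs both the surplus factor [r^-D] on the delay noise and the growth during
    startup. Both are at most about [D kap sigma E], since [E Do < gap sigma], and [E < 1/13]. *)
Let DG_slack : (r ^- D - 1) * (Do / gap) + D%:R * eps * (r ^- D * Do) / re <= DG.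
Proof.
have E0 := E_gt0; have Do0 := Delta_out_gt0.
have DoE : Do / gap <= sigma / E.
  by rewrite ler_pdivrMr // mulrAC ler_pdivlMr // mulrC [leRHS]mulrC ltW // Delta_out_small.
have q1 : (r ^- D - 1) * (Do / gap) <= 80 / 79 * (D%:R * (es * lambda)) * (sigma / E).
  by apply: ler_pM => //; rewrite subr_ge0.
have -> : forall X Y Z : R, X * eps * Y / Z = X * (Y * eps / Z) by move=> *; ring.
have reV : re^-1 <= 80 / 79.
  have -> : 80 / 79 = (79 / 80)^-1 :> R by rewrite invf_div.
  by rewrite lef_pV2 ?posrE //; [exact: le_trans r_ge le_r_re|lra].
have q2 : r ^- D * Do * eps / re <= 80 / 79 * (gap * sigma) * E * (80 / 79).
  apply: ler_pM => //; rewrite ?invr_ge0 ?(ltW re_gt0) //.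
    by rewrite mulr_ge0 ?(ltW eps_gt0) // mulr_ge0 ?(ltW Do0) // invr_ge0 ltW.
  apply: (@le_trans _ _ (80 / 79 * (E * Do) * E)).
    have -> : 80 / 79 * (E * Do) * E = 80 / 79 * Do * E ^+ 2 by ring.
    rewrite E2; apply: ler_pM; rewrite ?(ltW eps_gt0) //.
      by rewrite mulr_ge0 ?(ltW Do0) // invr_ge0 ltW.
    by rewrite ler_pM2r.
  by rewrite ler_pM2r // ler_wpM2l ?divr_ge0 // ltW // Delta_out_small.
have q3 : D%:R * (r ^- D * Do * eps / re) <= D%:R * (80 / 79 * (gap * sigma) * E * (80 / 79)).
  by rewrite ler_pM2l.
apply: le_trans (lerD q1 q3) _; apply: le_trans Delta_G_ge.
have -> : 80 / 79 * (D%:R * (es * lambda)) * (sigma / E) = 80 / 79 * (D%:R * (E * lambda * sigma)).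
  rewrite -[X in X * lambda]E2; move: (E) E0 => x x0; field; exact: lt0r_neq0.
have q4 : n%:R * D%:R * kap * sigma >= D%:R * (kap * sigma).
  rewrite -!mulrA ler_peMl // mulr_ge0 // !mulr_ge0 // ltW //.
have l1 : E * lambda * sigma <= 1 / 13 * kap * sigma.
  rewrite ler_pM2r //; apply: ler_pM; rewrite ?(ltW E0) ?(ltW lambda_gt0) ?(ltW E_small) //.
  exact: ltW kap_gt.
have l2 : gap * sigma * E <= kap * sigma * (1 / 13).
  apply: ler_pM; rewrite ?(ltW E0) ?(ltW E_small) //; first by rewrite mulr_ge0 // ltW.
  by rewrite ler_pM2r.
have := ler_wpM2l (ltW D_gt0) l1; have := ler_wpM2l (ltW D_gt0) l2.
have : 0 <= D%:R * (kap * sigma) by rewrite mulr_ge0 // mulr_ge0 // ltW.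
move: q4; lra.
Qed.

(** The budget for [x]: its initial value; one [e DG] for the distance between [g] and [x]; one
    [e DG] consumed by [DG_slack]; and [e DY / gap], the fixed point of the perturbed
    contraction. *)
Let sigma1 := sigma0 p * re ^- D + e * rate.

Let DY_gap : DG <= DY / gap.
Proof.
rewrite ler_pdivlMr //; apply: le_trans Delta_Y_ge.
have := Delta_out_gt0; have : DG * gap <= DG * kap by rewrite ler_pM2l ?Delta_G_gt0.
lra.
Qed.

Let rate_ge : 2 * DG <= rate.
Proof. by have := Delta_G_gt0; have := DY_gap; lra. Qed.

Let sigma1_gap : (E - e) * rate < sigma - sigma1.
Proof.
have := cond_c_margin; rewrite /sigma1.
have : sigma0 p * re ^- D <= sigma0 p * r ^- D by rewrite ler_pM2l.
lra.
Qed.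

Let rate_gt0 : 0 < rate.
Proof. by have := Delta_G_gt0; have := rate_ge; lra. Qed.

Let sigma1_lt : sigma1 < sigma.
Proof.
rewrite -subr_gt0; apply: le_lt_trans sigma1_gap.
by rewrite mulr_ge0 ?subr_ge0 // ltW.
Qed.

Let sigma1_ge0 : 0 <= sigma1.
Proof. by rewrite addr_ge0 ?mulr_ge0 ?(ltW e_gt0) ?(ltW rate_gt0) ?(ltW sigma0_gt0) ?(ltW (reV_gt0 _)). Qed.

Let sy1 := H_M p / 2 * (re ^- D * (sigma1 + al * A)) ^+ 2.

Let amp1_ge0 : 0 <= sigma1 + al * A.
Proof. by rewrite addr_ge0 // mulr_ge0 ?norm_a_ge0 // ltW. Qed.

Let amp1_le : sigma1 + al * A <= sigma + al * A.
Proof. by rewrite lerD2r ltW // sigma1_lt. Qed.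

Let sy1_ge0 : 0 <= sy1.
Proof. by rewrite mulr_ge0 ?sqr_ge0 // divr_ge0 // ltW. Qed.

Let Sy_expand : Sy = H_M p / 2 * (r ^- D * (sigma + al * A)) ^+ 2.
Proof. by rewrite /sigma_y rE exprMn exprVn -exprM (mulnC D) [RHS]mulrA. Qed.

Let sy1_le : sy1 <= Sy.
Proof.
rewrite Sy_expand ler_pM2l ?divr_gt0 // lerXn2r ?nnegrE ?mulr_ge0 ?(ltW (reV_gt0 _)) ?(ltW amp_gt0) //.
  by rewrite invr_ge0 ltW.
by apply: ler_pM; rewrite ?(ltW (reV_gt0 _)).
Qed.

(* [sy1] is smaller than [Sy] by enough to compensate the possible growth of the
   filter gain when [eps] decreases. *)
Let sy1_trade : sy1 * (w - 2 * lambda + es * lambda ^+ 2)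
  <= Sy * (w - 2 * lambda + eps * lambda ^+ 2).
Proof.
set Xs := w - 2 * lambda + es * lambda ^+ 2; set Xe := w - 2 * lambda + eps * lambda ^+ 2.
have l2 : 0 < lambda ^+ 2 by rewrite exprn_gt0.
have Xs_gt0 : 0 < Xs by have := mulr_gt0 es_gt0 l2; have := lt_lambda_omega; rewrite /Xs; lra.
have Xe_gt0 : 0 < Xe by have := mulr_gt0 eps_gt0 l2; have := lt_lambda_omega; rewrite /Xe; lra.
set P := sigma + al * A; set p1 := sigma1 + al * A.
have P_gt0 : 0 < P by exact: amp_gt0.
have Ee : 0 <= E - e by rewrite subr_ge0.
(* Both sides are of order [(E - e) lambda^2 P]: on the left with factor [E + e], on the right with
   [19/25 = 2 * 2 * 19/100] from [2 (E - e) DG]. *)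
have key : (Xs - Xe) * P <= Xs * (P - p1).
  have d1 := sigma1_gap; have d2 := ler_wpM2l Ee rate_ge; have d3 := Delta_G_ge_rho2.
  have d4 := rho2_term_ge; rewrite -/Xs -/P in d4.
  have d5 : 19 / 100 * 1 * lambda * P * (2 * lambda / Xs) <= rho2 p k * (Se / al).
    apply: le_trans d4; apply: ler_pM.
    - apply: mulr_ge0 (ltW P_gt0); apply: mulr_ge0 (ltW lambda_gt0).
      by rewrite mulr1 divr_ge0.
    - by rewrite divr_ge0 ?mulr_ge0 ?(ltW lambda_gt0) ?(ltW Xs_gt0).
    - rewrite ler_pM2r //; apply: ler_pM; rewrite ?(ltW kap_gt) ?(ltW lambda_gt0) //.
        by rewrite mulr1 divr_ge0.
      apply: ler_pM; rewrite ?divr_ge0 //; first by case/andP: d019245_bounds => /ltW.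
      exact: mulr_ege1.
    - by rewrite ler_pM2r ?invr_gt0 // ltW.
  have d6 : (E - e) * (2 * (19 / 100 * 1 * lambda * P * (2 * lambda / Xs))) <= P - p1.
    have := ler_wpM2l Ee (le_trans d5 d3); rewrite /P /p1; lra.
  have d7 := ler_wpM2l (ltW Xs_gt0) d6.
  have d8 : Xs * ((E - e) * (2 * (19 / 100 * 1 * lambda * P * (2 * lambda / Xs)))) =
      19 / 25 * ((E - e) * (lambda ^+ 2 * P)).
    by move: (E - e) => g; field; exact: lt0r_neq0.
  rewrite d8 in d7; apply: le_trans d7.
  have -> : (Xs - Xe) * P = (E + e) * ((E - e) * (lambda ^+ 2 * P)).
    have -> : Xs - Xe = (E ^+ 2 - e ^+ 2) * lambda ^+ 2 by rewrite E2 e2 /Xs /Xe; ring.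
    by ring.
  rewrite ler_wpM2r //; first by rewrite mulr_ge0 // mulr_ge0 ?sqr_ge0 // ltW.
  by have := E_small; have := e_le; lra.
have key2 : Xs * p1 <= Xe * P by lra.
have p1_ge0 : 0 <= p1 by [].
have p1P : p1 <= P by [].
have key3 : p1 ^+ 2 * Xs <= P ^+ 2 * Xe.
  apply: (@le_trans _ _ (p1 * (Xe * P))).
    by rewrite expr2 -mulrA [p1 * Xs]mulrC ler_wpM2l.
  have -> : P ^+ 2 * Xe = P * (Xe * P) by ring.
  by rewrite ler_pM2r // mulr_gt0.
have -> : sy1 * Xs = H_M p / 2 * (re ^- D) ^+ 2 * (p1 ^+ 2 * Xs).
  by rewrite /sy1 -/p1; move: (re ^- D) => t; ring.
have -> : Sy * Xe = H_M p / 2 * (r ^- D) ^+ 2 * (P ^+ 2 * Xe).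
  by rewrite Sy_expand -/P; move: (r ^- D) => t; ring.
have HM2 : 0 < H_M p / 2 by rewrite divr_gt0.
apply: ler_pM key3.
- by rewrite mulr_ge0 ?sqr_ge0 // ltW.
- by rewrite mulr_ge0 ?sqr_ge0 // ltW.
rewrite (ler_pM2l HM2) lerXn2r ?nnegrE ?(ltW (reV_gt0 _)) //.
by rewrite invr_ge0 ltW.
Qed.

Let filter_ok : eps * w * sy1 < (re ^+ 2 - `|1 - eps * w|) * Se.
Proof.
have el1 : es * lambda < 1 by have := decay_base_gt0; lra.
have el1' : eps * lambda < 1 by apply: le_lt_trans el1.
have cf := cond_b_filter.
have cf' := filter_cond_mono eps_gt0 le_eps lambda_gt0 lt_lambda_omega el1 cf.
have dp : 0 < re ^+ 2 - `|1 - eps * w|.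
  by rewrite subr_gt0; apply: filter_bounds.
have := filter_gain_mono eps_gt0 le_eps lambda_gt0 lt_lambda_omega el1 cf sy1_ge0 sy1_le sy1_trade.
move=> g; rewrite mulrC -[ltRHS]mulrC -ltr_pdivrMr //.
have -> : sy1 * (eps * w) / (re ^+ 2 - `|1 - eps * w|) =
  w * (eps * sy1 / (re ^+ 2 - `|1 - eps * w|)) by ring.
apply: (@le_lt_trans _ _ (w * (es * Sy / (r ^+ 2 - q)))); first by rewrite ler_pM2l.
have -> : w * (es * Sy / (r ^+ 2 - q)) = es * w * Sy / (r ^+ 2 - q) by ring.
by rewrite /sigma_eta rE ltrDr DQ_gt0.
Qed.

Let gain := 2 * k * B / al * (sy1 + Se).

Let gain_ge0' : 0 <= gain.
Proof.
apply: mulr_ge0; last by rewrite addr_ge0 // ltW // sigma_eta_gt0.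
by rewrite divr_ge0 ?mulr_ge0 ?norm_ainv_ge0 ?(ltW k_gt0) // ltW.
Qed.

(** [Delta] bounds the measurement without the factor [r^-2D] of [sigma_y]. By [delay_small] that
    factor is at most [40/39], a loss left for [theta] to absorb. *)
Let gain_le : gain <= 40 / 39 * Dl.
Proof.
have r2 : 39 / 40 <= r ^+ (2 * D).
  apply: le_trans (bernoulli_ineq (2 * D) _ _); rewrite ?mulr_ge0 ?(ltW es_gt0) ?(ltW lambda_gt0) //.
    by have := delay_small; rewrite natrM; lra.
  by have := decay_base_gt0; lra.
have rv : r ^- (2 * D) <= 40 / 39.
  have -> : 40 / 39 = (39 / 40)^-1 :> R by rewrite invf_div.
  by rewrite lef_pV2 ?posrE //; lra.
set Q := H_M p / 2 * (sigma + al * A) ^+ 2.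
have Q_ge0 : 0 <= Q by rewrite mulr_ge0 ?sqr_ge0 // divr_ge0 // ltW.
have s1 : sy1 <= 40 / 39 * Q.
  apply: le_trans sy1_le _; rewrite /sigma_y rE /Q mulrAC [leRHS]mulrC.
  by rewrite ler_wpM2l.
have s2 : sy1 + Se <= 40 / 39 * (Q + Se) by have := sigma_eta_gt0; lra.
have -> : 40 / 39 * Dl = 2 * k * B / al * (40 / 39 * (Q + Se)).
  by rewrite /Delta -/Q; ring.
apply: ler_wpM2l s2.
by rewrite divr_ge0 ?mulr_ge0 ?norm_ainv_ge0 ?(ltW k_gt0) // ltW.
Qed.

(** [DY - Do] is matched term by term; [theta] pays wherever the actual quantity is larger than its
    counterpart in [Delta_Y]. *)
Let drift_main : theta * (kap * DG + rho1 p k * gain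
    + rho2 p k / al * (H_M p / 2 * (2 * sigma * gain + eps * gain ^+ 2
         + lambda / re * (sigma + eps * gain) ^+ 2) + (w * (Se + sy1) + lambda * Se))
    + rho3 p k es * al * lambda) <= DY - Do.
Proof.
have DDo : Dl <= Dl + E * Do by rewrite lerDl mulr_ge0 ?(ltW E_gt0) ?(ltW Delta_out_gt0).
have D0 := Delta_ge0; have g0 := gain_ge0'; have gl := gain_le.
set D' := Dl + E * Do in DDo.
have D'0 : 0 <= D' by lra.
have th1 : theta * gain <= D' by lra.
have g2 : gain ^+ 2 <= (40 / 39 * D') ^+ 2 by rewrite lerXn2r ?nnegrE //; lra.
(* The tightest use of the margin: [(19/20) (40/39)^2 = 1520/1521]. *)
have th2 : theta * gain ^+ 2 <= D' ^+ 2 by have := sqr_ge0 D'; lra.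
have eg : eps * gain <= 40 / 39 * (es * D').
  have -> : 40 / 39 * (es * D') = es * (40 / 39 * D') by ring.
  by apply: ler_pM; rewrite ?(ltW eps_gt0) //; lra.
have esD : 0 <= es * D' by rewrite mulr_ge0 // ltW.
have g3 : (sigma + eps * gain) ^+ 2 <= (40 / 39 * (sigma + es * D')) ^+ 2.
  have := sigma_gt0 => s0; have eg0 : 0 <= eps * gain by rewrite mulr_ge0 // ltW.
  by rewrite lerXn2r ?nnegrE; lra.
have th3 : theta * (sigma + eps * gain) ^+ 2 <= (sigma + es * D') ^+ 2.
  by have := sqr_ge0 (sigma + es * D'); lra.
have rho2_0 := rho2_ge0; have rho1_0 := rho1_ge0; have rho3_0 := rho3_ge0.
have c0 : 0 <= rho2 p k / al * (H_M p / 2).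
  by rewrite mulr_ge0 ?divr_ge0 ?(ltW H_M_gt0) ?(ltW alpha0_gt0).
have t1 : theta * (rho1 p k * gain) <= rho1 p k * D'.
  by have := ler_wpM2l rho1_0 th1; lra.
have t2 : theta * (rho2 p k / al * (H_M p / 2 * (2 * sigma * gain))) <=
    rho2 p k / al * (H_M p / 2) * (2 * sigma * D').
  have s0 : 0 <= 2 * sigma by rewrite mulr_ge0 // ltW.
  by have := ler_wpM2l c0 (ler_wpM2l s0 th1); lra.
have t3 : theta * (rho2 p k / al * (H_M p / 2 * (eps * gain ^+ 2))) <=
    rho2 p k / al * (H_M p / 2) * (es * D' ^+ 2).
  have h : eps * (theta * gain ^+ 2) <= es * D' ^+ 2.
    by apply: ler_pM; rewrite ?(ltW eps_gt0) // mulr_ge0 ?sqr_ge0 ?divr_ge0.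
  by have := ler_wpM2l c0 h; lra.
have t4 : theta * (rho2 p k / al * (H_M p / 2 * (lambda / re * (sigma + eps * gain) ^+ 2))) <=
    rho2 p k / al * (H_M p / 2) * (lambda / r * (sigma + es * D') ^+ 2).
  have h : lambda / re * (theta * (sigma + eps * gain) ^+ 2) <= lambda / r * (sigma + es * D') ^+ 2.
    apply: ler_pM th3; [exact: divr_ge0 (ltW lambda_gt0) (ltW re_gt0)| |].
      by rewrite mulr_ge0 ?sqr_ge0 ?divr_ge0.
    by rewrite ler_pM2l // lef_pV2 ?posrE ?decay_base_gt0.
  by have := ler_wpM2l c0 h; lra.
have t5 : theta * (rho2 p k / al * (w * (Se + sy1) + lambda * Se)) <=
    rho2 p k / al * (w * (Sy + Se) + lambda * (Se * q + es * w * Sy) / r).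
  have c1 : 0 <= rho2 p k / al by rewrite divr_ge0 // ltW.
  suff h : theta * (w * (Se + sy1) + lambda * Se) <= w * (Sy + Se) + lambda * (Se * q + es * w * Sy) / r.
    by have := ler_wpM2l c1 h; lra.
  have h1 : lambda * (Se * q) <= lambda * (Se * q + es * w * Sy) / r.
    rewrite ler_pdivlMr ?decay_base_gt0 //; apply: (@le_trans _ _ (lambda * (Se * q))).
      by rewrite ler_piMr ?(ltW decay_base_lt1) // mulr_ge0 ?(ltW lambda_gt0) // mulr_ge0 // ltW // sigma_eta_gt0.
    rewrite ler_pM2l // lerDl; apply: mulr_ge0; last exact: ltW sigma_y_gt0.
    by rewrite mulr_ge0 // ltW.
  have h2 : w * sy1 <= w * Sy by rewrite ler_pM2l.
  (* [Delta_Y] has [lambda Se q] where [lambda Se] is needed; the deficit is charged to the term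
     [w Se]. *)
  have h3 : lambda * (1 - q) <= w / 80.
    have : 1 - q <= es * w by have := ler_norm (1 - es * w); lra.
    have h4 : es * lambda <= 1 / 80 by have := delay_small; have := h_le; lra.
    have := ler_wpM2r (ltW omega_h_gt0) h4; have := lambda_gt0 => l0 h5 h6.
    have := ler_wpM2l (ltW l0) h6; lra.
  have h4 := ler_wpM2r (ltW sigma_eta_gt0) h3.
  have w0 : 0 <= w * Se by rewrite mulr_ge0 ?(ltW sigma_eta_gt0) // ltW.
  have w1 : 0 <= w * Sy by rewrite mulr_ge0 ?(ltW sigma_y_gt0) // ltW.
  have w2 : 0 <= lambda * (Se * q).
    by rewrite mulr_ge0 ?(ltW lambda_gt0) // mulr_ge0 // ltW // sigma_eta_gt0.
  move: h1; set X := _ / r; lra.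
have t6 : theta * (rho3 p k es * al * lambda) <= rho3 p k es * al * lambda.
  rewrite ler_piMl //; last by lra.
  by rewrite mulr_ge0 ?(ltW lambda_gt0) // mulr_ge0 // ltW.
have t7 : theta * (kap * DG) <= kap * DG.
  by rewrite (ler_piMl (mulr_ge0 (ltW kap_gt0) (ltW Delta_G_gt0))) //; lra.
have -> : DY - Do = kap * DG + rho1 p k * D'
   + rho2 p k / al * (w * (Sy + Se) + lambda * (Se * q + es * w * Sy) / r)
   + rho3 p k es * al * lambda
   + rho2 p k / al * (H_M p / 2) * (2 * sigma * D')
   + rho2 p k / al * (H_M p / 2) * (es * D' ^+ 2)
   + rho2 p k / al * (H_M p / 2) * (lambda / r * (sigma + es * D') ^+ 2).
  rewrite /Delta_Y rE -/D' rho4E; move: (r) decay_base_gt0 => r' r'0.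
  field; rewrite !gt_eqF //.
lra.
Qed.


(** [5/19] is [(1/4) / (19/20)]: the primitive of the cubic term has constant [1/4], and [theta] is
    to be gained on [rho3]. For [n D >= 2] the leading term [(n D)^2 / 6] suffices. *)
Let c_ge i : 5 / 19 * (n%:R * D%:R) <= c p es i.
Proof.
have pi0 := @pi_ge3 R; have pi1 := @pi_le33 R.
have E0 := ltW E_gt0; have nD0 := ltW nD_gt0.
have d0 : 0 < @d33072 R by rewrite /d33072; lra.
have di_gt0 (l : 'I_n) : 0 < @d33072 R * pi * l.+1%:R.
  by rewrite mulr_gt0 // mulr_gt0 // pi_gt0.
set v := @d33072 R * pi * i.+1%:R.
have v_gt0 : 0 < v by exact: di_gt0.
have -> : c p es i = (n%:R * D%:R + E) * (2 * (n%:R * D%:R) + E) / 12 +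
  (E * (E + n%:R * D%:R) + (n%:R * D%:R) ^+ 2 * (1 + v^-1)) * v^-1.
  by rewrite /c -/v div1r exprMn [D%:R ^+ 2 * _]mulrC.

have V0 : 0 <= v^-1 by rewrite invr_ge0 ltW.
set N := n%:R * D%:R in nD0 *.
have N0 : 0 <= N by [].
have t1 : 0 <= E * (E + N) * v^-1 by rewrite !mulr_ge0 // addr_ge0.
have t2 : 0 <= N * E by rewrite mulr_ge0.
have t3 := sqr_ge0 E; have t4 := sqr_ge0 N.
have t5 : 0 <= N ^+ 2 * ((1 + v^-1) * v^-1) by rewrite mulr_ge0 // mulr_ge0 // addr_ge0.
have base : N ^+ 2 / 6 + N ^+ 2 * ((1 + v^-1) * v^-1) <=
  (N + E) * (2 * N + E) / 12 + (E * (E + N) + N ^+ 2 * (1 + v^-1)) * v^-1.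
  move: t1 t2 t3 t4 t5; move: (v^-1) => V; lra.
apply: le_trans base; have [le2|lt2] := leqP 2 (n * D).
  have : 2 * N <= N ^+ 2 by rewrite expr2 ler_wpM2r // /N -natrM ler_nat.
  by lra.
(* The remaining case [n = D = 1] needs the second summand of [c]; with [v <= 11] the total is at
   least [1/6 + 12/121], barely above [5/19]. *)
have nD1 : (n * D = 1)%N.
  by apply/eqP; rewrite eqn_leq -ltnS lt2 muln_gt0 n_gt0.
have n1 : n = 1%N by move/eqP: nD1; rewrite muln_eq1 => /andP[/eqP].
have i_0 : nat_of_ord i = 0%N by have := ltn_ord i; rewrite {2}n1; case: (nat_of_ord i).
have N1 : N = 1 by rewrite /N -natrM nD1.
have vE : v = @d33072 R * pi by rewrite /v i_0 mulr1.
have v_le : v <= 11 by rewrite vE /d33072; lra.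
have V_ge : 1 / 11 <= v^-1 by rewrite div1r lef_pV2 ?posrE.
have : (1 + 1 / 11) * (1 / 11) <= (1 + v^-1) * v^-1.
  by apply: ler_pM => //; rewrite ?divr_ge0 ?lerD2l //; lra.
rewrite N1; lra.
Qed.

Let rho3_bound : n%:R * D%:R / 4 * (k * H_M p * (\sum_s a p s ^+ 2)) * B <= theta * rho3 p k es.
Proof.
have nD0 := ltW nD_gt0.
have s2 : 0 <= \sum_s a p s ^+ 2 by apply: sumr_ge0 => i _; apply: sqr_ge0.
have h : 5 / 19 * (n%:R * D%:R) * B <= Num.sqrt (\sum_i c p es i ^+ 2 / a p i ^+ 2).
  have N0 : 0 <= 5 / 19 * (n%:R * D%:R) :> R by rewrite mulr_ge0 // divr_ge0.
  rewrite -[X in X * B]ger0_norm // -sqrtr_sqr -sqrtrM ?sqr_ge0 //.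
  rewrite ler_wsqrtr // mulr_sumr; apply: ler_sum => i _.
  rewrite ler_wpM2r ?invr_ge0 ?sqr_ge0 // lerXn2r ?nnegrE ?c_ge //.
  exact: le_trans (c_ge i).
rewrite /rho3; set s := \sum_s _ in s2 *; set Z := Num.sqrt _ in h *.
have -> : n%:R * D%:R / 4 * (k * H_M p * s) * B = theta * (k * H_M p * s) * (5 / 19 * (n%:R * D%:R) * B).
  by field.
rewrite -[leLHS]mulrA ler_wpM2l ?divr_ge0 // ler_wpM2l //.
by rewrite mulr_ge0 // ltW.
Qed.

Let Q := \sum_(i < n) 1 / i.+1%:R + \sum_(i < n) \sum_(l < n | l != i)
  a p l / a p i * (1 / `|i.+1%:R - l.+1%:R| + 1 / (i.+1%:R + l.+1%:R)) : R.
Let c1 := e * theta * (@d019245 R * (n%:R * D%:R) * k * Q).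
Let c2 := e * (theta * rho2 p k).
Let c3 := e * (theta * rho3 p k es).

Let c1E : c1 * H_M p = e * (theta * rho1 p k).
Proof. by rewrite /c1 /rho1 -/Q; ring. Qed.

Let Q_ge0 : 0 <= Q.
Proof.
rewrite addr_ge0 //; first by apply: sumr_ge0 => i _; rewrite divr_ge0.
apply: sumr_ge0 => i _; apply: sumr_ge0 => l _.
by rewrite mulr_ge0 ?divr_ge0 ?addr_ge0 ?divr_ge0 ?addr_ge0 // ltW.
Qed.

(** One of the two factors [e] in [eps] is spent on the period; the other remains as the [sqrt eps]
    in front of the constants. *)
Let scale_bound (X y : R) : 0 <= X -> y <= T%:R * X -> eps * k * y <= e * (n%:R * D%:R * k * X).
Proof.
move=> X_ge0 y_le; have Te := period_sqrt_le n_gt0 D_M_gt0 eps_gt0 truncn_ge13.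
apply: (@le_trans _ _ (e * ((T%:R * e) * k * X))).
  have -> : e * ((T%:R * e) * k * X) = e ^+ 2 * k * (T%:R * X) by ring.
  by rewrite e2 ler_pM2l // mulr_gt0.
by rewrite ler_pM2l // ler_wpM2r // ler_pM2r.
Qed.

Let K_le j y : eps * k * enorm (prim2 p eps j *m y) <= c1 * enorm y.
Proof.
have := prim2_le n_gt0 D_M_gt0 a_gt0 eps_gt0 truncn_ge13 j y; rewrite -/Q.
have -> : T%:R * (7 / 39) * Q * enorm y = T%:R * (7 / 39 * (Q * enorm y)) by ring.
have Qy_ge0 : 0 <= Q * enorm y by rewrite mulr_ge0 ?enorm_ge0.
move=> h; apply: le_trans (scale_bound _ h) _; first by rewrite mulr_ge0 ?divr_ge0.
have X_ge0 : 0 <= e * (n%:R * D%:R * k * (Q * enorm y)).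
  by rewrite mulr_ge0 ?(ltW e_gt0) // mulr_ge0 // mulr_ge0 // ltW.
(* About 0.1795 against 0.1828: here the sharper sine bound pays for [theta]. *)
have d1 : 7 / 39 <= theta * @d019245 R by rewrite /d019245 /d03849; lra.
have -> : e * (n%:R * D%:R * k * (7 / 39 * (Q * enorm y))) = 7 / 39 * (e * (n%:R * D%:R * k * (Q * enorm y))) by ring.
have -> : c1 * enorm y = theta * @d019245 R * (e * (n%:R * D%:R * k * (Q * enorm y))).
  by rewrite /c1; move: (@d019245 R) => d; ring.
by rewrite ler_wpM2r.
Qed.

Let m_le j : eps * k * enorm (prim1 p eps j) <= c2.
Proof.
have := prim1_le n_gt0 D_M_gt0 a_gt0 eps_gt0 truncn_ge13 j.
have := sum_ge0; rewrite /c2 /rho2; set s := \sum_(i < n) _ => s_ge0.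
rewrite -mulrA => h; apply: le_trans (scale_bound _ h) _; first by rewrite mulr_ge0 ?divr_ge0.
have X_ge0 : 0 <= e * (n%:R * D%:R * k * s).
  by rewrite mulr_ge0 ?(ltW e_gt0) // mulr_ge0 // mulr_ge0 // ltW.
have d1 : 14 / 39 <= theta * @d03849 R by rewrite /d03849; lra.
have -> : e * (n%:R * D%:R * k * (14 / 39 * s)) = 14 / 39 * (e * (n%:R * D%:R * k * s)) by ring.
have -> : e * (theta * (@d03849 R * (n%:R * D%:R) * k * s)) = theta * @d03849 R * (e * (n%:R * D%:R * k * s)).
  by move: (@d03849 R) => d; ring.
by rewrite ler_wpM2r.
Qed.

Let N_bound (v : 'cV[R]_n) : enorm v <= T%:R / 4 * (H_M p * (\sum_s a p s ^+ 2)) * B ->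
  eps * k * enorm v <= c3.
Proof.
have s2 : 0 <= \sum_s a p s ^+ 2 by apply: sumr_ge0 => i _; apply: sqr_ge0.
have s3 : 0 <= H_M p * (\sum_s a p s ^+ 2) by rewrite mulr_ge0 // ltW.
have -> : T%:R / 4 * (H_M p * (\sum_s a p s ^+ 2)) * B =
  T%:R * (1 / 4 * (H_M p * (\sum_s a p s ^+ 2)) * B) by ring.
move=> h; apply: le_trans (scale_bound _ h) _.
  by rewrite mulr_ge0 ?norm_ainv_ge0 // mulr_ge0 ?divr_ge0.
rewrite /c3 ler_pM2l //; apply: le_trans rho3_bound.
by rewrite le_eqVlt; apply/orP; left; apply/eqP; ring.
Qed.

Let corrE : correction_bound (H_M p) al c1 c2 c3 sigma Se = e * (theta * DG).
Proof.
by rewrite /correction_bound c1E /c2 /c3 /Delta_G rho4E; field; exact: lt0r_neq0.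
Qed.

Let noise := e * (r ^- D * Do).
Let tau := eps * noise / re.
(** The largest bound on the averaged state that still leaves room in [sigma1] for the startup
    growth and for the distance to [x]. *)
Let Gc := sigma1 - e * DG - D%:R * tau.

Let noise_ge0 : 0 <= noise.
Proof. by rewrite mulr_ge0 ?(ltW e_gt0) // mulr_ge0 ?(ltW Delta_out_gt0) // invr_ge0 ltW. Qed.

Let tau_ge0 : 0 <= tau.
Proof. by rewrite divr_ge0 ?(ltW re_gt0) // mulr_ge0 // ltW. Qed.

Let DtauE : D%:R * tau = e * (D%:R * eps * (r ^- D * Do) / re).
Proof. by rewrite /tau /noise; ring. Qed.

Let Dtau_le : D%:R * tau <= e * DG.
Proof.
rewrite DtauE ler_pM2l //; apply: le_trans DG_slack; rewrite lerDr.
by rewrite mulr_ge0 ?subr_ge0 ?rV_ge1 ?Do_gap_ge0.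
Qed.

Let noise_ok : k / al * (H_M p / 2 * (D%:R * (re ^- D * (eps * gain + al * A * (max_freq p eps + eps * lambda))))
              * ((1 + re ^- D) * (sigma1 + al * A))) * (2 * B) <= noise.
Proof.
set J := 2 * E * k * (Sy + Se) / al * B
     + al * A * (lambda * E
          + 2 * pi / ((1 - E) * D%:R) * (pi * E / ((1 - E) * D%:R) + 1)) / r.
have e_lt1 : e < 1 by have := E_lt1; have := e_le; lra.
have A0 : 0 <= al * A by rewrite mulr_ge0 ?norm_a_ge0 // ltW.
have inc_le : eps * gain + al * A * (max_freq p eps + eps * lambda) <= e * J.
  rewrite [e * J]mulrDr; apply: lerD.
    have -> : eps * gain = e * (e * gain) by rewrite mulrA -expr2 e2.
    rewrite ler_pM2l //.
    have -> : 2 * E * k * (Sy + Se) / al * B = E * (2 * k * B / al * (Sy + Se)) by ring.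
    apply: ler_pM; rewrite ?(ltW e_gt0) ?gain_ge0' //.
    rewrite ler_wpM2l ?lerD2r //.
    by rewrite divr_ge0 ?mulr_ge0 ?norm_ainv_ge0 ?(ltW k_gt0) // ltW.
  have -> : forall y z : R, e * (al * A * y / z) = al * A * (e * y / z) by move=> *; ring.
  rewrite ler_wpM2l //.
  have f1 := max_freq_le n_gt0 D_M_gt0 eps_gt0 truncn_ge13 e_lt1.
  have f2 : 2 * pi * e / ((1 - e) * D%:R) <= e * (2 * pi / ((1 - E) * D%:R)).
    have -> : 2 * pi * e / ((1 - e) * D%:R) = e * (2 * pi / ((1 - e) * D%:R)) by ring.
    have d1 : 0 < (1 - E) * D%:R by rewrite mulr_gt0.
    have d2 : 0 < (1 - e) * D%:R by rewrite mulr_gt0 ?subr_gt0.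
    rewrite ler_pM2l // ler_wpM2l ?mulr_ge0 ?pi_ge0 // lef_pV2 ?posrE // ler_pM2r //.
    by rewrite lerD2l lerN2.
  have f3 : eps * lambda <= e * (lambda * E).
    have -> : eps * lambda = e * (lambda * e) by rewrite mulrCA -expr2 e2 mulrC.
    by rewrite !ler_pM2l.
  set u := lambda * E + _ * _.
  have f4 : max_freq p eps + eps * lambda <= e * u.
    have p0 := pi_ge0 R.
    have h2 : 0 <= 2 * pi / ((1 - E) * D%:R).
      by rewrite divr_ge0 ?mulr_ge0 ?(ltW oneE_gt0).
    have h3 : 0 <= pi * E / ((1 - E) * D%:R).
      by rewrite divr_ge0 ?mulr_ge0 ?(ltW oneE_gt0) ?(ltW E_gt0).
    have h4 := mulr_ge0 (ltW e_gt0) (mulr_ge0 h2 h3); move: (le_trans f1 f2) f3 h4; rewrite /u.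
    set X := 2 * pi / _; set Z := pi * E / _; lra.
  apply: le_trans f4 _; rewrite ler_peMr ?invf_ge1 ?decay_base_gt0 ?(ltW decay_base_lt1) //.
  rewrite mulr_ge0 ?(ltW e_gt0) //; apply: le_trans freq_ge.
  by rewrite divr_ge0 ?mulr_ge0 ?pi_ge0 ?(ltW oneE_gt0).
set inc := eps * gain + _ in inc_le *.
have inc0 : 0 <= inc.
  apply: addr_ge0; first exact: mulr_ge0 (ltW eps_gt0) gain_ge0'.
  apply: mulr_ge0 => //; apply: addr_ge0; first exact: max_freq_ge0.
  exact: mulr_ge0 (ltW eps_gt0) (ltW lambda_gt0).
have -> : k / al * (H_M p / 2 * (D%:R * (re ^- D * inc)) * ((1 + re ^- D) * (sigma1 + al * A))) * (2 * B) =
  re ^- D * (k * D%:R * H_M p / al * B * (sigma1 + al * A) * (1 + re ^- D) * inc).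
  by move: (re ^- D) => t; field; exact: lt0r_neq0.
rewrite /noise Do_factor -/J.
have -> : e * (r ^- D * (k * D%:R * H_M p / al * B * (sigma + al * A) * (1 + r ^- D) * J)) =
  r ^- D * (k * D%:R * H_M p / al * B * (sigma + al * A) * (1 + r ^- D) * (e * J)) by ring.
have k0 : 0 <= k * D%:R * H_M p / al * B.
  apply: mulr_ge0; last exact: norm_ainv_ge0.
  by rewrite divr_ge0 ?mulr_ge0 // ltW.
have reV0 := ltW (reV_gt0 D).
have onere : 0 <= 1 + re ^- D by rewrite addr_ge0.
have k1 : 0 <= k * D%:R * H_M p / al * B * (sigma1 + al * A) by exact: mulr_ge0.
apply: ler_pM => //; first by apply: mulr_ge0 => //; exact: mulr_ge0.
apply: ler_pM => //; first exact: mulr_ge0.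
apply: ler_pM => //; last by rewrite lerD2l.
exact: ler_wpM2l.
Qed.

Let drift_ok : eps * k * H_M p * correction_bound (H_M p) al c1 c2 c3 sigma Se + eps * noise
   + (c1 * H_M p * (eps * gain)
     + c2 / al * (H_M p / 2 * (2 * sigma * (eps * gain) + (eps * gain) ^+ 2
                            + (re^-1 - 1) * (sigma + eps * gain) ^+ 2)
                  + eps * (w * (Se + sy1) + lambda * Se))
     + c3 * al * (eps * lambda)) <= eps * (k * H_m p - lambda) * Gc.
Proof.
have main := ler_wpM2l (ltW (mulr_gt0 eps_gt0 e_gt0)) drift_main.
have reE : re^-1 - 1 = eps * (lambda / re).
  by field; exact: lt0r_neq0.
have DYE : gap * (DY / gap) = DY by rewrite mulrC divfK // gt_eqF.
have DoE : gap * (Do / gap) = Do by rewrite mulrC divfK // gt_eqF.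
have slack := ler_wpM2l (ltW (mulr_gt0 gap_gt0 e_gt0)) DG_slack.
(* The fixed-point part of [sigma1] yields [e DY]; the part [e DG] remaining in [Gc], less the
   startup growth, yields the surplus on [Do]. *)
have GE : e * (DY + (r ^- D - 1) * Do) <= gap * Gc.
  rewrite /Gc DtauE /sigma1.
  have s0 : 0 <= gap * (sigma0 p * re ^- D) by rewrite mulr_ge0 ?(ltW gap_gt0) // mulr_ge0 ?(ltW sigma0_gt0) // ltW.
  set X := D%:R * eps * _ / re in slack *.
  have q1 : gap * e * ((r ^- D - 1) * (Do / gap) + X) = e * ((r ^- D - 1) * Do) + gap * e * X.
    by rewrite -{2}DoE; ring.
  rewrite q1 in slack.
  have -> : gap * (sigma0 p * re ^- D + e * rate - e * DG - e * X) =
    gap * (sigma0 p * re ^- D) + e * (gap * (DY / gap)) + gap * e * DG - gap * e * X by ring.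
  rewrite DYE; move: slack s0; lra.
have := ler_wpM2l (ltW eps_gt0) GE; rewrite [eps * (gap * _)]mulrA.
apply: le_trans; rewrite corrE c1E reE /c2 /c3 /noise.
have -> : eps * (e * (DY + (r ^- D - 1) * Do)) = eps * e * (DY - Do) + eps * (e * (r ^- D * Do)) by ring.
set nz := eps * (e * (r ^- D * Do)).
have -> : forall X Y Z : R, X + Y + Z = (X + Z) + Y by move=> *; ring.
rewrite lerD2r; apply: le_trans main; rewrite le_eqVlt; apply/orP; left; apply/eqP.
by ring.
Qed.

Lemma normalized_bounds (H : 'M[R]_n) (x u : nat -> 'cV[R]_n) (z : nat -> R) (delay : nat -> nat) :
  H^T = H ->
  (forall y : 'cV[R]_n, H_m p * dot y y <= dot y (H *m y)) ->
  (forall y : 'cV[R]_n, dot y (H *m y) <= H_M p * dot y y) ->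
  (forall j, (delay j <= D)%N) ->
  (forall j, (D <= j)%N -> (D < j - delay j)%N ->
     u j = re ^- delay j *: (x (j - delay j)%N + al *: dither p eps (j - delay j)%N)) ->
  (forall j, (D <= j)%N -> (j - delay j <= D)%N -> u j = re ^- (j - D) *: x D) ->
  (forall j, (D <= j)%N -> re *: x j.+1 =
     x j - (eps * k / al * (dot (u j) (H *m u j) / 2 - z j)) *: demod p eps j) ->
  (forall j, (D <= j)%N -> re ^+ 2 * z j.+1 =
     (1 - eps * w) * z j + eps * w * (dot (u j) (H *m u j) / 2)) ->
  enorm (x D) <= sigma0 p * re ^- D -> `|z D| <= Delta_Q p * re ^- (2 * D) ->
  forall j, (D <= j)%N -> enorm (x j) < sigma /\ `|z j| < Se.
Proof.
move=> Hsym Hge Hle delay_le u_late u_early x_step z_step x_init z_init j le_Dj.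
have el1 : eps * lambda < 1 by have := re_gt0; lra.
have Habs (y : 'cV[R]_n) : `|dot y (H *m y)| <= H_M p * enorm y ^+ 2.
  by rewrite sqr_enorm ger0_norm // (H_psd Hge (ltW H_m_gt0)).
have [N [N_step N_le]] := prim3_exists n_gt0 D_M_gt0 a_gt0 eps_gt0 truncn_ge13 Habs.
have s1_init : sigma0 p * re ^- D <= sigma1.
  by rewrite lerDl mulr_ge0 ?(ltW e_gt0) ?(ltW rate_gt0).
have z_init' : `|z D| < Se.
  apply: le_lt_trans z_init _; apply: (@le_lt_trans _ _ (Delta_Q p * q ^- D)).
    by apply: le_trans DQ_le; rewrite ler_pM2l.
  apply: lt_le_trans sigma_eta_ge; rewrite ltrDl divr_gt0 //; first by rewrite mulr_gt0 ?sigma_y_gt0.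
  have := mulr_gt0 es_gt0 (exprn_gt0 2 lambda_gt0); have := lt_lambda_omega; lra.
have Gc_init : sigma0 p * re ^- D + correction_bound (H_M p) al c1 c2 c3 sigma Se <= Gc.
  rewrite corrE /Gc /sigma1.
  have h1 : e * DG <= e * (DY / gap) by rewrite ler_pM2l // DY_gap.
  have h2 := Dtau_le; have h3 : 0 <= e * DG by rewrite mulr_ge0 ?(ltW e_gt0) ?(ltW Delta_G_gt0).
  move: h1 h2 h3; set X := DY / gap; set Y := D%:R * tau; lra.
have gam_ok : correction_bound (H_M p) al c1 c2 c3 sigma Se <= re * (e * DG).
  rewrite corrE [leRHS]mulrCA ler_pM2l // ler_pM2r ?Delta_G_gt0 //.
  by have := r_ge; have := le_r_re; lra.
have delta_ok : eps * k / al * (sy1 + Se) * (2 * B) <= eps * gain.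
  by rewrite le_eqVlt; apply/orP; left; apply/eqP; rewrite /gain; ring.
have tau_ok : eps * noise <= re * tau.
  by rewrite /tau [leRHS]mulrC divfK // lt0r_neq0.
have sum_ok : Gc + D%:R * tau + e * DG <= sigma1 by rewrite /Gc; lra.
have c1_ge0 : 0 <= c1.
  apply: mulr_ge0; first by rewrite mulr_ge0 ?divr_ge0 ?(ltW e_gt0).
  apply: mulr_ge0 Q_ge0; apply: mulr_ge0 (ltW k_gt0).
  exact: mulr_ge0 (ltW d_gt0) (ltW nD_gt0).
have c2_ge0 : 0 <= c2 by rewrite mulr_ge0 ?(ltW e_gt0) // mulr_ge0 ?rho2_ge0 ?divr_ge0.
have c3_ge0 : 0 <= c3 by rewrite mulr_ge0 ?(ltW e_gt0) // mulr_ge0 ?rho3_ge0 ?divr_ge0.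
have [x_le z_lt] := error_bounds Hsym Hge Hle H_m_gt0 H_mM k_gt0 alpha0_gt0 eps_gt0 lambda_gt0
  el1 step_lt1 lt_lambda_kH omega_h_gt0 norm_a_ge0 norm_ainv_ge0 (max_freq_ge0 p eps)
  (dither_le eps a_gt0) (demod_le eps a_gt0) (dither0 p eps)
  (dither_lipschitz n_gt0 D_M_gt0 a_gt0 eps_gt0 truncn_ge13)
  (prim2S n_gt0 D_M_gt0 a_gt0 eps_gt0 truncn_ge13) (prim1S n_gt0 D_M_gt0 eps_gt0 truncn_ge13)
  N_step c1_ge0 c2_ge0 c3_ge0 K_le m_le (fun i => N_bound (N_le i)) delay_le u_late u_early
  x_step z_step sigma1_ge0 sy1_ge0 sigma_eta_gt0 (ltW sigma1_lt) tau_ge0 x_init s1_init z_init'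
  (lexx _) filter_ok delta_ok noise_ok Gc_init drift_ok tau_ok gam_ok sum_ok le_Dj.
by split=> //; apply: le_lt_trans sigma1_lt.
Qed.

End SmallStep.
End Margins.

(** * The algorithm in normalized coordinates *)

Section Trajectory.
Context {R : realType} {n : nat}.
Variables (p : design R n) (k lambda eps : R) (H : 'M[R]_n)
  (theta_star theta_init : 'cV[R]_n) (Q_star Q_0 : R) (delay : nat -> nat)
  (theta_hat : nat -> 'cV[R]_n) (eta : nat -> R).
Local Notation D := (D_M p).
Local Notation r := (1 - eps * lambda).
Local Notation theta := (input p lambda eps theta_init theta_hat).
Hypotheses (r_gt0 : 0 < r) (alpha0_gt0 : 0 < alpha0 p)
  (alg : algorithm p k lambda eps (quad_map H theta_star Q_star) delay
       theta_init Q_0 theta_hat eta).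

(** The filter error is scaled by [r^-2j] because the measurement is quadratic in the input. The
    delayed input is scaled by the time of the measurement, not of the input, which is the source of
    the factors [r^-delay] below. *)
Definition norm_err j := r ^- j *: (theta_hat j - theta_star).
Definition norm_eta_err j := r ^- (2 * j) * (eta j - Q_star).
Definition norm_delayed_err j := r ^- j *: (theta (j - delay j)%N - theta_star).

Let rn_neq0 j : r ^+ j != 0. Proof. by rewrite expf_neq0 // gt_eqF. Qed.
Let r_neq0 : r != 0. Proof. exact: lt0r_neq0. Qed.

Lemma norm_measurement j : (D <= j)%N ->
  dot (norm_delayed_err j) (H *m norm_delayed_err j) / 2 =
  r ^- (2 * j) * (measurement p (quad_map H theta_star Q_star) delay theta j - Q_star).
Proof.
move=> le_Dj; rewrite /measurement ltnNge le_Dj /= /quad_map wnorm2E addrAC subrr add0r.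
rewrite /norm_delayed_err -scalemxAr dotZl dotZr mulnC exprM.
by have := rn_neq0 j; move: (r ^+ j) => t t0; field.
Qed.

Lemma norm_delayed_late j : (D <= j)%N -> (D < j - delay j)%N ->
  norm_delayed_err j = r ^- delay j *:
    (norm_err (j - delay j) + alpha0 p *: dither p eps (j - delay j)).
Proof.
move=> le_Dj late; rewrite /norm_delayed_err /norm_err /input leqNgt late /=.
set s := (j - delay j)%N in late *.
have js : j = (delay j + s)%N by rewrite subnKC // ltnW // -subn_gt0 (leq_ltn_trans _ late).
rewrite [in LHS]js exprD invfM /alpha; have := rn_neq0 s; move: (r ^+ s) => t t0.
apply/colP => i; rewrite !mxE; move: (r ^- delay j) => d; field; exact: t0.
Qed.

Lemma norm_delayed_early j : (D <= j)%N -> (j - delay j <= D)%N ->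
  norm_delayed_err j = r ^- (j - D) *: norm_err D.
Proof.
move=> le_Dj early; rewrite /norm_delayed_err /norm_err /input early.
by rewrite (theta_hat_init alg) // scalerA -invfM -exprD subnK.
Qed.

Lemma norm_err_step j : (D <= j)%N -> r *: norm_err j.+1 =
  norm_err j - (eps * k / alpha0 p *
    (dot (norm_delayed_err j) (H *m norm_delayed_err j) / 2 - norm_eta_err j)) *: demod p eps j.
Proof.
move=> le_Dj; rewrite norm_measurement // /norm_err /norm_eta_err (theta_hat_step alg) //=.
set y := measurement _ _ _ _ _; rewrite /alpha mulnC exprM exprS.
have := rn_neq0 j; move: (r ^+ j) (demod p eps j) => t M t0.
move: (r) r_neq0 => r' r0; apply/colP => i; rewrite !mxE; field.
by rewrite t0 r0 gt_eqF.
Qed.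

Lemma norm_eta_err_step j : (D <= j)%N -> r ^+ 2 * norm_eta_err j.+1 =
  (1 - eps * omega_h p) * norm_eta_err j
  + eps * omega_h p * (dot (norm_delayed_err j) (H *m norm_delayed_err j) / 2).
Proof.
move=> le_Dj; rewrite norm_measurement // /norm_eta_err (eta_step alg) //=.
set y := measurement _ _ _ _ _; rewrite (mulnC 2 j.+1) (mulnC 2 j) !exprM (exprS _ j).
have := rn_neq0 j; move: (r ^+ j) => t t0.
move: (r) r_neq0 => r' r0; field.
by rewrite t0 r0.
Qed.

Lemma norm_err_init : enorm (norm_err D) = enorm (theta_init - theta_star) * r ^- D.
Proof.
rewrite /norm_err (theta_hat_init alg) // enormZ ger0_norm; first by rewrite mulrC.
by rewrite invr_ge0 exprn_ge0 // ltW.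
Qed.

Lemma norm_eta_err_init : `|norm_eta_err D| = `|Q_star - Q_0| * r ^- (2 * D).
Proof.
rewrite /norm_eta_err (eta_init alg) normrM ger0_norm; first by rewrite mulrC distrC.
by rewrite invr_ge0 exprn_ge0 // ltW.
Qed.

Lemma err_of_norm j : enorm (theta_hat j - theta_star) = enorm (norm_err j) * r ^+ j.
Proof.
rewrite /norm_err enormZ ger0_norm ?invr_ge0 ?exprn_ge0 ?(ltW r_gt0) //.
by rewrite mulrC mulrA divff ?mul1r.
Qed.

Lemma eta_err_of_norm j : `|eta j - Q_star| = `|norm_eta_err j| * r ^+ (2 * j).
Proof.
rewrite /norm_eta_err normrM ger0_norm ?invr_ge0 ?exprn_ge0 ?(ltW r_gt0) //.
by rewrite mulrC mulrA divff ?mul1r.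
Qed.

End Trajectory.

(** The order of the two spectral bounds is deduced from the existence of [H], tested on one nonzero
    vector. *)
Lemma spectral_bounds_le (R : realType) (n : nat) (H : 'M[R]_n) (lo hi : R) : (0 < n)%N ->
  (forall x : 'cV[R]_n, lo * enorm x ^+ 2 <= wnorm2 H x /\ wnorm2 H x <= hi * enorm x ^+ 2) ->
  lo <= hi.
Proof.
move=> n_gt0 bd; have [le1 le2] := bd (const_mx 1).
have := le_trans le1 le2; rewrite sqr_enorm /dot.
under eq_bigr do rewrite !mxE mulr1.
by rewrite sumr_const card_ord ler_pM2r // ltr0n.
Qed.

Section Decay.
Context {R : realType} {n : nat}.
Variables (p : design R n) (k lambda sigma es eps : R).
Hypotheses (n_gt0 : (0 < n)%N) (D_M_gt0 : (0 < D_M p)%N)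
  (H_m_gt0 : 0 < H_m p)
  (sigma0_gt0 : 0 < sigma0 p) (Delta_Q_gt0 : 0 < Delta_Q p)
  (a_gt0 : forall i, 0 < a p i) (alpha0_gt0 : 0 < alpha0 p)
  (omega_h_gt0 : 0 < omega_h p) (k_gt0 : 0 < k) (lambda_gt0 : 0 < lambda)
  (lt_lambda_kH : lambda < k * H_m p) (lt_lambda_omega : 2 * lambda < omega_h p)
  (lt_sigma : sigma0 p < sigma) (es_gt0 : 0 < es)
  (ca : cond_a p es) (cb : cond_b p k lambda es) (cc : cond_c p k lambda sigma es)
  (eps_gt0 : 0 < eps) (le_eps : eps <= es).

Local Notation r := (1 - eps * lambda).
Local Notation D := (D_M p).
Local Notation Se := (sigma_eta p lambda sigma es).

Lemma decay_rate : 0 < r < 1.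
Proof.
have r0 := decay_base_gt0 lambda_gt0 lt_lambda_kH es_gt0 cb.
have : eps * lambda <= es * lambda by rewrite ler_pM2r.
have : 0 < eps * lambda by rewrite mulr_gt0.
by move=> *; apply/andP; split; lra.
Qed.

Lemma exponential_decay (H : 'M[R]_n) (theta_star theta_init : 'cV[R]_n) (Q_star Q_0 : R)
    (delay : nat -> nat) (theta_hat : nat -> 'cV[R]_n) (eta : nat -> R) :
  H^T = H ->
  (forall x : 'cV[R]_n, H_m p * enorm x ^+ 2 <= wnorm2 H x
                        /\ wnorm2 H x <= H_M p * enorm x ^+ 2) ->
  enorm (theta_init - theta_star) <= sigma0 p ->
  `|Q_star - Q_0| <= Delta_Q p ->
  (forall j, (delay j <= D)%N) ->
  algorithm p k lambda eps (quad_map H theta_star Q_star) delay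
    theta_init Q_0 theta_hat eta ->
  forall j, (D <= j)%N ->
    enorm (theta_hat j - theta_star) < sigma * r ^+ j /\
    `|eta j - Q_star| < Se * r ^+ (2 * j).
Proof.
move=> H_sym H_bd th_init Q_init delay_le alg j le_Dj.
have H_mM := spectral_bounds_le n_gt0 H_bd.
have [r0 r1] := andP decay_rate.
have Hge (y : 'cV[R]_n) : H_m p * dot y y <= dot y (H *m y).
  by rewrite -sqr_enorm -wnorm2E; case: (H_bd y).
have Hle (y : 'cV[R]_n) : dot y (H *m y) <= H_M p * dot y y.
  by rewrite -sqr_enorm -wnorm2E; case: (H_bd y).
rewrite (err_of_norm _ _ r0) (eta_err_of_norm _ _ r0).
rewrite !ltr_pM2r ?exprn_gt0 //.
apply: (normalized_bounds n_gt0 D_M_gt0 H_m_gt0 H_mM sigma0_gt0 Delta_Q_gt0 a_gt0 alpha0_gt0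
  omega_h_gt0 k_gt0 lambda_gt0 lt_lambda_kH lt_lambda_omega lt_sigma es_gt0 ca cb cc
  eps_gt0 le_eps H_sym Hge Hle delay_le (norm_delayed_late theta_star theta_init theta_hat r0)
  (norm_delayed_early alg) (norm_err_step r0 alpha0_gt0 alg) (norm_eta_err_step r0 alg)) => //.
- by rewrite (norm_err_init r0 alg) ler_pM2r // invr_gt0 exprn_gt0.
- by rewrite (norm_eta_err_init r0 alg) ler_pM2r // invr_gt0 exprn_gt0.
Qed.

End Decay.

(** * Feasibility *)

Section BoundedNearZero.
Context {R : realType}.
Implicit Types (f g : R -> R) (c : R).

(** Boundedness near 0 replaces limits: apart from the power of [|1 - eps k H_m|], which is
    estimated directly, the terms of (c) depending on [eps] carry a factor [sqrt eps]. *)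
Definition bounded_near0 f :=
  exists C d : R, 0 < d /\ forall x, 0 < x -> x < d -> `|f x| <= C.

Lemma bounded_near0_le f g d : 0 < d ->
  (forall x, 0 < x -> x < d -> `|f x| <= `|g x|) -> bounded_near0 g -> bounded_near0 f.
Proof.
move=> d_gt0 le_fg [C [d' [d'_gt0 gC]]]; exists C, (Num.min d d'); split.
  by rewrite lt_min d_gt0.
by move=> x x_gt0; rewrite lt_min => /andP[ltd ltd']; apply: le_trans (le_fg _ _ _) (gC _ _ _).
Qed.

Lemma bounded_near0_cst c : bounded_near0 (fun=> c).
Proof. by exists `|c|, 1; split. Qed.

Lemma bounded_near0_id : bounded_near0 id.
Proof. by exists 1, 1; split=> // x x_gt0 x_lt1; rewrite gtr0_norm // ltW. Qed.

Lemma bounded_near0D f g :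
  bounded_near0 f -> bounded_near0 g -> bounded_near0 (fun x => f x + g x).
Proof.
move=> [C [d [d_gt0 fC]]] [C' [d' [d'_gt0 gC]]]; exists (C + C'), (Num.min d d'); split.
  by rewrite lt_min d_gt0.
move=> x x_gt0; rewrite lt_min => /andP[ltd ltd'].
by apply: le_trans (ler_normD _ _) (lerD (fC _ _ _) (gC _ _ _)).
Qed.

Lemma bounded_near0M f g :
  bounded_near0 f -> bounded_near0 g -> bounded_near0 (fun x => f x * g x).
Proof.
move=> [C [d [d_gt0 fC]]] [C' [d' [d'_gt0 gC]]]; exists (C * C'), (Num.min d d'); split.
  by rewrite lt_min d_gt0.
move=> x x_gt0; rewrite lt_min => /andP[ltd ltd'].
by rewrite normrM ler_pM // ?fC ?gC.
Qed.

Lemma bounded_near0N f : bounded_near0 f -> bounded_near0 (fun x => - f x).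
Proof. by apply: bounded_near0_le ltr01 _ => x _ _; rewrite normrN. Qed.

Lemma bounded_near0_norm f : bounded_near0 f -> bounded_near0 (fun x => `|f x|).
Proof. by apply: bounded_near0_le ltr01 _ => x _ _; rewrite normr_id. Qed.

Lemma bounded_near0X f m : bounded_near0 f -> bounded_near0 (fun x => f x ^+ m).
Proof.
move=> bf; elim: m => [|m IH].
  exact: bounded_near0_le ltr01 (fun _ _ _ => lexx _) (bounded_near0_cst 1).
apply: bounded_near0_le ltr01 _ (bounded_near0M bf IH) => x _ _.
by rewrite exprS.
Qed.

Lemma bounded_near0_sum (I : finType) (F : I -> R -> R) :
  (forall i, bounded_near0 (F i)) -> bounded_near0 (fun x => \sum_i F i x).
Proof.
move=> bF; elim: (index_enum I) => [|i s IH].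
  by apply: bounded_near0_le ltr01 _ (bounded_near0_cst 0) => x _ _; rewrite big_nil.
apply: bounded_near0_le ltr01 _ (bounded_near0D (bF i) IH) => x _ _.
by rewrite big_cons.
Qed.

Lemma bounded_near0_sqrt f : bounded_near0 f -> bounded_near0 (fun x => Num.sqrt (f x)).
Proof.
move=> bf; apply: bounded_near0_le ltr01 _ (bounded_near0D (bounded_near0_cst 1) (bounded_near0_norm bf)).
move=> x _ _; rewrite ger0_norm ?sqrtr_ge0 // ger0_norm ?addr_ge0 //.
have [le1|/ltW ge1] := leP (f x) 1.
  by apply: le_trans (ler_wsqrtr le1) _; rewrite sqrtr1 lerDl.
have f0 : 0 <= f x by apply: le_trans ge1.
apply: (@le_trans _ _ `|f x|); last by rewrite lerDr.
rewrite ger0_norm // -[leRHS]ger0_norm // -sqrtr_sqr ler_wsqrtr //.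
by rewrite expr2 ler_peMl.
Qed.

Lemma bounded_near0V f d m : 0 < d -> 0 < m ->
  (forall x, 0 < x -> x < d -> m <= f x) -> bounded_near0 (fun x => (f x)^-1).
Proof.
move=> d_gt0 m_gt0 fm; exists m^-1, d; split=> // x x_gt0 x_lt.
have f_gt0 := lt_le_trans m_gt0 (fm x x_gt0 x_lt).
by rewrite gtr0_norm ?invr_gt0 // lef_pV2 // fm.
Qed.

End BoundedNearZero.

(** Inverses have no structural rule, since they need a lower bound; they are supplied by the
    section facts through [assumption]. *)
Ltac bounded_near0 := repeat first
  [ assumption | apply: bounded_near0_cst | apply: bounded_near0_id
  | apply: bounded_near0_sqrt | apply: bounded_near0D | apply: bounded_near0M
  | apply: bounded_near0N | apply: bounded_near0_norm | apply: bounded_near0X ].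

Section Feasibility.
Context {R : realType} {n : nat}.
Variables (p : design R n) (k lambda sigma : R).
Hypotheses (n_gt0 : (0 < n)%N) (D_M_gt0 : (0 < D_M p)%N) (H_m_gt0 : 0 < H_m p)
  (sigma0_gt0 : 0 < sigma0 p) (omega_h_gt0 : 0 < omega_h p) (k_gt0 : 0 < k)
  (lambda_gt0 : 0 < lambda)
  (lt_lambda_omega : 2 * lambda < omega_h p).
Local Notation D := (D_M p).
Local Notation w := (omega_h p).

Definition small_bound : R := (10 * (1 + (lambda + k * H_m p + w) * D%:R))^-1.

Let kH_gt0 : 0 < k * H_m p. Proof. exact: mulr_gt0. Qed.
Let D_ge1 : 1 <= D%:R :> R. Proof. by rewrite ler1n. Qed.

Lemma small_bound_gt0 : 0 < small_bound.
Proof. by rewrite invr_gt0 mulr_gt0 // addr_gt0 // mulr_gt0 ?ltr0n // !addr_gt0. Qed.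

Lemma small_bounds es : 0 < es -> es < small_bound ->
  [/\ es < 1 / 10, es * lambda < 1 / 10, es * w < 1 / 10 & D%:R * (es * (k * H_m p)) < 1 / 10].
Proof.
move=> es_gt0 lt_es; set X := lambda + k * H_m p + w.
have X_gt0 : 0 < X by rewrite !addr_gt0.
have D0 : 0 < D%:R :> R by rewrite ltr0n.
have Z_gt0 : 0 < 10 * (1 + X * D%:R) by apply: mulr_gt0 => //; apply: addr_gt0 => //; apply: mulr_gt0.
have h : es * (10 * (1 + X * D%:R)) < 1 by rewrite -ltr_pdivlMr // div1r.
have h1 : 0 <= es * (lambda * D%:R) by rewrite !mulr_ge0 // ltW.
have h2 : 0 <= es * (k * H_m p * D%:R) by rewrite !mulr_ge0 // ltW.
have h3 : 0 <= es * (w * D%:R) by rewrite !mulr_ge0 // ltW.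
have h4 : es * lambda <= es * (lambda * D%:R) by rewrite ler_pM2l // ler_peMr // ltW.
have h5 : es * w <= es * (w * D%:R) by rewrite ler_pM2l // ler_peMr // ltW.
move: h; rewrite /X; split; lra.
Qed.

Let near := small_bound_gt0.

Let b_r : bounded_near0 (fun es => `|1 - es * lambda|).
Proof. by bounded_near0. Qed.

Let b_rV : bounded_near0 (fun es => `|1 - es * lambda|^-1).
Proof.
apply: (@bounded_near0V _ _ _ (1 / 2) near) => [|es es_gt0 lt_es]; first lra.
have [_ h _ _] := small_bounds es_gt0 lt_es; have := mulr_gt0 es_gt0 lambda_gt0 => h0.
by rewrite ger0_norm; lra.
Qed.

Let b_q : bounded_near0 (fun es => `|1 - es * w|).
Proof. by bounded_near0. Qed.

Let b_qV : bounded_near0 (fun es => `|1 - es * w|^-1).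
Proof.
apply: (@bounded_near0V _ _ _ (1 / 2) near) => [|es es_gt0 lt_es]; first lra.
have [_ _ h _] := small_bounds es_gt0 lt_es; have := mulr_gt0 es_gt0 omega_h_gt0 => h0.
by rewrite ger0_norm; lra.
Qed.

Let b_rVX m : bounded_near0 (fun es => `|1 - es * lambda| ^- m).
Proof.
apply: bounded_near0_le ltr01 _ (bounded_near0X m b_rV) => x _ _.
by rewrite exprVn.
Qed.

Let b_qVX m : bounded_near0 (fun es => `|1 - es * w| ^- m).
Proof.
apply: bounded_near0_le ltr01 _ (bounded_near0X m b_qV) => x _ _.
by rewrite exprVn.
Qed.

Let b_Sy : bounded_near0 (fun es => sigma_y p lambda sigma es).
Proof. by rewrite /sigma_y; bounded_near0. Qed.

(** Numerator and denominator both vanish at 0; for small [es] the quotient is exactly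
    [1 / (w - 2 lambda + es lambda^2)]. *)
Let b_gain : bounded_near0 (fun es => es / (`|1 - es * lambda| ^+ 2 - `|1 - es * w|)).
Proof.
apply: bounded_near0_le near _ (bounded_near0_cst (w - 2 * lambda)^-1) => es es_gt0 lt_es.
have [_ h1 h2 _] := small_bounds es_gt0 lt_es.
have d_gt0 : 0 < w - 2 * lambda by rewrite subr_gt0.
have := mulr_gt0 es_gt0 lambda_gt0 => h3; have := mulr_gt0 es_gt0 omega_h_gt0 => h4.
have -> : `|1 - es * lambda| = 1 - es * lambda by rewrite ger0_norm; lra.
have -> : `|1 - es * w| = 1 - es * w by rewrite ger0_norm; lra.
have -> : (1 - es * lambda) ^+ 2 - (1 - es * w) = es * (w - 2 * lambda + es * lambda ^+ 2) by ring.
have h5 : 0 <= es * lambda ^+ 2 by rewrite mulr_ge0 ?sqr_ge0 // ltW.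
rewrite invfM mulrA divff ?gt_eqF // mul1r !ger0_norm ?invr_ge0 ?lef_pV2 ?posrE //; lra.
Qed.

Let b_Se : bounded_near0 (fun es => sigma_eta p lambda sigma es).
Proof.
rewrite /sigma_eta.
apply: bounded_near0D; first by bounded_near0.
apply: bounded_near0_le ltr01 _ (bounded_near0M (bounded_near0M (bounded_near0_cst w) b_Sy) b_gain).
move=> es _ _; rewrite le_eqVlt; apply/orP; left; apply/eqP; congr `|_|; ring.
Qed.

Let b_E : bounded_near0 (fun es : R => Num.sqrt es).
Proof. by bounded_near0. Qed.

Let sqrt_lt es : 0 < es -> es < small_bound -> Num.sqrt es < 1 / 3.
Proof.
move=> es_gt0 lt_es; have [h _ _ _] := small_bounds es_gt0 lt_es.
have e0 : 0 <= 1 / 3 :> R by rewrite divr_ge0.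
rewrite -[ltRHS]ger0_norm // -sqrtr_sqr ltr_sqrt; last by rewrite exprn_gt0 // divr_gt0.
lra.
Qed.

Let b_oneEV : bounded_near0 (fun es : R => ((1 - Num.sqrt es) * D%:R)^-1).
Proof.
apply: (@bounded_near0V _ _ _ (1 / 2) near) => [|es es_gt0 lt_es]; first lra.
have := sqrt_lt es_gt0 lt_es => h.
have : 1 / 2 * 1 <= (1 - Num.sqrt es) * D%:R by apply: ler_pM => //; lra.
lra.
Qed.

Let b_rho3 : bounded_near0 (fun es => rho3 p k es).
Proof.
rewrite /rho3; apply: bounded_near0M; first exact: bounded_near0_cst.
apply: bounded_near0_sqrt; apply: bounded_near0_sum => i.
apply: bounded_near0M; last exact: bounded_near0_cst.
by apply: bounded_near0X; rewrite /c; bounded_near0.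
Qed.

Let b_DG : bounded_near0 (fun es => Delta_G p k lambda sigma es).
Proof. by rewrite /Delta_G; bounded_near0. Qed.

Let b_Dl : bounded_near0 (fun es => Delta p k lambda sigma es).
Proof. by rewrite /Delta; bounded_near0. Qed.

Let b_Do : bounded_near0 (fun es => Delta_out p k lambda sigma es).
Proof. by rewrite /Delta_out; bounded_near0. Qed.

Let b_alrV : bounded_near0 (fun es => (alpha0 p * `|1 - es * lambda|)^-1).
Proof.
apply: bounded_near0_le ltr01 _ (bounded_near0M (bounded_near0_cst (alpha0 p)^-1) b_rV) => es _ _.
by rewrite invfM.
Qed.

Let b_DY : bounded_near0 (fun es => Delta_Y p k lambda sigma es).
Proof. by rewrite /Delta_Y; bounded_near0. Qed.

(** With [sigma = 2 sigma0] there is room for [(3/2) sigma0], where [3/2] bounds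
    [|1 - es k H_m|^-D], and half of [sigma0] remains for the terms of order [sqrt es]. *)
Lemma feasible : sigma = 2 * sigma0 p -> exists2 eps_max : R, 0 < eps_max &
  forall es, 0 < es -> es < eps_max ->
    [/\ cond_a p es, cond_b p k lambda es & cond_c p k lambda sigma es].
Proof.
move=> sigmaE.
have b_gap : bounded_near0 (fun es => es / (`|1 - es * lambda| - `|1 - es * k * H_m p|)).
  apply: bounded_near0_le near _ (bounded_near0_cst (k * H_m p - lambda)^-1) => es es_gt0 lt_es.
  have [_ h1 _ h2] := small_bounds es_gt0 lt_es.
  have h3 := mulr_gt0 es_gt0 kH_gt0; have h4 := mulr_gt0 es_gt0 lambda_gt0.
  have h5 : es * (k * H_m p) <= D%:R * (es * (k * H_m p)) by rewrite ler_peMl // ltW.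
  have -> : `|1 - es * lambda| = 1 - es * lambda by rewrite ger0_norm; lra.
  have -> : `|1 - es * k * H_m p| = 1 - es * (k * H_m p) by rewrite -mulrA ger0_norm; lra.
  have -> : 1 - es * lambda - (1 - es * (k * H_m p)) = es * (k * H_m p - lambda) by ring.
  by rewrite invfM mulrA divff ?gt_eqF // mul1r.
have [C [d [d_gt0 bC]]] : bounded_near0 (fun es => Delta_G p k lambda sigma es
    + Delta_Y p k lambda sigma es * (es / (`|1 - es * lambda| - `|1 - es * k * H_m p|))).
  by bounded_near0.
have [C' [d' [d'_gt0 bC']]] : bounded_near0 (fun es =>
  Delta_G p k lambda sigma es * `|1 - es * lambda| ^+ D) by bounded_near0.
(* [E X < sigma0] keeps the [sqrt es] terms, [E ((3/2) C' + C)], below [sigma0 / 2]; the added 1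
   makes [X] positive. *)
set X := 2 * (3 / 2 * `|C'| + `|C| + 1).
have X_gt0 : 0 < X by rewrite /X; have := normr_ge0 C; have := normr_ge0 C'; lra.
have m_gt0 : 0 < (sigma0 p / X) ^+ 2 by rewrite exprn_gt0 // divr_gt0.
exists (Num.min small_bound (Num.min d (Num.min d' ((sigma0 p / X) ^+ 2)))).
  by rewrite !lt_min near d_gt0 d'_gt0.
move=> es es_gt0; rewrite !lt_min => /and4P[lt_es lt_d lt_d' lt_m].
have [_ h1 h2 h3] := small_bounds es_gt0 lt_es.
have E_lt := sqrt_lt es_gt0 lt_es.
have E_gt0 : 0 < Num.sqrt es by rewrite sqrtr_gt0.
have EX : Num.sqrt es * X < sigma0 p.
  rewrite -ltr_pdivlMr // -[ltRHS]ger0_norm ?divr_ge0 ?(ltW X_gt0) ?(ltW sigma0_gt0) //.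
  by rewrite -sqrtr_sqr ltr_sqrt.
have h4 := mulr_gt0 es_gt0 kH_gt0; have h5 := mulr_gt0 es_gt0 lambda_gt0.
have h6 := mulr_gt0 es_gt0 omega_h_gt0.
have h7 : es * (k * H_m p) <= D%:R * (es * (k * H_m p)) by rewrite ler_peMl // ltW.
split.
- rewrite /cond_a; apply: (@leq_trans (n * 1 * 3)).
    by rewrite muln1 (mulnC n 3) (mulSn 2) addnC leq_add2r.
  rewrite !leq_mul // truncn_gt_nat ler_pdivlMr //; lra.
- have h8 : 0 <= es * (es * lambda ^+ 2) by rewrite !mulr_ge0 ?sqr_ge0 // ltW.
  by rewrite /cond_b /Num.max; case: ifP => _; lra.
split; [by rewrite gt_eqF //; lra..|].
have qE : `|1 - es * k * H_m p| = 1 - es * (k * H_m p) by rewrite -mulrA ger0_norm; lra.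
have qV : `|1 - es * k * H_m p| ^- D <= 3 / 2.
  have qD : 1 - D%:R * (es * (k * H_m p)) <= (1 - es * (k * H_m p)) ^+ D.
    by apply: bernoulli_ineq; lra.
  have -> : 3 / 2 = (2 / 3)^-1 :> R by rewrite invf_div.
  by rewrite qE lef_pV2 ?posrE ?exprn_gt0 //; lra.
have b1 := bC _ es_gt0 lt_d; have b2 := bC' _ es_gt0 lt_d'.
have e2 : Num.sqrt es ^+ 2 = es by rewrite sqr_sqrtr // ltW.
set E := Num.sqrt es in E_lt E_gt0 EX e2 *.
set G := Delta_G _ _ _ _ _ in b1 b2 *; set g := `|1 - es * lambda| - _ in b1 *.
have -> : E ^+ 3 * Delta_Y p k lambda sigma es / g = E * (Delta_Y p k lambda sigma es * (es / g)).
  by rewrite exprS e2; ring.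
rewrite -addrA -mulrDr.
have t1 : E * (G + Delta_Y p k lambda sigma es * (es / g)) <= E * `|C|.
  by rewrite ler_pM2l // (le_trans (ler_norm _)) // (le_trans b1) // ler_norm.
have t2 : (sigma0 p + E * G * `|1 - es * lambda| ^+ D) * `|1 - es * k * H_m p| ^- D <=
    (sigma0 p + E * `|C'|) * (3 / 2).
  have t3 : E * G * `|1 - es * lambda| ^+ D <= E * `|C'|.
    by rewrite -mulrA ler_pM2l // (le_trans (ler_norm _)) // (le_trans b2) // ler_norm.
  apply: (@le_trans _ _ ((sigma0 p + E * `|C'|) * `|1 - es * k * H_m p| ^- D)).
    by rewrite ler_wpM2r ?invr_ge0 ?exprn_ge0 // lerD2l.
  by rewrite ler_wpM2l // addr_ge0 ?mulr_ge0 // ltW.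
apply: le_lt_trans (lerD t2 t1) _; move: EX; rewrite sigmaE /X.
by have := E_gt0; set c := `|C|; set c' := `|C'|; lra.
Qed.

End Feasibility.

Theorem theorem1 (R : realType) (n : nat) (p : design R n)
    (n_gt0 : (0 < n)%N) (D_M_gt0 : (0 < D_M p)%N)
    (H_m_gt0 : 0 < H_m p) (H_M_gt0 : 0 < H_M p)
    (sigma0_gt0 : 0 < sigma0 p) (Delta_Q_gt0 : 0 < Delta_Q p)
    (a_gt0 : forall i, 0 < a p i) (alpha0_gt0 : 0 < alpha0 p)
    (omega_h_gt0 : 0 < omega_h p) :
  (forall k lambda sigma eps_star : R,
     0 < k -> 0 < lambda -> lambda < k * H_m p -> 2 * lambda < omega_h p ->
     sigma0 p < sigma -> 0 < eps_star ->
     cond_a p eps_star ->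
     cond_b p k lambda eps_star ->
     cond_c p k lambda sigma eps_star ->
     forall eps : R, 0 < eps -> eps <= eps_star ->
     let r := `|1 - eps * lambda| in
     r < 1 /\
     exists C : R,
     forall (H : 'M[R]_n) (theta_star theta_init : 'cV[R]_n)
       (lo hi : 'I_n -> R) (Q_star Q_0 : R) (D : nat -> nat)
       (theta_hat : nat -> 'cV[R]_n) (eta : nat -> R),
     H^T = H ->
     (forall x : 'cV[R]_n, H_m p * enorm x ^+ 2 <= wnorm2 H x
                           /\ wnorm2 H x <= H_M p * enorm x ^+ 2) ->
     (forall i, lo i <= theta_star i 0 <= hi i) ->
     \sum_i (hi i - lo i) ^+ 2 = sigma0 p ^+ 2 ->
     enorm (theta_init - theta_star) <= sigma0 p ->
     `|Q_star - Q_0| <= Delta_Q p ->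
     (forall j, (D j <= D_M p)%N) ->
     algorithm p k lambda eps (quad_map H theta_star Q_star) D
       theta_init Q_0 theta_hat eta ->
     let theta_err j := theta_hat j - theta_star in
     let eta_err j := eta j - Q_star in
     let theta := input p lambda eps theta_init theta_hat in
     [/\ forall j, (D_M p <= j)%N ->
           enorm (theta_err j) < sigma * r ^+ j
           /\ `|eta_err j|
              < sigma_eta p lambda sigma eps_star * r ^+ (2 * j),
         forall j, (D_M p <= j)%N ->
           enorm (theta_err j) <= C * r ^+ j /\ `|eta_err j| <= C * r ^+ j
       & forall j, enorm (theta j - theta_star) <= C * r ^+ j])
  /\
  (exists k_max lambda_max : R, [/\ 0 < k_max, 0 < lambda_max &
     forall k lambda : R,
       0 < k -> k < k_max -> 0 < lambda -> lambda < lambda_max ->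
       lambda < k * H_m p -> 2 * lambda < omega_h p ->
       exists sigma eps_max : R, [/\ sigma0 p < sigma, 0 < eps_max &
         forall eps_star : R, 0 < eps_star -> eps_star < eps_max ->
           [/\ cond_a p eps_star,
               cond_b p k lambda eps_star
             & cond_c p k lambda sigma eps_star]]]).
Proof.
split; last first.
  (* [sigma] and [eps_max] are chosen after the gains, so any positive upper bounds for [k] and
     [lambda] can serve as witnesses. *)
  exists 1, 1; split=> // k lambda k_gt0 _ lambda_gt0 _ lt_kH lt_w.
  have [eps_max eps_max_gt0 feas] := feasible n_gt0 D_M_gt0 H_m_gt0 sigma0_gt0 omega_h_gt0
    k_gt0 lambda_gt0 lt_w (erefl (2 * sigma0 p)).
  by exists (2 * sigma0 p), eps_max; split=> //; lra.
move=> k lambda sigma es k_gt0 lambda_gt0 lt_kH lt_w lt_sigma es_gt0 ca cb cc eps eps_gt0 le_eps.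
have /andP[r_gt0 r_lt1] := decay_rate lambda_gt0 lt_kH es_gt0 cb eps_gt0 le_eps.
rewrite /= gtr0_norm //; split=> //; set r := 1 - eps * lambda in r_gt0 r_lt1 *.
pose Se := sigma_eta p lambda sigma es.
exists (sigma + alpha0 p * norm_a p + `|Se| + sigma0 p * r ^- D_M p).
move=> H theta_star theta_init lo hi Q_star Q_0 D theta_hat eta H_sym H_bd _ _ th_init Q_init D_le alg.
have decay := exponential_decay n_gt0 D_M_gt0 H_m_gt0 sigma0_gt0 Delta_Q_gt0 a_gt0 alpha0_gt0
  omega_h_gt0 k_gt0 lambda_gt0 lt_kH lt_w lt_sigma es_gt0 ca cb cc eps_gt0 le_eps
  H_sym H_bd th_init Q_init D_le alg.
have rj_gt0 j : 0 < r ^+ j by rewrite exprn_gt0.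
have A_ge0 : 0 <= alpha0 p * norm_a p by rewrite mulr_ge0 ?norm_a_ge0 // ltW.
have init_ge0 : 0 <= sigma0 p * r ^- D_M p by rewrite mulr_ge0 ?invr_ge0 ?ltW.
have Se_ge0 := normr_ge0 Se.
split=> // [j le_Dj|j].
  have [th_lt eta_lt] := decay j le_Dj; split.
    by apply: le_trans (ltW th_lt) _; rewrite ler_pM2r //; lra.
  apply: le_trans (ltW eta_lt) _; apply: (@le_trans _ _ (`|Se| * r ^+ j)).
    apply: (@le_trans _ _ (`|Se| * r ^+ (2 * j))); first by rewrite ler_pM2r ?ler_norm.
    by rewrite ler_wpM2l // ler_wiXn2l ?(ltW r_gt0) ?(ltW r_lt1) // leq_pmull.
  by rewrite ler_pM2r //; lra.
rewrite /input; case: leqP => [le_jD|lt_Dj].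
  apply: le_trans th_init _; apply: (@le_trans _ _ (sigma0 p * r ^- D_M p * r ^+ j)).
    rewrite -mulrA ler_peMr ?(ltW sigma0_gt0) // mulrC ler_pdivlMr // mul1r.
    by rewrite ler_wiXn2l ?(ltW r_gt0) ?(ltW r_lt1).
  by rewrite ler_pM2r //; lra.
have [th_lt _] := decay j (ltnW lt_Dj).
rewrite addrAC; apply: le_trans (enormD _ _) _.
apply: (@le_trans _ _ (sigma * r ^+ j + alpha0 p * norm_a p * r ^+ j)); last first.
  by rewrite -mulrDl ler_pM2r //; lra.
apply: lerD (ltW th_lt) _; rewrite enormZ /alpha -/r gtr0_norm ?mulr_gt0 //.
by rewrite mulrAC ler_pM2r // ler_pM2l // dither_le.
Qed.
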